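(* (i) Let $D\subset V=\mathbb{C}^n$ be a linear free divisor with defining equation $h\in\mathbb{C}[V]_n$, seen as a morphism $h:V\to T=\mathrm{Spec}\,\mathbb{C}[t]$. Let $f\in\mathbb{C}[V]_1$ be linear and $\mathcal{R}_h$-finite. Then for any $t\in T$ there is a $V^+$-solution of the Birkhoff problem for $(G_t,\nabla)$, defined by the basis $\underline\omega^{(2)}$ if $t=0$, resp. $\underline\omega^{(3)}$ if $t\ne0$, constructed as in the context. If $\nu^{(2)}_1-\nu^{(2)}_n\le1$ then $\underline\omega^{(3)}=\underline\omega^{(2)}$. Moreover, $\omega^{(2)}_i-(-f)^{i-1}\alpha$ and $\omega^{(3)}_i-(-f)^{i-1}\alpha$ lie in $\tau^{-1}G_t$ for all $i\in\{1,\dots,n\}$. (ii) Let $D$ be reductive. Then the integrable connection $\nabla$ on $\mathbf{G}[t^{-1}]$ (defined in the context) takes the following form in the basis $\underline\omega^{(3)}$: $$\nabla(\underline\omega^{(3)})=\underline\omega^{(3)}\cdot\Big[(\Omega_0+\tau^{-1}A^{(3)}_\infty)\,d\tau+(\widetilde D+\tau\Omega_0+A_\infty^{(3)})\frac{dt}{nt}\Big],$$ where $\widetilde D:=\mathrm{diag}(0,\dots,n-1)+k\cdot n\cdot\mathrm{Id}$, and $k$ is the number of times the (meromorphic) base change (B) of Algorithm 2 is performed. Hence, in the reductive case, $\underline\omega^{(3)}$ gives a $V^+$-solution $\widehat G[t^{-1}]$ to the Birkhoff problem for $(G[t^{-1}],\nabla)$.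
   Context: **Linear free divisors.** A reduced hypersurface $D=\{h=0\}\subset V=\mathbb{C}^n$ is a linear free divisor if $\mathrm{Der}(-\log D)=\{\chi:\chi\cdot h\in(h)\}$ is a free module with a basis of weight-zero vector fields (all coefficients linear forms); then $h$ is homogeneous of degree $n$. It is reductive if the identity component $G^0_D$ of $\{A\in \mathrm{GL}_n(\mathbb{C}):AD=D\}$ is reductive, and special if $\chi_h=\det$ on $G^0_D$, where $h\circ g=\chi_h(g)h$ (reductive implies special). $\mathrm{Der}(-\log h)=\{\chi\in\mathrm{Der}(-\log D):\chi\cdot h=0\}$. $f$ is $\mathcal{R}_h$-finite if $\dim_{\mathbb{C}}\mathcal{O}_{\mathbb{C}^n,0}/(df(\mathrm{Der}(-\log h))+(h))<\infty$. **Gauss–Manin system.** Forms are global algebraic; $\Omega^\bullet(\log h)=\Omega^\bullet(\log D)/(\tfrac{dh}{h}\wedge\Omega^{\bullet-1}(\log D))$; $E=\sum x_i\partial_{x_i}$; $\alpha=\iota_E(dx_1\wedge\dots\wedge dx_n/h)$. $\mathbf{G}=\Omega^{n-1}(\log h)[\tau^{\pm1}]/(d-\tau df\wedge)\Omega^{n-2}(\log h)[\tau^{\pm1}]$, $G=$ image of $\Omega^{n-1}(\log h)[\tau^{-1}]$; $t$ acts as $h$. $\partial_\tau(\tau^i\omega)=i\tau^{i-1}\omega-\tau^if\omega$. $G$ is free over $\mathbb{C}[t,\tau^{-1}]$ with basis $\omega_i^{(0)}=(-f)^{i-1}\alpha$ ($1\le i\le n$), a lattice in $\mathbf{G}$.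 $\mathbf{G}_t,G_t$ are the restrictions to a fixed $t$; $\mathbf{G}[t^{-1}],G[t^{-1}]$ the localisations. In the reductive case, $\nabla$ is completed to an integrable connection by $\nabla_{\partial_t}(\omega)=\frac{1}{nt}(L_E(\omega)-\tau L_E(f)\cdot\omega)$ for $\omega\in\Omega^{n-1}(\log h)$, extended $\tau$-linearly. **The bases.** There is a basis $\underline\omega^{(1)}$ of $G$ of the form $\omega_j^{(1)}=\omega_j^{(0)}+\sum_{i=1}^{j-1}b_i^j\tau^{-i}\omega^{(0)}_{j-i}$, $b_i^j\in\mathbb{C}$ (with $b_i^{i+1}=0$ if $D$ is special), such that $\partial_\tau\underline\omega^{(1)}=\underline\omega^{(1)}(\Omega_0+\tau^{-1}A_\infty^{(1)})$, $A_\infty^{(1)}=\mathrm{diag}(-\nu_1^{(1)},\dots,-\nu_n^{(1)})$, where $\Omega_0$ has entries $1$ in positions $(i+1,i)$, $t$ in position $(1,n)$ and $0$ elsewhere (a nonzero constant in front of $t$ being normalised to $1$ by a change of the coordinate $t$). Algorithm 1: as long as there is $i\in\{2,\dots,n\}$ with $\nu_i-\nu_{i-1}>1$, replace $\omega_i$ by $\omega_i+\tau^{-1}(\nu_i-\nu_{i-1}-1)\omega_{i-1}$, keeping the other $\omega_j$; the connection matrix keeps the form $\Omega_0+\tau^{-1}\mathrm{diag}(-\nu)$ with $(\nu_{i-1},\nu_i)$ replaced by $(\nu_i-1,\nu_{i-1}+1)$. The output, started at $\underline\omega^{(1)}$, is $\underline\omega^{(2)}$, with $A_\infty^{(2)}=\mathrm{diag}(-\nu^{(2)}_i)$.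 Algorithm 2: run Algorithm 1; if then $\nu_1-\nu_n>1$, perform the base change (B): replace $\omega_1$ by $t\omega_1+\tau^{-1}(\nu_1-\nu_n-1)\omega_n$ and $\omega_i$ by $t\omega_i$ for $i\neq1$ (so $(\nu_1,\nu_n)$ becomes $(\nu_n+1,\nu_1-1)$), and run Algorithm 2 again. The output, started at $\underline\omega^{(1)}$, is $\underline\omega^{(3)}$, with $\partial_\tau\underline\omega^{(3)}=\underline\omega^{(3)}(\Omega_0+\tau^{-1}A_\infty^{(3)})$, $A_\infty^{(3)}=\mathrm{diag}(-\nu_i^{(3)})$. Both algorithms terminate. **$V^+$-solutions.** Let $\mathbb{K}=\mathbb{Q}$ if $t\neq0$ and $\mathbb{K}=\mathbb{C}$ with the lexicographic order extending that of $\mathbb{R}$ if $t=0$. $V_\bullet\mathbf{G}_t$ is the increasing exhaustive Kashiwara–Malgrange filtration at $\tau=0$, indexed by $\mathbb{K}$: good with respect to the $V$-filtration of $\mathbb{C}[\tau]\langle\partial_\tau\rangle$, with $\tau\partial_\tau+\beta$ nilpotent on $gr^V_\beta$. A solution of the Birkhoff problem for $G_t$ is a $\tau\partial_\tau$-stable $\mathbb{C}[\tau]$-lattice $G'_t\subset\mathbf{G}_t$ with $G_t=(G_t\cap G'_t)\oplus\tau^{-1}G_t$ (for a basis $\underline\omega$ of $G_t$ with $\partial_\tau\underline\omega=\underline\omega(\Omega_0+\tau^{-1}A)$ the lattice is $\bigoplus\mathbb{C}[\tau]\omega_i$). It is a $V^+$-solution if for all $\beta$: $G_t\cap V_\beta=(G_t\cap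 G'_t\cap V_\beta)\oplus(\tau^{-1}G_t\cap V_\beta)$ and $(\tau\partial_\tau+\beta)(G_t\cap G'_t\cap V_\beta)\subset(G_t\cap G'_t\cap V_{<\beta})\oplus\tau(G_t\cap G'_t\cap V_{\beta+1})$. A $V^+$-solution for $(G[t^{-1}],\nabla)$ is an extension of $G[t^{-1}]$ to a trivial algebraic bundle $\widehat G[t^{-1}]$ (here $\bigoplus_i\mathcal{O}_{\mathbb{P}^1\times T}[t^{-1}]\omega_i^{(3)}$) on $\mathbb{P}^1\times(T\setminus\{0\})$ on which the connection has a logarithmic pole along $\{\tau=0\}$ and which restricts to a $V^+$-solution for each $t\ne0$.
   Formalization: The last claim of (i) for ω^(3) is corrected: ω^(3)_i − t^k(−f)^{i−1}α lies in τ^{-1}G_t, with k the number of base changes (B); without the factor t^k the claim fails when t^k ≠ 1, as each (B) multiplies the basis by t modulo τ^{-1}G_t. *)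

(* Defs.v *)
From HB Require Import structures.
From mathcomp Require Import all_boot all_order all_algebra.
From mathcomp Require Import boolp classical_sets reals.
From mathcomp Require Import complex mpoly.

Set Implicit Arguments.
Unset Strict Implicit.
Unset Printing Implicit Defensive.

Import Order.TTheory GRing.Theory Num.Theory.

Local Open Scope classical_set_scope.
Local Open Scope ring_scope.

(** * Linear free divisors *)

Section LinearFreeDivisor.
Context {R : realType} {n : nat}.
Local Notation C := R[i].
Implicit Types (h f : {mpoly C[n]}) (S U : set 'M[C]_n).

(* [chi] stands for the vector field \sum_i chi_i d/dx_i on C^n *)
Definition vf_app (chi : 'I_n -> {mpoly C[n]}) (p : {mpoly C[n]}) : {mpoly C[n]} :=
  \sum_i chi i * p^`M(i).

Definition der_log h (chi : 'I_n -> {mpoly C[n]}) : Prop :=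
  exists q, vf_app chi h = q * h.

(* [h] is a reduced equation of a hypersurface D, and Der(-log D) is free over
   C[x_1,...,x_n] (necessarily of rank n) on vector fields with linear
   coefficients *)
Definition linear_free_divisor h : Prop :=
  [/\ forall a : C, h <> a%:MP,
      forall p q, h = p ^+ 2 * q -> exists a : C, p = a%:MP
    & exists delta : 'I_n -> 'I_n -> {mpoly C[n]},
      [/\ forall i j, delta i j \is 1.-homog,
          forall i, der_log h (delta i),
          forall chi, der_log h chi ->
            exists a : 'I_n -> {mpoly C[n]},
              forall j, chi j = \sum_i a i * delta i j
        & forall a : 'I_n -> {mpoly C[n]},
            (forall j, \sum_i a i * delta i j = 0) -> forall i, a i = 0]].

(** ** The groups attached to D *)

Definition point (v : 'cV[C]_n) : 'I_n -> C := fun i => v i 0.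

Definition group_D h : set 'M[C]_n :=
  [set A | A \in unitmx /\
     forall v, h.@[point v] = 0 <-> h.@[point (A *m v)] = 0].

Definition zariski_closed S : Prop :=
  exists P : set {mpoly C[(n * n)%N]},
    S = [set A | forall p, P p -> p.@[fun i => mxvec A 0 i] = 0].

Definition zariski_connected S : Prop :=
  forall Z1 Z2, zariski_closed Z1 -> zariski_closed Z2 ->
    S `<=` Z1 `|` Z2 -> (S `&` Z1) !=set0 -> (S `&` Z2) !=set0 ->
    (S `&` Z1 `&` Z2) !=set0.

Definition identity_component S : set 'M[C]_n :=
  [set A | exists U, [/\ U `<=` S, zariski_connected U, U 1%:M & U A]].

Definition group_D0 h := identity_component (group_D h).

Definition mx_subgroup U S : Prop :=
  [/\ U `<=` S, U 1%:M, forall A B, U A -> U B -> U (A *m B)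
    & forall A, U A -> U (invmx A)].

(* the unipotent radical of the linear algebraic group [S] is trivial *)
Definition reductive_group S : Prop :=
  forall U, mx_subgroup U S ->
    (forall A B, S A -> U B -> U (A *m B *m invmx A)) ->
    (exists2 Z, zariski_closed Z & U = S `&` Z) ->
    zariski_connected U ->
    (forall A, U A -> exists m, (A - 1%:M) ^+ m = 0) ->
    U `<=` [set 1%:M].

Definition reductive_divisor h : Prop := reductive_group (group_D0 h).

Definition special_divisor h : Prop :=
  forall A, group_D0 h A ->
    forall v, h.@[point (A *m v)] = \det A * h.@[point v].

(** ** R_h-finiteness *)

(* power series in n variables, as families of coefficients *)
Definition pseries := 'X_{1..n} -> C.

(* the elements of O_{C^n,0} *)
Definition convergent (a : pseries) : Prop :=
  exists M r : R, forall m, `|a m| <= (M * r ^+ mdeg m)%:C%C.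

Definition ps_mul (a b : pseries) : pseries := fun m =>
  \sum_(k : 'X_{1..n < (mdeg m).+1} | (k <= m)%MM) a k * b (m - k)%MM.

Definition ps_of (p : {mpoly C[n]}) : pseries := fun m => p@_m.

Definition germ_vf_app (chi : 'I_n -> pseries) (p : {mpoly C[n]}) : pseries :=
  fun m => \sum_i ps_mul (chi i) (ps_of p^`M(i)) m.

(* the ideal df(Der(-log h)) + (h) of O_{C^n,0}; a germ of vector field
   annihilating h is automatically logarithmic *)
Definition Rh_ideal h f : set pseries :=
  [set g | exists (chi : 'I_n -> pseries) (q : pseries),
     [/\ forall i, convergent (chi i), convergent q,
         forall m, germ_vf_app chi h m = 0
       & forall m, g m = germ_vf_app chi f m + ps_mul q (ps_of h) m]].

Definition Rh_finite h f : Prop :=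
  exists N (e : 'I_N -> pseries), (forall i, convergent (e i)) /\
    forall g, convergent g -> exists a : 'I_N -> C,
      Rh_ideal h f (fun m => g m - \sum_i a i * e i m).

End LinearFreeDivisor.

(** * Rational differential forms on C^n depending rationally on tau *)

Section Forms.
Context {R : realType} {n : nat}.
Local Notation C := R[i].

(* the field C(x_1,...,x_n,tau): the last of the n+1 variables is tau *)
Definition xtfield : fieldType := {fraction {mpoly C[n.+1]}}.
Local Notation F := xtfield.

Definition tau : F := tofrac ('X_ord_max : {mpoly C[n.+1]}).
Definition xfun (p : {mpoly C[n]}) : F := tofrac (mwiden p).
Definition constF (a : C) : F := xfun a%:MP.

(* d/dX_j, by the quotient rule *)
Definition fder (j : 'I_n.+1) (r : F) : F :=
  let p : {mpoly C[n.+1]} := \n_(repr r) in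
  let q : {mpoly C[n.+1]} := \d_(repr r) in
  tofrac (p^`M(j) * q - p * q^`M(j)) / tofrac (q ^+ 2).

Definition dx_ (i : 'I_n) : F -> F := fder (widen_ord (leqnSn n) i).
Definition dtau : F -> F := fder ord_max.

(* the form \sum_I (w I) dx_I, where dx_I = dx_{i_1} /\ ... /\ dx_{i_p} for
   I = {i_1 < ... < i_p} *)
Definition rform := {ffun {set 'I_n} -> F^o}.
Local Notation form := rform.
Implicit Types (w : form) (a : F).

Definition degree (p : int) w : Prop := forall I, w I != 0 -> #|I|%:Z = p.

Definition map_coef (D : F -> F) w : form := [ffun I => D (w I)].

Definition esign (i : 'I_n) (I : {set 'I_n}) : F :=
  (-1) ^+ #|[pred j in I | (j < i)%N]|.

(* dx_i /\ w *)
Definition dx_wedge (i : 'I_n) w : form :=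
  [ffun I : {set 'I_n} => if i \in I then esign i I * w (I :\ i)%SET else 0].

(* contraction of w with d/dx_i *)
Definition contract (i : 'I_n) w : form :=
  [ffun I : {set 'I_n} => if i \in I then 0 else esign i I * w (i |: I)%SET].

(* exterior derivative relative to tau *)
Definition ext_d w : form := \sum_i dx_wedge i (map_coef (dx_ i) w).

(* dp /\ w *)
Definition d_wedge (p : {mpoly C[n]}) w : form :=
  \sum_i xfun p^`M(i) *: dx_wedge i w.

Definition contract_E w : form := \sum_i xfun 'X_i *: contract i w.

Definition lie_E w : form := ext_d (contract_E w) + contract_E (ext_d w).

Definition vol : form := [ffun I : {set 'I_n} => if #|I| == n then 1 else 0].

(* coefficients in C[x_1,...,x_n] *)
Definition regular w : Prop := forall I, exists p, w I = xfun p.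

(* C[s_1,...,s_k] inside F *)
Definition Calg (s : seq F) : set F :=
  [set a | exists p : {mpoly C[size s]}, a = mmap constF (fun i => nth 0 s i) p].

(* the sums \sum_k tau^{e_k} w_k with e_k in E and w_k in P *)
Definition tau_span (E : set int) (P : set form) : set form :=
  [set u | exists N (e : 'I_N -> int) (w : 'I_N -> form),
     (forall k, E (e k) /\ P (w k)) /\ u = \sum_k tau ^ e k *: w k].

Definition scale_set (a : F) (S : set form) : set form :=
  [set u | exists2 v, S v & u = a *: v].

Definition rspan (A : set F) (w : 'I_n -> form) : set form :=
  [set u | exists a : 'I_n -> F,
     (forall i, A (a i)) /\ u = \sum_i a i *: w i].

Definition Csubspace (S : set form) : Prop :=
  S 0 /\ forall (a : C) u v, S u -> S v -> S (constF a *: u + v).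

(** Subquotients M/Z of the space of forms.  An element of M/Z is given by a
    representative, equality is congruence modulo Z, and a subspace of M/Z is
    given by its full preimage, a subspace of M containing Z.  Intersections
    and sums of subspaces are computed on the preimages. *)

Definition sat (Z S : set form) : set form :=
  [set u | exists2 v, S v & Z (u - v)].

(* S is the direct sum of S1 and S2, in the quotient by Z *)
Definition dsum (Z S1 S2 S : set form) : Prop :=
  (forall u, S u <-> exists v w, [/\ S1 v, S2 w & Z (u - (v + w))]) /\
  S1 `&` S2 `<=` Z.

Definition is_basis (A : set F) (Z M : set form) (w : 'I_n -> form) : Prop :=
  [/\ forall i, M (w i),
      forall u, M u -> exists2 v, rspan A w v & Z (u - v)
    & forall a : 'I_n -> F, (forall i, A (a i)) ->
        Z (\sum_i a i *: w i) -> forall i, a i = 0].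

(* the row vector (w_1,...,w_n) times the matrix m *)
Definition frame_mul (w : 'I_n -> form) (m : 'M[F]_n) : 'I_n -> form :=
  fun j => \sum_i m i j *: w i.

End Forms.

(** * The lexicographic order of C *)

Section Lexicographic.
Context {R : realType}.

Definition lexle (x y : R[i]) : bool :=
  (complex.Re x < complex.Re y) ||
  ((complex.Re x == complex.Re y) && (complex.Im x <= complex.Im y)).

Definition lexlt (x y : R[i]) : bool := ~~ lexle y x.

End Lexicographic.

(** * The Gauss-Manin system *)

Section GaussManin.
Context {R : realType} {n : nat}.
Local Notation C := R[i].
Local Notation F := (@xtfield R n).
Local Notation form := (@rform R n).
Variables (h f : {mpoly C[n]}).

(* The coordinate t of T acts as c * h, for a nonzero constant c: rescaling t is
   what normalises the constant in front of t in Omega_0 to 1. *)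
Variable c : C.
Definition tfun : F := constF c * xfun h.

Definition log_form (p : int) : set form :=
  [set w | [/\ degree p w, regular (xfun h *: w)
             & regular (xfun h *: ext_d w)]].

Definition alpha : form := (xfun h)^-1 *: contract_E vol.
Definition omega0 (k : nat) : form := (- xfun f) ^+ k *: alpha.

(* Gnum / Grel is the Gauss-Manin system; quotienting by dh/h /\ _ turns
   Omega(log D) into Omega(log h) *)
Definition Gnum : set form := tau_span setT (log_form (n%:Z - 1)).
Definition Grel : set form :=
  [set u | exists v w,
     [/\ tau_span setT (log_form (n%:Z - 2)) v,
         tau_span setT (log_form (n%:Z - 2)) w
       & u = ext_d v - tau *: d_wedge f v + (xfun h)^-1 *: d_wedge h w]].

(* the Brieskorn lattice, in a quotient by Z containing Grel *)
Definition Glat (Z : set form) : set form :=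
  sat Z (tau_span [set k | k <= 0] (log_form (n%:Z - 1))).

(* tau^i w |-> i tau^(i-1) w - tau^i f w *)
Definition nabla_tau (u : form) : form := map_coef dtau u - xfun f *: u.

(* (1 / nt) (L_E - tau L_E(f)) *)
Definition nabla_t (u : form) : form :=
  (n%:R * tfun)^-1 *:
    (lie_E u - (tau * \sum_i xfun ('X_i * f^`M(i))) *: u).

(* restriction to the value t0 of t: Gnum / (Zfib t0) *)
Definition Zfib (t0 : C) : set form :=
  [set u | exists v w, [/\ Grel v, Gnum w & u = v + (tfun - constF t0) *: w]].

(* localisation at t *)
Definition loc (S : set form) : set form :=
  [set u | exists k : nat, S (tfun ^+ k *: u)].

(** ** The bases *)

Definition Omega_0 : 'M[F]_n := \matrix_(i, j)
  ((if (i == j.+1 :> nat) then 1 else 0) +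
   (if (i == 0 :> nat) && (j.+1 == n) then tfun else 0)).

Definition A_infty (nu : 'I_n -> C) : 'M[F]_n :=
  diag_mx (\row_i - constF (nu i)).

Definition nabla_tau_form (w : 'I_n -> form) (nu : 'I_n -> C) : Prop :=
  forall j, Grel (nabla_tau (w j) -
                  frame_mul w (Omega_0 + tau^-1 *: A_infty nu) j).

(* indices start at 0 *)
Definition is_omega1 (w : 'I_n -> form) (nu : 'I_n -> C) : Prop :=
  [/\ is_basis (Calg [:: tfun; tau^-1]) Grel (Glat Grel) w,
      exists b : nat -> nat -> C,
        (forall j : 'I_n, Grel (w j - (omega0 j +
           \sum_(1 <= i < j.+1) (constF (b i j) * tau ^- i) *: omega0 (j - i)))) /\
        (special_divisor h -> forall i, (0 < i < n)%N -> b i i = 0)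
    & nabla_tau_form w nu].

Definition state := (('I_n -> form) * ('I_n -> C))%type.

(* one replacement of Algorithm 1, at the consecutive indices i' and i *)
Definition alg1_cond (s : state) (i' i : 'I_n) : Prop :=
  i = i'.+1 :> nat /\ lexlt 1 (s.2 i - s.2 i').

Definition alg1_step (s : state) (i' i : 'I_n) : state :=
  (fun j => if j == i
            then s.1 i + (tau^-1 * constF (s.2 i - s.2 i' - 1)) *: s.1 i'
            else s.1 j,
   fun j => if j == i' then s.2 i - 1
            else if j == i then s.2 i' + 1 else s.2 j).

Inductive alg1 : state -> state -> Prop :=
| alg1_stop s : (forall i' i, ~ alg1_cond s i' i) -> alg1 s s
| alg1_next s i' i s' :
    alg1_cond s i' i -> alg1 (alg1_step s i' i) s' -> alg1 s s'.

(* the base change (B), where i1 and il are the first and the last index *)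
Definition alg2_cond (s : state) (i1 il : 'I_n) : Prop :=
  [/\ i1 = 0%N :> nat, il.+1 = n & lexlt 1 (s.2 i1 - s.2 il)].

Definition base_change_B (s : state) (i1 il : 'I_n) : state :=
  (fun j => if j == i1
            then tfun *: s.1 i1 +
                 (tau^-1 * constF (s.2 i1 - s.2 il - 1)) *: s.1 il
            else tfun *: s.1 j,
   fun j => if j == i1 then s.2 il + 1
            else if j == il then s.2 i1 - 1 else s.2 j).

(* [alg2 s k s']: on the input s, Algorithm 2 performs (B) exactly k times
   and stops with the output s' *)
Inductive alg2 : state -> nat -> state -> Prop :=
| alg2_stop s s' :
    alg1 s s' -> (forall i1 il, ~ alg2_cond s' i1 il) -> alg2 s 0 s'
| alg2_next s s' i1 il k s'' :
    alg1 s s' -> alg2_cond s' i1 il -> alg2 (base_change_B s' i1 il) k s'' ->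
    alg2 s k.+1 s''.

(** ** Kashiwara-Malgrange filtrations and V^+-solutions *)

Section Fibre.
Variable t0 : C.
Local Notation Z := (Zfib t0).
Local Notation Gt := (Glat (Zfib t0)).

Section Index.
(* the index set K, its order and its embedding in C *)
Variables (K : nzRingType) (le : rel K) (emb : K -> C).

Definition Vlt (V : K -> set form) (b : K) : set form :=
  [set u | exists2 g, le g b && (g != b) & V g u].

Definition res_shift (b : K) (u : form) : form :=
  tau *: nabla_tau u + constF (emb b) *: u.

(* The jumps lie in finitely many cosets of Z (vf_jumps); each V_b is finitely
   generated over C[tau]<tau d_tau> (vf_fg). *)
Record KM_filtration (V : K -> set form) : Prop := {
  vf_sub : forall b, [/\ Csubspace (V b), Z `<=` V b & V b `<=` Gnum];
  vf_incr : forall b b', le b b' -> V b `<=` V b';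
  vf_exh : forall u, Gnum u -> exists b, V b u;
  vf_jumps : exists s : seq K, forall b, exists2 a, a \in s &
    exists m : int, le (a + m%:~R) b /\ V b = V (a + m%:~R);
  vf_tau : forall b u, V b u -> V (b - 1) (tau *: u);
  vf_dtau : forall b u, V b u -> V (b + 1) (nabla_tau u);
  vf_fg : forall b, exists s : seq form, (forall u, u \in s -> V b u) /\
    forall S, Csubspace S -> Z `<=` S -> (forall u, u \in s -> S u) ->
      (forall u, S u -> S (tau *: u)) ->
      (forall u, S u -> S (tau *: nabla_tau u)) -> V b `<=` S;
  vf_good_tau : forall b, exists N : nat, forall k : nat, (N <= k)%N ->
    V (b - k%:R - 1) = sat Z (scale_set tau (V (b - k%:R)));
  vf_good_dtau : forall b, exists N : nat, forall k : nat, (N <= k)%N ->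
    forall u, V (b + k%:R + 1) u ->
      exists v w, [/\ V (b + k%:R) v, V (b + k%:R) w
                    & Z (u - (v + nabla_tau w))];
  vf_nilp : forall b, exists N : nat, forall u, V b u ->
    Vlt V b (iter N (res_shift b) u)
}.

Definition Vplus_cond (V : K -> set form) (G' : set form) : Prop :=
  forall b,
    [/\ dsum Z (Gt `&` G' `&` V b) (scale_set tau^-1 Gt `&` V b) (Gt `&` V b),
        forall u, (Gt `&` G' `&` V b) u -> exists v w,
          [/\ (Gt `&` G' `&` Vlt V b) v, (Gt `&` G' `&` V (b + 1)) w
            & Z (res_shift b u - (v + tau *: w))]
      & (Gt `&` G' `&` Vlt V b) `&` scale_set tau (Gt `&` G' `&` V (b + 1))
          `<=` Z].

End Index.

Definition Ctau_lattice (G' : set form) : Prop :=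
  [/\ Csubspace G' /\ (forall u, G' u -> G' (tau *: u)),
      Z `<=` G' /\ G' `<=` Gnum,
      exists s : seq form, (forall u, u \in s -> G' u) /\
        forall S, Csubspace S -> Z `<=` S -> (forall u, u \in s -> S u) ->
          (forall u, S u -> S (tau *: u)) -> G' `<=` S
    & forall u, Gnum u -> exists N : nat, G' (tau ^+ N *: u)].

Definition birkhoff_solution (G' : set form) : Prop :=
  [/\ Ctau_lattice G',
      forall u, G' u -> G' (tau *: nabla_tau u)
    & dsum Z (Gt `&` G') (scale_set tau^-1 Gt) Gt].

(* the index set is C if t0 = 0 and Q otherwise *)
Definition Vplus_solution (G' : set form) : Prop :=
  [/\ birkhoff_solution G',
      t0 = 0 -> forall V : C -> set form,
        KM_filtration lexle id V -> Vplus_cond lexle id V G'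
    & t0 <> 0 -> forall V : rat -> set form,
        KM_filtration <=%O ratr V -> Vplus_cond <=%O ratr V G'].

Definition basis_Vplus_solution (w : 'I_n -> form) : Prop :=
  is_basis (Calg [:: tau^-1]) Z Gt w /\
  Vplus_solution (sat Z (rspan (Calg [:: tau]) w)).

End Fibre.

(** ** V^+-solutions in family over T \ {0} *)

(* A bundle on P^1 x (T \ {0}) extending G[1/t] is given by its module of
   sections on the chart tau <> oo, a C[t,1/t,tau]-submodule M0 of the localised
   Gauss-Manin system, the sections on the chart tau <> 0 being those of
   G[1/t].  It is trivial if it has a global frame w, that is, a common basis
   of both modules. *)
Definition trivial_extension (M0 : set form) (w : 'I_n -> form) : Prop :=
  is_basis (Calg [:: tfun; tfun^-1; tau^-1]) (loc Grel) (loc (Glat Grel)) w /\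
  is_basis (Calg [:: tfun; tfun^-1; tau]) (loc Grel) M0 w.

Definition log_pole (M0 : set form) : Prop :=
  forall u, M0 u -> M0 (tau *: nabla_tau u) /\ M0 (nabla_t u).

(* the restriction to t0 <> 0; the restriction of the localised system to t0
   is the one of the system itself *)
Definition restrict (t0 : C) (M0 : set form) : set form :=
  [set u | Gnum u /\ exists2 v, M0 v & loc (Zfib t0) (u - v)].

Definition family_Vplus_solution (w : 'I_n -> form) : Prop :=
  let M0 := sat (loc Grel) (rspan (Calg [:: tfun; tfun^-1; tau]) w) in
  [/\ trivial_extension M0 w, log_pole M0
    & forall t0, t0 <> 0 -> Vplus_solution t0 (restrict t0 M0)].

Definition Dtilde (k : nat) : 'M[F]_n :=
  diag_mx (\row_(i < n) i%:R) + (k * n)%:R%:M.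

End GaussManin.

(* Main.v *)
(** In a frame [w] with connection matrix [Omega_0 - tau^-1 diag(nu)], give
    [tau^m w_i] the order [nu_i - m].  Then [tau d_tau + (nu_i - m)] sends
    [tau^m w_i] to [tau^(m+1) w_(i+1)] (to [t tau^(m+1) w_1] if [i = n]), whose
    order is not larger exactly when the cyclic inequalities
    [nu_(i+1) - nu_i <= 1] hold, the last one being void for [t = 0].  These are
    the stopping conditions of Algorithms 1 and 2.  Under them the orders define a
    filtration satisfying the conditions on the Kashiwara-Malgrange filtration; as two
    such filtrations are mutually cofinal they agree, and the V^+ conditions hold
    because this one is split by the frame.

    The Gauss-Manin relations are homogeneous for the grading
    giving weight 1 to [x_i], [dx_i] and weight -1 to [tau].  Both algorithms
    preserve homogeneity: [w_j] has weight [j - 1 + k n] after [k] base changes (B),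
    which is the matrix [Dtilde] of [nabla_t]. *)

(* For t <> 0 the filtration [V] is indexed by Q, while the orders [nu_i - m] are complex, and
   neither order is well-founded. Filtrations are therefore compared across two index sets embedded
   in C. A product of operators [tau d_tau + a] with [a <= b] pushes an element of [V_b] as deep as
   desired; these operators are injective on the graded pieces of index [> b] of the other
   filtration, so the element already has order [<= b] there. Only finitely many jumps matter, as
   they lie in finitely many cosets of Z. Termination meets the same obstacle: the measure is
   real-valued, and one has to bound its decrease from below. Bases are given over C[t, 1/tau] and
   must stay bases at each t = t0. A relation in the fibre would make a nonzero polynomial in tau a
   multiple of [c h - t0], which is impossible because [h] is not constant. The base change (B)
   multiplies by [t], which in the fibre is the scalar t0; hence it is harmless exactly away from 0,
   and the invariant of the algorithms records the admissible values of t. *)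
Require Import Defs.
From HB Require Import structures.
From mathcomp Require Import all_boot all_order all_algebra.
From mathcomp Require Import boolp classical_sets reals.
From mathcomp Require Import complex mpoly.
From mathcomp Require Import perm ring lra zify.

Set Implicit Arguments.
Unset Strict Implicit.
Unset Printing Implicit Defensive.

Import Order.TTheory GRing.Theory Num.Theory.

Local Open Scope classical_set_scope.
Local Open Scope ring_scope.

(** * The lexicographic order *)

Section LexOrder.
Context {R : realType}.
Local Notation C := R[i].
Implicit Types x y z : C.

(** Transports the total order of the library's lexicographic product, so that the order axioms are
    inherited. *)
Definition lexpair x : (R *l R)%type := (complex.Re x, complex.Im x).

Lemma lexleE x y : lexle x y = (lexpair x <= lexpair y)%O.
Proof.
rewrite /lexle [RHS]leEprodlexi /= le_eqVlt.
by case: (ltgtP (complex.Re x) (complex.Re y)) => //= _; rewrite ?andbF.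
Qed.

Lemma lexltE x y : lexlt x y = (lexpair x < lexpair y)%O.
Proof. by rewrite /lexlt lexleE -ltNge. Qed.

Lemma lexpair_inj : injective lexpair.
Proof. by move=> [a b] [a' b'] [/= -> ->]. Qed.

Lemma lexle_refl x : lexle x x.
Proof. by rewrite lexleE. Qed.

Lemma lexle_trans y x z : lexle x y -> lexle y z -> lexle x z.
Proof. by rewrite !lexleE; apply: le_trans. Qed.

Lemma lexle_anti x y : lexle x y -> lexle y x -> x = y.
Proof.
by rewrite !lexleE => xy yx; apply/lexpair_inj/le_anti; rewrite xy yx.
Qed.

Lemma lexle_total x y : lexle x y || lexle y x.
Proof. by rewrite !lexleE; apply: le_total. Qed.

Lemma lexltW x y : lexlt x y -> lexle x y.
Proof. by rewrite lexltE lexleE; apply: ltW. Qed.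

Lemma lexlt_neqle x y : lexlt x y = (x != y) && lexle x y.
Proof. by rewrite lexltE lexleE lt_neqAle (inj_eq lexpair_inj). Qed.

Lemma lexle_lt_trans y x z : lexle x y -> lexlt y z -> lexlt x z.
Proof. by rewrite !lexltE lexleE; apply: le_lt_trans. Qed.

Lemma lexlt_le_trans y x z : lexlt x y -> lexle y z -> lexlt x z.
Proof. by rewrite !lexltE lexleE; apply: lt_le_trans. Qed.

Lemma lexlt_irr x : lexlt x x = false.
Proof. by rewrite /lexlt lexle_refl. Qed.

Lemma lexleNgt x y : lexle x y = ~~ lexlt y x.
Proof. by rewrite negbK. Qed.

Lemma lexle0E x y : lexle x y = lexle 0 (y - x).
Proof.
case: x y => [a b] [a' b']; rewrite /lexle /= !subr_gt0 subr_ge0.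
by rewrite [0 == _]eq_sym subr_eq0 [a' == _]eq_sym.
Qed.

Lemma lexleD2r z x y : lexle (x + z) (y + z) = lexle x y.
Proof. by rewrite lexle0E [RHS]lexle0E opprD addrACA subrr addr0. Qed.

Lemma lexleN2 x y : lexle (- x) (- y) = lexle y x.
Proof. by rewrite lexle0E [RHS]lexle0E opprK addrC. Qed.

Lemma lexltD2r z x y : lexlt (x + z) (y + z) = lexlt x y.
Proof. by rewrite /lexlt lexleD2r. Qed.

Lemma lexlt0E x y : lexlt x y = lexlt 0 (y - x).
Proof. by rewrite -(lexltD2r (- x)) subrr. Qed.

Lemma Re_int (m : int) : complex.Re (m%:~R : C) = m%:~R.
Proof. by rewrite raddfMz. Qed.

Lemma Im_int (m : int) : complex.Im (m%:~R : C) = 0.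
Proof. by rewrite raddfMz /= mul0rz. Qed.

Lemma Re_Dint (x : C) (m : int) : complex.Re (x + m%:~R) = complex.Re x + m%:~R.
Proof. by rewrite raddfD /= Re_int. Qed.

Lemma Im_Dint (x : C) (m : int) : complex.Im (x + m%:~R) = complex.Im x.
Proof. by rewrite raddfD /= Im_int addr0. Qed.

Lemma lexle_int (m p : int) : lexle (m%:~R : C) p%:~R = (m <= p).
Proof.
rewrite /lexle !Re_int !Im_int lexx andbT ltr_int eqr_int.
by rewrite le_eqVlt orbC.
Qed.

Lemma lexlt_Re x y : complex.Re x < complex.Re y -> lexlt x y.
Proof. by move=> h; rewrite /lexlt /lexle (gt_eqF h) ltNge (ltW h). Qed.

(** The order is not Archimedean, purely imaginary numbers being infinitesimal; but subtracting
    integers lowers the real part, and distinct real parts decide. *)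
Lemma lex_archi x y : exists N : nat, forall m : int, (N%:Z <= m) ->
  lexlt (x - m%:~R) y.
Proof.
exists (Num.truncn `|complex.Re x - complex.Re y|).+1 => m Nm.
apply: lexlt_Re; rewrite raddfB /= Re_int ltrBlDr -ltrBlDl.
apply: le_lt_trans (ler_norm _) _; apply: lt_le_trans (truncnS_gt _) _.
by rewrite pmulrn ler_int.
Qed.

End LexOrder.

(** * Termination and confluence of the algorithms *)

Section Termination.
Context {R : realType} {n : nat}.
Local Notation C := R[i].
Implicit Types nu : 'I_n -> C.

(** Both moves act on [nu] in this way, when [nu a - nu b > 1]: a replacement of Algorithm 1 with
    [a = i] and [b = i'], the base change (B) with [a] the first and [b] the last index. One
    termination argument thus serves both. *)
Definition swap nu (a b : 'I_n) : 'I_n -> C :=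
  fun j => if j == b then nu a - 1 else if j == a then nu b + 1 else nu j.

Lemma posfin_lb (I : finType) (g : I -> R) : (forall i, 0 < g i) ->
  exists2 d : R, 0 < d & forall i, d <= g i.
Proof.
move=> g_gt0; have s_ge0 : 0 <= \sum_i (g i)^-1.
  by apply: sumr_ge0 => i _; rewrite invr_ge0 ltW.
(* This is below every [g i] and still makes sense when [I] is empty, where a minimum would not. *)
exists (1 + \sum_i (g i)^-1)^-1 => [|i]; first by rewrite invr_gt0 ltr_pwDl.
rewrite invf_ple ?posrE ?ltr_pwDl // (bigD1 i) //= addrCA lerDl.
rewrite addr_ge0 // ?ler01 //.
by apply: sumr_ge0 => j _; rewrite invr_ge0 ltW.
Qed.

(** A coset of Z is discrete: the gap is 1 for Z itself, and otherwise the distance from [r] to the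
    nearest integer. *)
Lemma int_shift_gap (r : R) : exists2 d : R, 0 < d &
  forall m : int, r + m%:~R != 0 -> d <= `|r + m%:~R|.
Proof.
have [/intrP[k ->]|rNint] := boolP (r \is a Num.int).
  exists 1 => // m; rewrite -rmorphD -intr_norm intr_eq0 -[1]/(1%:~R) ler_int.
  by rewrite -normr_gt0 gtz0_ge1.
pose k := Num.floor r.
have [fr0 fr1] : k%:~R < r /\ r < (k + 1)%:~R.
  split; last exact: floorD1_gt.
  rewrite lt_neqAle (real_floor_le (num_real r)) andbT.
  by apply: contra rNint => /eqP<-; apply: intr_int.
exists (Num.min (r - k%:~R) ((k + 1)%:~R - r)).
  by rewrite lt_min !subr_gt0 fr0.
move=> m _; rewrite ge_min; have [km|km] := lerP 0 (k + m).
  apply/orP; left; rewrite [r + m%:~R](_ : _ = (r - k%:~R) + (k + m)%:~R); last by rewrite intrD; ring.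
  have m0 : 0 <= (k + m)%:~R :> R by rewrite ler0z.
  by rewrite ger0_norm ?lerDl // addr_ge0 // subr_ge0 ltW.
apply/orP; right; rewrite ler_normr; apply/orP; right.
have : (k + m)%:~R <= (-1)%:~R :> R by rewrite ler_int; lia.
by rewrite !intrD intrN; lra.
Qed.

(* Write [L x = Re x + e * Im x].  A swap decreases [\sum_j L (nu j) ^+ 2] by
   [2 * L (nu a - nu b - 1)]; the differences stay in finitely many classes
   modulo the integers, so for small [e] this decrease is bounded below. *)
Lemma swap_ind nu0 (P : ('I_n -> C) -> Prop) :
  (forall nu, (forall a b, lexlt 1 (nu a - nu b) -> P (swap nu a b)) -> P nu) ->
  P nu0.
Proof.
move=> IH.
have /choice[gap gapP] : forall p : 'I_n * 'I_n, exists g : R, 0 < g /\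
    forall m : int, complex.Re (nu0 p.1 - nu0 p.2) + m%:~R != 0 ->
      g <= `|complex.Re (nu0 p.1 - nu0 p.2) + m%:~R|.
  by move=> p; have [g] := int_shift_gap (complex.Re (nu0 p.1 - nu0 p.2)); exists g.
have [d1 d1_gt0 d1P] := posfin_lb (fun p => (gapP p).1).
pose im (p : 'I_n * 'I_n) := complex.Im (nu0 p.1 - nu0 p.2).
(* Swaps move the entries by integers, so the imaginary parts of differences stay in a finite set,
   whose positive members are bounded below. *)
have [d2 d2_gt0 d2P] : exists2 d : R, 0 < d & forall p, 0 < im p -> d <= im p.
  have [|d d0 dP] := @posfin_lb _ (fun p => if 0 < im p then im p else 1).
    by move=> p; case: ifP.
  by exists d => // p p0; have := dP p; rewrite p0.
pose B : R := 1 + \sum_p `|im p|.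
have B_gt0 : 0 < B by rewrite ltr_pwDl // sumr_ge0.
have BP p : `|im p| <= B.
  rewrite /B (bigD1 p) //= addrCA lerDl addr_ge0 ?ler01 //.
  exact: sumr_ge0.
(* With this [e] the imaginary part changes [L] by at most [d1 / 2], so a positive real part, being
   at least [d1], prevails. If the real part vanishes, [e * d2] is the bound. *)
pose e := d1 / 2 / B; have e_gt0 : 0 < e by rewrite !divr_gt0.
pose L (x : C) := complex.Re x + e * complex.Im x.
pose d := Num.min (d1 / 2) (e * d2).
have d_gt0 : 0 < d by rewrite lt_min divr_gt0 // mulr_gt0.
have LD x y : L (x + y) = L x + L y by rewrite /L !raddfD /=; ring.
have LN x : L (- x) = - L x by rewrite /L !raddfN /=; ring.
have L1 : L 1 = 1 by rewrite /L /= mulr0 addr0.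
pose cls nu := forall j, exists a (m : int), nu j = nu0 a + m%:~R.
have Lgap nu a b : cls nu -> lexlt 1 (nu a - nu b) -> d <= L (nu a - nu b - 1).
  move=> /[dup] /(_ a)[a' [ma ->]] /(_ b)[b' [mb ->]]; rewrite lexlt0E.
  have -> : nu0 a' + ma%:~R - (nu0 b' + mb%:~R) - 1 =
    nu0 a' - nu0 b' + (ma - mb - 1)%:~R by rewrite !intrD !intrN; ring.
  set m := _ - 1; set y := _ - nu0 b'.
  rewrite lexlt_neqle /lexle /L Re_Dint Im_Dint => /andP[n0].
  have := d1P (a', b'); have := (gapP (a', b')).2 m; have := BP (a', b').
  have := d2P (a', b'); rewrite /im /= -/y => im1 im2 re1 re2.
  have eB : e * B = d1 / 2 by rewrite /e divfK // gt_eqF.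
  case/orP => [r0|/andP[/eqP r0 i0]].
    rewrite ge_min; apply/orP; left.
    have := re1; rewrite gt_eqF // gtr0_norm // => /(_ isT) re3.
    have : e * - B <= e * complex.Im y.
      by rewrite ler_pM2l //; move: im2; rewrite ler_norml => /andP[].
    rewrite mulrN eB; lra.
  rewrite -r0 add0r ge_min; apply/orP; right; rewrite ler_pM2l //.
  apply: im1; rewrite lt_neqAle i0 andbT; apply: contra n0 => /eqP i1.
  by rewrite eq_complex Re_Dint Im_Dint /= -r0 -i1 !eqxx.
pose Phi nu := \sum_j L (nu j) ^+ 2.
have PhiD nu a b : lexlt 1 (nu a - nu b) ->
    Phi (swap nu a b) = Phi nu - 2 * L (nu a - nu b - 1).
  move=> ab; have ba : b != a.
    by apply: contraTneq ab => ->; rewrite subrr /lexlt -[0]/(0%:~R) -[1]/(1%:~R) lexle_int.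
  rewrite /Phi (bigD1 a) //= (bigD1 b) //= [in RHS](bigD1 a) //= [in RHS](bigD1 b) //=.
  rewrite /swap eqxx eq_sym (negPf ba) eqxx.
  rewrite (eq_bigr (fun j => L (nu j) ^+ 2)).
    by rewrite !(LD, LN, L1); ring.
  by move=> j /andP[/negPf-> /negPf->].
have clsS nu a b : cls nu -> cls (swap nu a b).
  move=> nuc j; rewrite /swap; case: ifP => _.
    by have [a' [m ->]] := nuc a; exists a', (m - 1); rewrite intrD addrA.
  case: ifP => _; last exact: nuc.
  by have [a' [m ->]] := nuc b; exists a', (m + 1); rewrite intrD addrA.
(* [Phi] is nonnegative and each swap lowers it by at least [2 * d], so its size in units of [d]
   bounds the number of swaps. *)
suff H N nu : cls nu -> Phi nu < N%:R * d -> P nu.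
  apply: (H (Num.truncn (Phi nu0 / d)).+1).
    by move=> j; exists j, 0; rewrite addr0.
  by rewrite -ltr_pdivrMr // truncnS_gt.
elim: N nu => [|N IHN] nu nuc.
  by rewrite mul0r ltNge sumr_ge0 // => j _; apply: sqr_ge0.
move=> lt; apply: IH => a b ab; apply: IHN; first exact: clsS.
rewrite PhiD //; have := Lgap _ _ _ nuc ab.
by move: lt; rewrite -addn1 natrD mulrDl mul1r; lra.
Qed.

End Termination.

(** * Runs of the algorithms: existence, invariants, and confluence of Algorithm 1 *)

Section Algorithms.
Context {R : realType} {n : nat}.
Local Notation C := R[i].
Local Notation state := (@state R n).
Variables (h : {mpoly C[n]}) (c : C).
Implicit Types s : state.

Lemma lexlt_sub1_neq (nu : 'I_n -> C) a b : lexlt 1 (nu a - nu b) -> a != b.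
Proof.
apply: contraTneq => ->; rewrite subrr /lexlt.
by rewrite -[0]/(0%:~R) -[1]/(1%:~R) lexle_int.
Qed.

(** The two sides test the indices in opposite order, which is immaterial once they differ. *)
Lemma base_change_B_nu s a b :
  a != b -> (base_change_B h c s a b).2 = swap s.2 a b.
Proof.
move=> ab; apply/funext => j; rewrite /base_change_B /swap /=.
by case: (eqVneq j a) => [->|//]; rewrite (negPf ab).
Qed.

(** The recursion is on [nu] alone; the frame changes at every step, so the predicate quantifies
    over it. *)
Lemma alg1_exists s : exists s', alg1 s s'.
Proof.
case: s => w nu; move: w.
apply: (@swap_ind _ _ nu (fun nu => forall w, exists s', alg1 (w, nu) s')) => {}nu IH w.
have [[i' [i ii]]|no] := pselect (exists i' i, alg1_cond (w, nu) i' i).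
  have [s' s'P] := IH _ _ ii.2 (alg1_step (w, nu) i' i).1.
  by exists s'; apply: alg1_next ii s'P.
by exists (w, nu); apply: alg1_stop => i' i ii; apply: no; exists i', i.
Qed.

Lemma alg2_exists s : exists k s', alg2 h c s k s'.
Proof.
case: s => w nu; move: w.
apply: (@swap_ind _ _ nu (fun nu => forall w, exists k s', alg2 h c (w, nu) k s')) => {}nu IH w.
have [[i' [i ii]]|no] := pselect (exists i' i, alg1_cond (w, nu) i' i).
  have [k [s' s'P]] := IH _ _ ii.2 (alg1_step (w, nu) i' i).1.
  (* The run obtained by recursion begins with a run of Algorithm 1, and the present step is
     prepended to that one. *)
  exists k, s'; inversion s'P; subst.
    by apply: alg2_stop => //; apply: alg1_next ii H.
  by apply: (alg2_next (s' := s'0)) H0 H1; apply: alg1_next ii H.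
have st : alg1 (w, nu) (w, nu).
  by apply: alg1_stop => i' i ii; apply: no; exists i', i.
have [[a [b ab]]|nob] := pselect (exists a b, alg2_cond (w, nu) a b).
  have [_ _ lt] := ab.
  have [k [s' s'P]] := IH _ _ lt (base_change_B h c (w, nu) a b).1.
  exists k.+1, s'; apply: alg2_next st ab _.
  have sw : base_change_B h c (w, nu) a b =
      ((base_change_B h c (w, nu) a b).1, swap nu a b).
    have <- := @base_change_B_nu (w, nu) a b (lexlt_sub1_neq lt).
    by rewrite -surjective_pairing.
  by rewrite sw; apply: s'P.
by exists 0%N, (w, nu); apply: alg2_stop st _ => a b ab; apply: nob; exists a, b.
Qed.

Lemma alg1_inv (P : state -> Prop) s s' :
    (forall t i' i, alg1_cond t i' i -> P t -> P (alg1_step t i' i)) ->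
  alg1 s s' -> P s -> P s'.
Proof. by move=> step; elim=> // t i' i t' cond _ IH Pt; apply/IH/step. Qed.

(** The counter starts at an arbitrary [k0] because the recursive call comes after a base change
    that is already counted. *)
Lemma alg2_inv (P : nat -> state -> Prop) k0 s k s' :
    (forall j t i' i, alg1_cond t i' i -> P j t -> P j (alg1_step t i' i)) ->
    (forall j t a b, alg2_cond t a b -> P j t -> P j.+1 (base_change_B h c t a b)) ->
  alg2 h c s k s' -> P k0 s -> P (k0 + k)%N s'.
Proof.
move=> step1 step2 s2; elim: s2 k0 => {s k s'} [s s' s1 _|s s' a b k s'' s1 ab _ IH] k0.
  by rewrite addn0; apply: alg1_inv s1; apply: step1.
move=> Ps; rewrite addnS -addSn; apply/IH/step2 => //.
by apply: alg1_inv s1 Ps; apply: step1.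
Qed.

Lemma alg1_final s s' : alg1 s s' -> forall i' i, ~ alg1_cond s' i' i.
Proof. by elim. Qed.

Lemma alg2_final s k s' : alg2 h c s k s' ->
  (forall i' i, ~ alg1_cond s' i' i) /\ (forall a b, ~ alg2_cond s' a b).
Proof. by elim=> // {}s {}s' /alg1_final. Qed.

(* A step of Algorithm 1 exchanges two adjacent entries of this sequence, so its
   output is the sorted sequence, whatever steps are chosen. *)
Definition shifted (nu : 'I_n -> C) : seq C :=
  map (fun i : 'I_n => nu i - i%:R) (enum 'I_n).

(** As [i = i' + 1], the new entry [nu_i - 1] at [i'] gives [nu_i - 1 - i' = nu_i - i], and likewise
    the new entry at [i] gives [nu_i' - i']: the subtraction of the index absorbs the shifts by
    1. *)
Lemma alg1_perm s s' : alg1 s s' -> perm_eq (shifted s.2) (shifted s'.2).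
Proof.
move=> s1; apply: (alg1_inv (P := fun t => perm_eq (shifted s.2) (shifted t.2)) _ s1).
  move=> t i' i cond st; apply: perm_trans st _.
  have [ii lt] := cond; have ne := lexlt_sub1_neq lt.
  have -> : shifted (alg1_step t i' i).2 =
      map (fun j => t.2 j - j%:R) (map (tperm i' i) (enum 'I_n)).
    rewrite -map_comp; apply: eq_map => j /=; rewrite /alg1_step /=.
    case: tpermP => [->|->|/eqP/negPf-> /eqP/negPf-> //].
      by rewrite eqxx ii -natr1; ring.
    by rewrite (negPf ne) eqxx ii -natr1; ring.
  apply/perm_map/uniq_perm; rewrite ?(map_inj_uniq (@perm_inj _ _)) ?enum_uniq //.
  move=> j; rewrite mem_enum; apply/esym/mapP; exists (tperm i' i j).
    by rewrite mem_enum.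
  by rewrite tpermK.
exact: perm_refl.
Qed.

Lemma lexle_final s : (forall i' i, ~ alg1_cond s i' i) ->
  forall i' i : 'I_n, i = i'.+1 :> nat -> lexle (s.2 i - s.2 i') 1.
Proof. by move=> no i' i ii; rewrite lexleNgt; apply/negP => lt; apply: (no i' i). Qed.

(** The stopping inequality [nu_i - nu_(i-1) <= 1] reads [nu_i - i <= nu_(i-1) - (i-1)]. *)
Lemma shifted_sorted s : (forall i' i, ~ alg1_cond s i' i) ->
  sorted (fun x y : C => lexle y x) (shifted s.2).
Proof.
move=> /lexle_final le; apply/(sortedP 0) => k.
rewrite /shifted size_map size_enum_ord => km.
pose i0 : 'I_n := Ordinal (leq_ltn_trans (leq0n _) km).
have szE : size (enum 'I_n) = n by rewrite size_enum_ord.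
rewrite !(@nth_map _ i0 _ 0 _ _ (enum 'I_n)) ?szE ?(ltnW km) //.
have := le (nth i0 (enum 'I_n) k) (nth i0 (enum 'I_n) k.+1).
rewrite !nth_enum_ord ?(ltnW km) // => /(_ erefl); set x := s.2 _; set y := s.2 _.
rewrite lexle0E [in X in _ -> X]lexle0E -natr1.
by congr (is_true (lexle _ _)); ring.
Qed.

(** The order of the steps is free, so two runs may differ; but the decreasing rearrangement of the
    shifted sequence is unique. The frames of two runs are compared in [algorithms_agree]. *)
Lemma alg1_nu s s' s'' : alg1 s s' -> alg1 s s'' -> s'.2 = s''.2.
Proof.
move=> s1 s2.
have eqs : shifted s'.2 = shifted s''.2.
  apply: (sorted_eq (leT := fun x y : C => lexle y x)).
  - by move=> y x z xy yz; apply: lexle_trans xy.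
  - by move=> x y /andP[yx xy]; apply: lexle_anti.
  - exact/shifted_sorted/alg1_final/s1.
  - exact/shifted_sorted/alg1_final/s2.
  - by apply: perm_trans (alg1_perm s2); rewrite perm_sym; apply: alg1_perm.
apply/funext => i; have /eq_in_map := eqs => /(_ i).
by rewrite mem_enum => /(_ isT) /addIr.
Qed.

End Algorithms.

(** * Laurent spans and filtrations *)

Section LaurentSpan.
Context {C F : fieldType} {M : lmodType F} {n : nat}.
Variables (k : {rmorphism C -> F}) (tt : F).
Implicit Types (S : set M) (u v : M) (a : C).

(** The forms are a space over the large field [F], whereas lattices and filtrations are only stable
    under the constants [C], acting through [k]. *)
Definition kspace S : Prop :=
  S 0 /\ forall a u v, S u -> S v -> S (k a *: u + v).

Lemma kspace0 S : kspace S -> S 0. Proof. by case. Qed.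

Lemma kspaceD S u v : kspace S -> S u -> S v -> S (u + v).
Proof. by move=> [_ SP] Su Sv; have := SP 1 u v Su Sv; rewrite rmorph1 scale1r. Qed.

Lemma kspaceZ S a u : kspace S -> S u -> S (k a *: u).
Proof. by move=> [S0 SP] Su; rewrite -[_ *: _]addr0; apply: SP. Qed.

Lemma kspaceN S u : kspace S -> S u -> S (- u).
Proof.
by move=> Ssp Su; have := kspaceZ (-1) Ssp Su; rewrite rmorphN1 scaleN1r.
Qed.

Lemma kspaceB S u v : kspace S -> S u -> S v -> S (u - v).
Proof. by move=> Ssp Su Sv; apply: kspaceD => //; apply: kspaceN. Qed.

Lemma kspace_sum S (I : Type) (r : seq I) (P : pred I) (G : I -> M) :
  kspace S -> (forall i, P i -> S (G i)) -> S (\sum_(i <- r | P i) G i).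
Proof. by move=> Ssp SG; elim/big_ind: _ => //; [case: Ssp | move=> *; apply: kspaceD]. Qed.

Lemma kspace_cong S (Z : set M) u v : kspace S -> Z `<=` S ->
  S v -> Z (u - v) -> S u.
Proof. by move=> Ssp ZS Sv /ZS uv; rewrite -(subrK v u); apply: kspaceD. Qed.

Lemma kspaceI S S' : kspace S -> kspace S' -> kspace (S `&` S').
Proof.
by move=> [S0 SP] [S0' SP']; split=> // a u v [? ?] [? ?]; split; [apply: SP|apply: SP'].
Qed.

Lemma kspace_preim S (g : M -> M) :
  (forall a u v, g (k a *: u + v) = k a *: g u + g v) ->
  kspace S -> kspace [set u | S (g u)].
Proof.
move=> gP Ssp; split=> /= [|a u v Su Sv]; last by rewrite gP; case: Ssp => _; apply.
have := gP (-1) 0 0; rewrite rmorphN1 scaler0 addr0 scaleN1r addNr => ->.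
by case: Ssp.
Qed.

Variables (Z : set M) (w : 'I_n -> M).
Hypothesis Zsp : kspace Z.

(** With [Z] the relations, both lattices, their multiples by powers of [tau] and the filtration by
    orders are all of this form. Inclusions, intersections and sums of them reduce to conditions on
    the exponents in [E]. *)
Inductive span (E : 'I_n -> int -> Prop) : set M :=
| spanZ u : Z u -> span E u
| spanX i m : E i m -> span E (tt ^ m *: w i)
| span_lin a u v : span E u -> span E v -> span E (k a *: u + v).

Lemma span_min E S : kspace S -> Z `<=` S ->
  (forall i m, E i m -> S (tt ^ m *: w i)) -> span E `<=` S.
Proof.
move=> [_ Ssp] ZS ES u; elim=> [|//|a {}u v _ Su _ Sv]; first exact: ZS.
exact: Ssp.
Qed.

Lemma span_kspace E : kspace (span E).
Proof. by split; [apply: spanZ; apply: kspace0 | move=> a u v; apply: span_lin]. Qed.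

Lemma spanS E E' : (forall i m, E i m -> E' i m) -> span E `<=` span E'.
Proof.
move=> EE'; apply: span_min; [exact: span_kspace|by move=> u; apply: spanZ|].
by move=> i m /EE'; apply: spanX.
Qed.

Lemma spanW E E' u : span E u -> (forall i m, E i m -> E' i m) -> span E' u.
Proof. by move=> Eu EE'; apply: (spanS EE'). Qed.

Lemma span0 E : (forall i m, ~ E i m) -> span E `<=` Z.
Proof. by move=> E0; apply: span_min => // i m /E0. Qed.

Lemma span_cong E u v : span E v -> Z (u - v) -> span E u.
Proof. by apply: kspace_cong; [apply: span_kspace|move=> x; apply: spanZ]. Qed.

Lemma span_fin E u : span E u ->
  exists N : nat, span (fun i m => E i m /\ - N%:Z <= m) u.
Proof.
apply: (span_min (S := [set u | exists N : nat,
  span (fun i m => E i m /\ - N%:Z <= m) u])); first split.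
- by exists 0%N; apply: kspace0; apply: span_kspace.
- move=> a u1 u2 [N1 h1] [N2 h2]; exists (maxn N1 N2).
  have [_] := span_kspace (fun i m => E i m /\ - (maxn N1 N2)%:Z <= m).
  by apply; [move: u1 h1|move: u2 h2]; apply: spanS => i m [? ?]; split => //; lia.
- by move=> v Zv; exists 0%N; apply: spanZ.
- by move=> i m Eim; exists `|m|%N; apply: spanX; split=> //; lia.
Qed.

Hypothesis tt0 : tt != 0.
Hypothesis Ztt : forall u m, Z u -> Z (tt ^ m *: u).

Lemma span_scale E (m : int) u : span E u -> span (fun i p => E i (p - m)) (tt ^ m *: u).
Proof.
apply: (span_min (S := [set u | span _ (tt ^ m *: u)])).
- apply: kspace_preim; last exact: span_kspace.
  by move=> a u1 u2; rewrite scalerDr !scalerA [_ * k a]mulrC.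
- by move=> v Zv; apply: spanZ; apply: Ztt.
- by move=> i p Eip; rewrite /= scalerA -expfzDr // addrC; apply: spanX; rewrite addrK.
Qed.

Definition ptt (p : {poly C}) : F := (map_poly k p).[tt].

Lemma pttD p q : ptt (p + q) = ptt p + ptt q.
Proof. by rewrite /ptt rmorphD hornerD. Qed.

Lemma pttM p q : ptt (p * q) = ptt p * ptt q.
Proof. by rewrite /ptt rmorphM hornerM. Qed.

Lemma pttXn m : ptt 'X^m = tt ^+ m.
Proof. by rewrite /ptt map_polyXn hornerXn. Qed.

Lemma pttC a : ptt a%:P = k a.
Proof. by rewrite /ptt map_polyC hornerC. Qed.

Lemma ptt0 : ptt 0 = 0.
Proof. by rewrite -polyC0 pttC rmorph0. Qed.

Lemma pttN p : ptt (- p) = - ptt p.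
Proof. by rewrite /ptt rmorphN hornerN. Qed.

Lemma pttE p : ptt p = \sum_(j < size p) k p`_j * tt ^+ j.
Proof.
rewrite /ptt horner_coef size_map_poly; apply: eq_bigr => j _.
by rewrite coef_map.
Qed.

(** Replaces Laurent polynomials by polynomials with one common denominator [tt ^+ N]: the
    coefficient of index [j] stands for the monomial [tt ^ (j - N)]. *)
Definition poly_rep E u : Prop := exists (p : 'I_n -> {poly C}) (N : nat),
  (forall i j, (p i)`_j != 0 -> E i (j%:Z - N%:Z)) /\
  Z (tt ^+ N *: u - \sum_i ptt (p i) *: w i).

Lemma span_poly_rep E u : span E u -> poly_rep E u.
Proof.
move: u; apply: (span_min (S := poly_rep E)); first split.
- exists (fun=> 0), 0%N; split=> [i j|]; first by rewrite coef0 eqxx.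
  by rewrite big1 => [|i _]; rewrite ?scaler0 ?subr0 ?ptt0 ?scale0r //; case: Zsp.
- move=> a u1 u2 [p1 [N1 [E1 Z1]]] [p2 [N2 [E2 Z2]]].
  (* The common denominator of the two summands is [tt ^+ (N1 + N2)]. *)
  exists (fun i => a%:P * ('X^N2 * p1 i) + 'X^N1 * p2 i), (N1 + N2)%N; split=> [i j|].
    rewrite coefD coefCM !coefXnM => ne0.
    case: (ltnP j N2) ne0 => j2; case: (ltnP j N1) => j1; rewrite ?mulr0 ?add0r ?addr0.
    - by rewrite eqxx.
    - by move=> /E2; rewrite -!subzn //; congr E; lia.
    - rewrite mulf_eq0 negb_or => /andP[_ /E1].
      by rewrite -!subzn //; congr E; lia.
    have [->|ne _] := eqVneq (p1 i)`_(j - N2) 0.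
      by rewrite mulr0 add0r => /E2; rewrite -!subzn //; congr E; lia.
    by have := E1 _ _ ne; rewrite -!subzn //; congr E; lia.
  pose g := k a *: (tt ^ N2 *: (tt ^+ N1 *: u1 - \sum_i ptt (p1 i) *: w i)) +
     tt ^ N1 *: (tt ^+ N2 *: u2 - \sum_i ptt (p2 i) *: w i).
  have Zg : Z g by case: (Zsp) => _; apply; apply: Ztt.
  move: Zg; congr Z; rewrite /g !(scalerBr, scalerDr) !scalerA !scaler_sumr.
  rewrite addrACA -opprD -big_split /=; congr (_ + _ - _).
  - by rewrite -?exprnP exprD; congr (_ *: _); ring.
  - by rewrite -?exprnP exprD.
  apply: eq_bigr => i _; rewrite !scalerA -scalerDl -!exprnP; congr (_ *: _).
  by rewrite pttD !pttM !pttXn pttC; ring.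
- move=> v Zv; exists (fun=> 0), 0%N; split=> [i j|]; first by rewrite coef0 eqxx.
  by rewrite scale1r big1 ?subr0 // => i _; rewrite ptt0 scale0r.
move=> i m Eim; pose N := `|m|%N; pose d := `|(m + N%:Z)%R|%N.
have dE : d%:Z = m + N%:Z by rewrite /d /N; lia.
exists (fun l => if l == i then 'X^d else 0), N; split=> [l j|].
  case: (eqVneq l i) => [->|_]; last by rewrite coef0 eqxx.
  by rewrite coefXn; case: (eqVneq j d) => [->|]; rewrite ?eqxx // dE addrK.
rewrite (bigD1 i) //= eqxx big1 => [|l /negPf->]; last by rewrite ptt0 scale0r.
rewrite pttXn addr0 scalerA !exprnP -expfzDr // dE [m + _]addrC subrr.
by case: Zsp.
Qed.

Hypothesis indep : forall p : 'I_n -> {poly C},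
  Z (\sum_i ptt (p i) *: w i) -> forall i, p i = 0.

(** Over a common denominator the two representations of [u] have the same coefficients by [indep],
    so each monomial that occurs satisfies both predicates. *)
Lemma span_cap E E' u : span E u -> span E' u ->
  span (fun i m => E i m /\ E' i m) u.
Proof.
move=> /span_poly_rep[p [N [Ep Zp]]] /span_poly_rep[q [N' [Eq Zq]]].
have pq i : 'X^N' * p i = 'X^N * q i.
  apply/eqP; rewrite -subr_eq0; apply/eqP; move: i.
  apply: indep; pose g := tt ^ N *: (tt ^+ N' *: u - \sum_i ptt (q i) *: w i)
    - tt ^ N' *: (tt ^+ N *: u - \sum_i ptt (p i) *: w i).
  have Zg : Z g by apply: kspaceB => //; apply: Ztt.
  move: Zg; congr Z; rewrite /g !scalerBr !scalerA !scaler_sumr.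
  rewrite -!exprnP [tt ^+ N' * _]mulrC opprB addrC addrA subrK -sumrB.
  apply: eq_bigr => i _; rewrite !scalerA -scalerBl.
  by rewrite pttD pttN !pttM !pttXn.
have uE : Z (u - \sum_i \sum_(j < size (p i)) k (p i)`_j *: (tt ^ (j%:Z - N%:Z) *: w i)).
  have := Ztt (- N%:Z) Zp; congr Z; rewrite scalerBr scalerA exprnP -expfzDr // addNr scale1r.
  rewrite scaler_sumr; congr (_ - _); apply: eq_bigr => i _.
  rewrite pttE scaler_suml scaler_sumr; apply: eq_bigr => j _.
  by rewrite !scalerA mulrCA [j%:Z - _]addrC expfzDr.
apply: (span_cong _ uE).
apply: kspace_sum (span_kspace _) _ => i _.
apply: kspace_sum (span_kspace _) _ => j _.
have [->|ne] := eqVneq (p i)`_j 0.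
  by rewrite rmorph0 scale0r; apply: (kspace0 (span_kspace _)).
apply: (kspaceZ _ (span_kspace _)).
apply: spanX; split; first exact: Ep.
have := congr1 (fun r : {poly C} => r`_(j + N')) (pq i).
rewrite !coefXnM ltnNge leq_addl /= addnK.
case: ltnP => [_ e|le e]; first by rewrite e eqxx in ne.
have /Eq : (q i)`_(j + N' - N) != 0 by rewrite -e.
by congr E'; move: (nat_of_ord j) le => l le; lia.
Qed.

End LaurentSpan.

(** * Comparison of filtrations on whose graded pieces [theta + b] is nilpotent *)

Section DiscreteFiltrations.
Context {R : realType} {F : fieldType} {M : lmodType F}.
Local Notation C := R[i].
Variables (k : {rmorphism C -> F}) (Z : set M) (theta : M -> M).
Hypothesis theta_lin : forall a u v,
  theta (k a *: u + v) = k a *: theta u + theta v.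
Implicit Types (u v : M) (a : C).

Definition shift a u : M := theta u + k a *: u.
Definition shifts (s : seq C) u : M := foldl (fun v a => shift a v) u s.

Lemma shift_lin b a u v : shift b (k a *: u + v) = k a *: shift b u + shift b v.
Proof.
rewrite /shift theta_lin !scalerDr !scalerA [k b * _]mulrC -!addrA; congr (_ + _).
by rewrite addrCA.
Qed.

Lemma shift0 b : shift b 0 = 0.
Proof.
by have := shift_lin b (-1) 0 0; rewrite rmorphN1 !scaleN1r oppr0 addr0 addNr.
Qed.

Lemma shiftZ b a u : shift b (k a *: u) = k a *: shift b u.
Proof. by have := shift_lin b a u 0; rewrite shift0 !addr0. Qed.

Lemma shiftB b u v : shift b (u - v) = shift b u - shift b v.
Proof.
by have := shift_lin b (-1) v u; rewrite rmorphN1 !scaleN1r addrC => ->; rewrite addrC.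
Qed.

Lemma iter_shift_lin N b a u v :
  iter N (shift b) (k a *: u + v) = k a *: iter N (shift b) u + iter N (shift b) v.
Proof. by elim: N => //= N ->; rewrite shift_lin. Qed.

Definition theta_stable (S : set M) := forall u, S u -> S (theta u).

Lemma shift_stable S b u : kspace k S -> theta_stable S -> S u -> S (shift b u).
Proof. by move=> Ssp Sth Su; apply: (kspaceD Ssp); [apply: Sth | apply: kspaceZ]. Qed.

Lemma iter_shift_stable S N b u :
  kspace k S -> theta_stable S -> S u -> S (iter N (shift b) u).
Proof. by move=> Ssp Sth Su; elim: N => //= N IH; apply: shift_stable. Qed.

Section OneFiltration.
Context {K : nzRingType}.
Variables (le : rel K) (emb : K -> C).

Definition below (V : K -> set M) (b : K) : set M :=
  [set u | exists2 g, le g b && (g != b) & V g u].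

(** Treats the index sets Q and C together: the order is pulled back from the lexicographic one. *)
Record lex_embedding : Prop := LexEmbedding {
  emb_inj : injective emb;
  emb_le : forall x y, le x y = lexle (emb x) (emb y);
  emb_int : forall x (m : int), emb (x + m%:~R) = emb x + m%:~R }.

(** The part of the conditions on the V-filtration that the comparison uses. Nilpotency is asked
    element by element, so that for a span it can be checked on generators. *)
Record discrete_filtration (V : K -> set M) : Prop := DiscreteFiltration {
  df_kspace : forall b, kspace k (V b);
  df_Z : forall b, Z `<=` V b;
  df_incr : forall b b', le b b' -> V b `<=` V b';
  df_jumps : exists s : seq K, forall b, exists2 a, a \in s &
    exists m : int, le (a + m%:~R) b /\ V b = V (a + m%:~R);
  df_theta : forall b, theta_stable (V b);
  df_nilp : forall b u, V b u -> exists N, below V b (iter N (shift (emb b)) u) }.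

Hypothesis emb_lex : lex_embedding.

Lemma le_refl x : le x x.
Proof. by rewrite emb_lex.(emb_le) lexle_refl. Qed.

Lemma ltE x y : le x y && (x != y) = lexlt (emb x) (emb y).
Proof. by rewrite lexlt_neqle emb_lex.(emb_le) andbC (inj_eq emb_lex.(emb_inj)). Qed.

Lemma below_lt V b g : lexlt (emb g) (emb b) -> V g `<=` below V b.
Proof. by move=> gb u Vu; exists g; rewrite ?ltE. Qed.

Lemma pred_lt b : lexlt (emb (b - 1)) (emb b).
Proof.
have -> : emb (b - 1) = emb b - 1 by have := emb_int emb_lex b (-1); rewrite !intrN.
by rewrite lexlt0E opprB addrCA subrr addr0 /lexlt -[0]/(0%:~R) -[1]/(1%:~R) lexle_int.
Qed.

Lemma kspace_below V b : (forall c, kspace k (V c)) ->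
  (forall c d, le c d -> V c `<=` V d) -> kspace k (below V b).
Proof.
move=> Vk Vincr; split; first by exists (b - 1); [rewrite ltE pred_lt | case: (Vk (b - 1))].
move=> a u v [g gb Vg] [g' g'b Vg'].
have [gg'|g'g] := orP (lexle_total (emb g) (emb g')).
  exists g' => //; case: (Vk g') => _; apply=> //.
  by apply: Vincr Vg; rewrite emb_lex.(emb_le).
exists g => //; case: (Vk g) => _; apply=> //.
by apply: Vincr Vg'; rewrite emb_lex.(emb_le).
Qed.

Variable V : K -> set M.
Hypothesis dV : discrete_filtration V.

Lemma below_sub b : below V b `<=` V b.
Proof. by move=> u [g /andP[gb _]]; apply: (df_incr dV). Qed.

Lemma below_kspace b : kspace k (below V b).
Proof. by apply: kspace_below; [apply: (df_kspace dV)|apply: (df_incr dV)]. Qed.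

Lemma below_theta b : theta_stable (below V b).
Proof. by move=> u [g gb Vu]; exists g => //; apply: (df_theta dV). Qed.

(** Each coset of Z meets the interval from [b] to [c] in finitely many points, since by [lex_archi]
    large integers leave it on either side. *)
Lemma window_finite b c (s : seq K) : exists J : seq K, forall (a : K) (m : int),
  a \in s -> ~~ le (a + m%:~R) b -> le (a + m%:~R) c -> a + m%:~R \in J.
Proof.
elim: s => [|a s [J JP]]; first by exists [::].
have [N1 N1P] := lex_archi (emb a) (emb b); have [N2 N2P] := lex_archi (emb c) (emb a).
exists (J ++ [seq a + (j%:Z - N1%:Z)%:~R | j <- iota 0 (N1 + N2)]) => a' m.
rewrite inE mem_cat => /orP[/eqP->|a's] nb lc; last by rewrite JP.
apply/orP; right; have m1 : - N1%:Z < m.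
  rewrite ltNge; apply: contra nb => m1; rewrite emb_lex.(emb_le) emb_lex.(emb_int).
  by apply: lexltW; rewrite -[m]opprK intrN; apply: N1P; lia.
have m2 : m < N2%:Z.
  rewrite ltNge; apply: contraL lc => m2; rewrite emb_lex.(emb_le) emb_lex.(emb_int).
  by rewrite -/(lexlt _ _) -(lexltD2r (- m%:~R)) addrK; apply: N2P.
apply/mapP; exists `|(m + N1%:Z)%R|%N; first by rewrite mem_iota; lia.
by congr (_ + _%:~R); lia.
Qed.

Lemma jumps_between b c : exists J : seq K, forall d, le d c ->
  V d `<=` V b \/ exists j, [/\ j \in J, le j d, ~~ le j b & V d = V j].
Proof.
have [s sP] := df_jumps dV; have [J JP] := window_finite b c s.
exists J => d dc; have [a ain [m [amd Vd]]] := sP d.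
have [amb|amb] := boolP (le (a + m%:~R) b).
  by left; rewrite Vd; apply: (df_incr dV).
right; exists (a + m%:~R); split=> //; apply: JP => //.
by move: amd dc; rewrite !emb_lex.(emb_le); apply: lexle_trans.
Qed.

(** Modulo [shift a], the operator [shift (emb b)] is the nonzero scalar [emb b - a]. Since
    [shift a u] drops below [b], so does the difference between [(emb b - a) ^+ N] times [u] and the
    [N]-th iterate of [shift (emb b)] on [u], and that iterate drops for suitable [N]. *)
Lemma below_shift b a u : a != emb b -> V b u -> below V b (shift a u) ->
  below V b u.
Proof.
move=> ab Vu Vau; have [N VN] := df_nilp dV Vu; pose e := (emb b - a) ^+ N.
have : below V b (k e *: u).
  rewrite -[_ *: u](subrK (iter N (shift (emb b)) u)) addrC.
  apply: (kspaceD (below_kspace b)) => //; rewrite /e.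
  elim: N {VN e} => [|N IHN] /=.
    by rewrite expr0 rmorph1 scale1r subrr; case: (below_kspace b).
  set x := iter N _ u in IHN *.
  have -> : k ((emb b - a) ^+ N.+1) *: u - shift (emb b) x =
      shift (emb b) (k ((emb b - a) ^+ N) *: u - x)
        + k (- (emb b - a) ^+ N) *: shift a u.
    have -> : k ((emb b - a) ^+ N.+1) *: u =
        k ((emb b - a) ^+ N) *: (shift (emb b) u - shift a u).
      rewrite exprSr rmorphM -scalerA; congr (_ *: _).
      by rewrite /shift opprD addrACA subrr add0r -scalerBl rmorphB.
    by rewrite shiftB shiftZ rmorphN scaleNr scalerBr addrAC.
  apply: (kspaceD (below_kspace b)).
    by apply: shift_stable => //; [apply: below_kspace | apply: below_theta].
  by apply: kspaceZ => //; apply: below_kspace.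
move/(kspaceZ e^-1 (below_kspace b)); rewrite scalerA -rmorphM mulVf ?rmorph1 ?scale1r //.
by rewrite expf_neq0 // subr_eq0 eq_sym.
Qed.

Lemma below_shifts b s u : (forall a, a \in s -> a != emb b) -> V b u ->
  below V b (shifts s u) -> below V b u.
Proof.
elim: s u => //= a s IHs u nes Vu /IHs H.
apply: (below_shift (a := a)) => //; first by apply: nes; rewrite inE eqxx.
apply: H => [a' a's|]; first by apply: nes; rewrite inE a's orbT.
by apply: shift_stable => //; [apply: (df_kspace dV)|apply: (df_theta dV)].
Qed.

(** Induction along the filtration, although the indices are not well-founded: only finitely many
    jumps lie between [b] and [c], and the induction is on their number. *)
Lemma jump_ind b (P : K -> set M) :
    (forall c d, le c d -> P c `<=` P d) -> (forall c, V b `<=` P c) ->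
    (forall j u, ~~ le j b -> V j u ->
      (forall g v, lexlt (emb g) (emb j) -> V g v -> P g v) -> P j u) ->
  forall c, V c `<=` P c.
Proof.
move=> Pincr Pb IH c u; have [J JP] := jumps_between b c.
have [N] := ubnP (size J); elim: N c J JP u => // N IHN c J JP u szJ Vu.
have [Vcb|[j [jJ jc jb Vcj]]] := JP c (le_refl c); first exact/Pb/Vcb.
apply: (Pincr j) => //; apply: IH => // [|g v gj Vv]; first by rewrite -Vcj.
(* Strictly below [j] the jump [j] no longer occurs, so the list shrinks. *)
apply: (IHN g (rem j J)) (Vv); last first.
  by rewrite size_rem //; case: (J) jJ szJ.
move=> d dg; have jd' : lexlt (emb d) (emb j).
  by apply: lexle_lt_trans gj; rewrite -emb_lex.(emb_le).
have [|Vdb|[j' [j'J j'd j'b Vd]]] := JP d; [|by left|right; exists j'; split=> //].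
  move: jc; rewrite !emb_lex.(emb_le); apply: lexle_trans; exact: lexltW.
have j'j : j' != j.
  apply: contraTneq j'd => ->; rewrite emb_lex.(emb_le) lexleNgt negbK.
  exact: jd'.
by have /perm_mem/(_ j') := perm_to_rem jJ; rewrite j'J inE (negPf j'j) /= => <-.
Qed.

(* [shift a] is bijective on the graded pieces at the jumps other than [a]. *)
Lemma shifts_descend b s c u : (forall a, a \in s -> lexle a (emb b)) ->
  V c u -> V b (shifts s u) -> V b u.
Proof.
move=> sb; move: c u; apply: (jump_ind (b := b) (P := fun=> [set u | V b (shifts s u) -> V b u])).
- by move=> c d _ u.
- by move=> _ u Vu _.
move=> j u jb Vju IH /= Vsu.
have bj : lexlt (emb b) (emb j) by rewrite /lexlt -emb_lex.(emb_le).
have [|g gj Vg] := below_shifts (s := s) _ Vju (below_lt bj Vsu).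
  by move=> a /sb ab; apply: contraTneq bj => <-; rewrite /lexlt ab.
by apply: (IH g u) => //; rewrite -ltE.
Qed.

Lemma shifts_descend_below b s c u : (forall a, a \in s -> lexlt a (emb b)) ->
  V c u -> below V b (shifts s u) -> below V b u.
Proof.
move=> sb Vu Bu; apply: (below_shifts (s := s)) => // [a /sb|].
  by apply: contraTneq => ->; rewrite lexlt_irr.
by apply: (shifts_descend (s := s) _ Vu (below_sub Bu)) => a /sb /lexltW.
Qed.

(** At each jump [j] on the way down from [c] to [b], a power of [shift (emb j)] makes the element
    drop. Hence only shifts by values [<= emb c] are used. *)
Lemma shifts_exists b c u : V c u -> exists s : seq C,
  (forall a, a \in s -> lexle a (emb c)) /\ V b (shifts s u).
Proof.
apply: (jump_ind (b := b) (P := fun c => [set u | exists s : seq C,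
    (forall a, a \in s -> lexle a (emb c)) /\ V b (shifts s u)])) c u.
- move=> c d cd u [s [sc su]]; exists s; split=> // a /sc ac.
  by apply: lexle_trans ac _; rewrite -emb_lex.(emb_le).
- by move=> c u Vu; exists [::].
move=> j u jb Vu IH; have [N [g]] := df_nilp dV Vu.
rewrite ltE => gj /(IH _ _ gj)[s [sg su]]; exists (nseq N (emb j) ++ s); split=> [a|].
  rewrite mem_cat => /orP[|/sg]; last by move=> ag; apply: lexle_trans ag (lexltW gj).
  by rewrite mem_nseq => /andP[_ /eqP->]; apply: lexle_refl.
rewrite /shifts foldl_cat; move: su; congr (V b (foldl _ _ _)).
by elim: N (u) {Vu} => //= N IHN v; rewrite -IHN -iterSr.
Qed.

End OneFiltration.

(** Shifts by values [<= emb1 b] bring an element of [V b] into some [V b'] contained in [U c]. At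
    the jumps of [U] beyond [c] these shifts are injective on graded pieces, so the element was in
    [U c] from the start. *)
Lemma discrete_filtration_sub (K1 K2 : nzRingType) (le1 : rel K1) (le2 : rel K2)
    (emb1 : K1 -> C) (emb2 : K2 -> C) V U :
    lex_embedding le1 emb1 -> lex_embedding le2 emb2 ->
    discrete_filtration le1 emb1 V -> discrete_filtration le2 emb2 U ->
    (forall c, exists b, V b `<=` U c) ->
    (forall b u, V b u -> exists c, U c u) ->
  forall b c, [/\ lexle (emb1 b) (emb2 c) -> V b `<=` U c
                & lexlt (emb1 b) (emb2 c) -> V b `<=` below le2 U c].
Proof.
move=> e1 e2 dV dU cof exh b c; split=> bc u Vu; have [c' Uc'] := exh _ _ Vu.
  have [b' b'c] := cof c; have [s [sb /b'c su]] := shifts_exists e1 dV b' Vu.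
  by apply: (shifts_descend e2 dU) Uc' su => a /sb ab; apply: lexle_trans ab bc.
(* Aiming at [c - 1] instead of [c] makes the shifted element lie strictly below [c]. *)
have [b' b'c] := cof (c - 1); have [s [sb /b'c su]] := shifts_exists e1 dV b' Vu.
apply: (shifts_descend_below e2 dU) Uc' (below_lt e2 (pred_lt e2 c) su) => a /sb ab.
exact: lexle_lt_trans ab bc.
Qed.

End DiscreteFiltrations.

(** * The filtration by orders of a frame, its identification with V, and the V^+ conditions *)

Section LogarithmicLattice.
Context {R : realType} {F : fieldType} {M : lmodType F} {n : nat}.
Local Notation C := R[i].
Variables (k : {rmorphism C -> F}) (tt : F) (tt0 : tt != 0).
Variables (Z : set M) (w : 'I_n -> M) (nab : M -> M).
Hypothesis Zsp : kspace k Z.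
Hypothesis Ztt : forall u m, Z u -> Z (tt ^ m *: u).
Hypothesis indep : forall p : 'I_n -> {poly C},
  Z (\sum_i ptt k tt (p i) *: w i) -> forall i, p i = 0.
Hypothesis nab_lin : forall a u v,
  nab (k a *: u + v) = k a *: nab u + nab v.
Hypothesis nab_tt : forall m u,
  nab (tt ^ m *: u) = tt ^ m *: nab u + (m%:~R * tt ^ (m - 1)) *: u.
Hypothesis Znab : forall u, Z u -> Z (nab u).
Variables (nu kc : 'I_n -> C).
Hypothesis nab_w : forall i,
  Z (nab (w i) - (k (kc i) *: w (ordS i) - (tt^-1 * k (nu i)) *: w i)).
Hypothesis nu_kc : forall i, kc i != 0 -> lexle (nu (ordS i) - 1) (nu i).
Hypothesis n_gt0 : (0 < n)%N.

Local Notation span := (span k tt Z w).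
Let theta u := tt *: nab u.
Let spank E : kspace k (span E). Proof. exact: span_kspace. Qed.
Let spanZk E : Z `<=` span E. Proof. exact: spanZ. Qed.
Implicit Types (u v : M).

Lemma theta_lin a u v : theta (k a *: u + v) = k a *: theta u + theta v.
Proof. by rewrite /theta nab_lin scalerDr !scalerA mulrC. Qed.

Definition level i (m : int) : C := nu i - m%:~R.

Lemma theta_tw i m : Z (theta (tt ^ m *: w i) -
  (k (kc i) *: (tt ^ (m + 1) *: w (ordS i)) - k (level i m) *: (tt ^ m *: w i))).
Proof.
have := Ztt (m + 1) (nab_w i); congr Z.
have e : tt ^ (m + 1) = tt * tt ^ m by rewrite expfzDr // expr1z mulrC.
have e' : tt ^ m = tt * tt ^ (m - 1).
  by rewrite -{2}[tt]expr1z -expfzDr // addrCA subrr addr0.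
have -> : theta (tt ^ m *: w i) = tt ^ (m + 1) *: nab (w i) + m%:~R *: (tt ^ m *: w i).
  rewrite /theta nab_tt scalerDr !scalerA e; congr (_ + _ *: _).
  by rewrite mulrCA -e'.
have -> : k (level i m) *: (tt ^ m *: w i) =
    tt ^ (m + 1) *: ((tt^-1 * k (nu i)) *: w i) - m%:~R *: (tt ^ m *: w i).
  rewrite /level rmorphB rmorph_int scalerBl !scalerA e; congr (_ *: _ - _).
  by rewrite [tt * _]mulrC mulrA mulfK // mulrC.
rewrite !scalerBr ![_ *: (_ *: w (ordS i))]scalerA [k (kc i) * _]mulrC !opprB.
by rewrite [X in _ = _ + X]addrAC addrACA subrr addr0.
Qed.

Lemma lexle_level i p q : lexle (level i q) (level i p) = (p <= q).
Proof.
rewrite lexle0E -[0]/(0%:~R) (_ : _ - _ = (q - p)%:~R) ?lexle_int ?subr_ge0 //.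
by rewrite /level intrB; ring.
Qed.

(* The V-filtration read off the basis: [tt ^ m *: w i] has order [nu i - m]. *)
Definition Ufilt b : set M := span (fun i m => lexle (level i m) b).

Lemma Ufilt_incr b b' : lexle b b' -> Ufilt b `<=` Ufilt b'.
Proof. by move=> bb'; apply: (spanS Zsp) => i m; move/lexle_trans; apply. Qed.

Lemma level_tw b i m : lexle (level i m) b -> kc i != 0 ->
  lexle (level (ordS i) (m + 1)) b.
Proof.
move=> lb /nu_kc H; apply: lexle_trans lb; rewrite /level intrD opprD [- _ - 1]addrC addrA.
by rewrite lexleD2r.
Qed.

Lemma Ufilt_theta b : theta_stable theta (Ufilt b).
Proof.
apply: (span_min (S := [set u | Ufilt b (theta u)])) => /=.
- by apply: (kspace_preim theta_lin (spank _)).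
- by move=> u Zu; apply: spanZk; rewrite /theta -[tt]expr1z; apply/Ztt/Znab.
move=> i m lb; apply: (span_cong Zsp _ (theta_tw i m)).
apply: (kspaceB (spank _)).
  have [->|ne] := eqVneq (kc i) 0.
    by rewrite rmorph0 scale0r; case: (spank (fun i m => lexle (level i m) b)).
  by apply: (kspaceZ _ (spank _)); apply: spanX; apply: level_tw.
by apply: (kspaceZ _ (spank _)); apply: spanX.
Qed.

Lemma lex_id_embedding : lex_embedding (@lexle R) id.
Proof. by split=> // x y. Qed.

Lemma lex_max_exists (e : 'I_n -> C) : exists i0, forall i, lexle (e i) (e i0).
Proof.
case: (@arg_maxP _ _ 'I_n (Ordinal n_gt0) xpredT (fun i => lexpair (e i))) => // i0 _ H.
by exists i0 => i; rewrite lexleE; apply: H.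
Qed.

(** For fixed [i] the exponents of order at most [b] form a half-line, as the order decreases by 1
    with each power of [tt]. Its end is found as a least natural number after a translation by
    [N2]. *)
Lemma level_threshold b i : exists m : int,
  forall p, lexle (level i p) b = (m <= p).
Proof.
have [N1 N1P] := lex_archi (nu i) b; have [N2 N2P] := lex_archi b (nu i).
have lowN : ~~ lexle (level i (- N2%:Z)) b.
  by rewrite /level intrN opprK -(lexleD2r (- N2%:~R)) addrK; apply: (N2P N2).
have ex : exists j : nat, lexle (level i (j%:Z - N2%:Z)) b.
  exists (N1 + N2)%N; rewrite PoszD addrK; exact/lexltW/N1P.
case: (ex_minnP ex) => j jb jmin; exists (j%:Z - N2%:Z) => p.
apply/idP/idP => [pb|jp]; last by apply: lexle_trans jb; rewrite lexle_level.
have p2 : - N2%:Z < p.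
  by rewrite ltNge; apply: contra lowN; rewrite -(lexle_level i) => /lexle_trans; apply.
have := jmin `|(p + N2%:Z)%R|%N; rewrite gez0_abs; last by lia.
by rewrite addrK => /(_ pb); lia.
Qed.

Lemma Ufilt_discrete : discrete_filtration k Z theta (@lexle R) id Ufilt.
Proof.
split.
- by move=> b; apply: spank.
- by move=> b; apply: spanZk.
- exact: Ufilt_incr.
- exists [seq nu i | i <- enum 'I_n] => b.
  have /choice[m mP] := level_threshold b.
  (* The largest order [<= b] attained by a monomial is the jump at which [Ufilt b] begins; it lies
     in the coset of [nu i0]. *)
  have [i0 i0P] := lex_max_exists (fun i => level i (m i)).
  exists (nu i0); first by apply: map_f; rewrite mem_enum.
  exists (- m i0); rewrite intrN -/(level _ _).
  have lb : lexle (level i0 (m i0)) b by rewrite mP.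
  split=> //; apply/seteqP; split; last exact: Ufilt_incr.
  apply: (spanS Zsp) => i p; rewrite mP => ip; apply: lexle_trans (i0P i).
  by rewrite lexle_level.
- exact: Ufilt_theta.
move=> b; have bk : kspace k (below (@lexle R) Ufilt b).
  by apply: (kspace_below lex_id_embedding) => [c|]; [apply: spank|apply: Ufilt_incr].
have bth : theta_stable theta (below (@lexle R) Ufilt b).
  by move=> u [g gb Uu]; exists g => //; apply: Ufilt_theta.
have Zb : Z `<=` below (@lexle R) Ufilt b.
  by move=> u Zu; apply: (below_lt lex_id_embedding (pred_lt lex_id_embedding b)); apply: spanZk.
pose S := [set u | exists N, below (@lexle R) Ufilt b (iter N (shift k theta b) u)].
have itk N j u : below (@lexle R) Ufilt b (iter N (shift k theta b) u) ->
    below (@lexle R) Ufilt b (iter (j + N) (shift k theta b) u).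
  by move=> H; rewrite iterD; apply: iter_shift_stable.
apply: (span_min (S := S)); first split.
- by exists 0%N; case: bk.
- move=> a u v [N1 h1] [N2 h2]; exists (N1 + N2)%N; rewrite iter_shift_lin; last exact: theta_lin.
  by case: bk => _; apply; [rewrite addnC|]; apply: itk.
- by move=> u Zu; exists 0%N; apply: Zb.
move=> i m im; exists n.
(* Below the order [b], applying [theta + b] only moves [tt ^ m *: w i] to the next index and
   exponent, with a scalar that is a product of values of [kc]. After [n] moves the index is [i]
   again while the exponent has grown by [n], so the order has strictly dropped. *)
suff H N : exists a, below (@lexle R) Ufilt b
    (iter N (shift k theta b) (tt ^ m *: w i) -
       k a *: (tt ^ (m + N%:Z) *: w (iter N (@ordS n) i))) /\
    (a != 0 -> lexle (level (iter N (@ordS n) i) (m + N%:Z)) b).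
  have [a []] := H n; have -> : iter n (@ordS n) i = i.
    apply/val_inj; suff -> : forall N, val (iter N (@ordS n) i) = ((i + N) %% n)%N.
      by rewrite modnDr modn_small.
    elim=> [|N /= ->]; first by rewrite addn0 modn_small.
    by rewrite addnS -addn1 modnDml addn1.
  move=> Ha _; rewrite -(subrK (k a *: (tt ^ (m + n%:Z) *: w i)) (iter _ _ _)).
  apply: (kspaceD bk) => //; apply: (kspaceZ _ bk).
  exists (level i (m + n%:Z)); last by apply: spanX; apply: lexle_refl.
  rewrite (ltE lex_id_embedding); apply: lexlt_le_trans im.
  by rewrite /lexlt lexle_level; lia.
elim: N => [|N [a [ha hl]]].
  by exists 1; rewrite /= addr0 rmorph1 scale1r subrr; split=> //; case: bk.
set i' := iter N _ i in ha hl *; set m' := m + N%:Z in ha hl *.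
have -> : m + N.+1%:Z = m' + 1 by rewrite /m'; lia.
exists (a * kc i'); split; last first.
  by rewrite mulf_eq0 negb_or => /andP[/hl lb kc0]; apply: level_tw.
have := shift_stable b bk bth ha; rewrite (shiftB theta_lin) (shiftZ theta_lin).
set x := shift _ _ _ (iter _ _ _); set y := tt ^ m' *: w i' => hx.
have hy : below (@lexle R) Ufilt b
   (k a *: shift k theta b y - k (a * kc i') *: (tt ^ (m' + 1) *: w (ordS i'))).
  have [->|a0] := eqVneq a 0.
    by rewrite mul0r rmorph0 !scale0r subrr; case: bk.
  rewrite rmorphM -scalerA -scalerBr; apply: (kspaceZ _ bk).
  have := Zb _ (theta_tw i' m'); rewrite -/y /shift => H.
  have -> : theta y + k b *: y - k (kc i') *: (tt ^ (m' + 1) *: w (ordS i')) =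
      theta y - (k (kc i') *: (tt ^ (m' + 1) *: w (ordS i')) - k (level i' m') *: y)
      + k (b - level i' m') *: y.
    rewrite [k (b - _)]rmorphB scalerBl opprB [k (level i' m') *: y - _]addrC [theta y + (_ + _)]addrA.
    by rewrite addrACA subrr addr0 addrAC.
  apply: (kspaceD bk H).
  have [e|ne] := eqVneq b (level i' m').
    by rewrite {2}e subrr rmorph0 scale0r; case: bk.
  apply: (kspaceZ _ bk); exists (level i' m'); last by apply: spanX; apply: lexle_refl.
  by rewrite (ltE lex_id_embedding) lexlt_neqle eq_sym ne hl.
have := kspaceD bk hx hy; rewrite addrA subrK.
by [].
Qed.

Definition scaled (a : F) (S : set M) : set M := [set u | exists2 v, S v & u = a *: v].

(** These become the Brieskorn lattice, the Birkhoff lattice and the whole system once [w] is a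
    basis; see [GtE], [GplusE] and [NE]. *)
Definition Gminus : set M := span (fun _ m => m <= 0).
Definition Gplus : set M := span (fun _ m => 0 <= m).
Definition Gall : set M := span (fun _ _ => True).

Section VFiltration.
Context {K : nzRingType}.
Variables (le : rel K) (emb : K -> C) (V : K -> set M).
Hypothesis emb_lex : lex_embedding le emb.
Hypothesis dV : discrete_filtration k Z theta le emb V.
Hypothesis V_sub : forall b, V b `<=` Gall.
Hypothesis V_exh : forall u, Gall u -> exists b, V b u.
Hypothesis V_tt : forall b u, V b u -> V (b - 1) (tt *: u).
Hypothesis V_fg : forall b, exists s : seq M, (forall u, u \in s -> V b u) /\
  forall S, kspace k S -> Z `<=` S -> (forall u, u \in s -> S u) ->
    (forall u, S u -> S (tt *: u)) -> (forall u, S u -> S (theta u)) -> V b `<=` S.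
Hypothesis V_good : forall b, exists N : nat, forall j : nat, (N <= j)%N ->
  forall u, V (b - j%:R - 1) u -> exists2 v, V (b - j%:R) v & Z (u - tt *: v).

Lemma span_ge_tt m u : span (fun _ p => m <= p) u ->
  span (fun _ p => m + 1 <= p) (tt *: u).
Proof.
move=> mu; rewrite -[X in X *: u]expr1z.
apply: (spanW Zsp (span_scale Zsp tt0 Ztt (E := fun _ p => m <= p) 1 mu)).
by move=> i p; lia.
Qed.

Lemma span_ge_theta m : theta_stable theta (span (fun _ p => m <= p)).
Proof.
apply: (span_min (S := [set u | span (fun _ p => m <= p) (theta u)])) => /=.
- by apply: (kspace_preim theta_lin (spank _)).
- by move=> u Zu; apply: spanZk; rewrite /theta -[tt]expr1z; apply/Ztt/Znab.
move=> i p mp; apply: (span_cong Zsp _ (theta_tw i p)); apply: (kspaceB (spank _)).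
  by apply: (kspaceZ _ (spank _)); apply: spanX; lia.
by apply: (kspaceZ _ (spank _)); apply: spanX.
Qed.

(** Finitely many generators involve finitely many monomials, and neither [tt] nor [theta] lowers
    exponents, the pole being logarithmic. *)
Lemma V_bounded b : exists N : nat, V b `<=` span (fun _ m => - N%:Z <= m).
Proof.
have [s [sV smin]] := V_fg b.
have [N NP] : exists N : nat, forall u, u \in s -> span (fun _ m => - N%:Z <= m) u.
  have : forall u, u \in s -> Gall u by move=> u /sV; apply: V_sub.
  elim: (s) => [|u r IHr] rG; first by exists 0%N.
  have [|N1 N1P] := IHr; first by move=> v vr; apply: rG; rewrite inE vr orbT.
  have [N2 N2P] := span_fin Zsp (rG _ (mem_head _ _)).
  exists (N1 + N2)%N => v; rewrite inE => /orP[/eqP->|/N1P].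
    by apply: (spanW Zsp N2P) => i m []; lia.
  by apply: (spanS Zsp) => i m; lia.
exists N; apply: smin; [exact: spank|exact: spanZk|exact: NP| |].
  by move=> u /span_ge_tt; apply: (spanS Zsp) => i m; lia.
exact: span_ge_theta.
Qed.

(** Far enough down each [V] is [tt] times the preceding one modulo [Z], so the lower bound on the
    exponents rises by 1 each time. *)
Lemma V_deep (N : int) : exists b, V b `<=` span (fun _ m => N <= m).
Proof.
have [N0 N0P] := V_good 0; have [N1 N1P] := V_bounded (0 - N0%:R).
have deep j : V (0 - (N0 + j)%:R) `<=` span (fun _ m => j%:Z - N1%:Z <= m).
  elim: j => [|j IHj u].
    by rewrite addn0 => u /N1P; apply: (spanS Zsp) => i m; lia.
  rewrite addnS -addn1 natrD opprD addrA => /(N0P _ (leq_addr _ _))[v /IHj Hv].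
  by apply: (span_cong Zsp); apply: (spanW Zsp (span_ge_tt Hv)) => i m; lia.
exists (0 - (N0 + (N1 + `|N|))%:R) => u /deep; apply: (spanS Zsp) => i m; lia.
Qed.

Lemma U_contains c : exists N : int, span (fun _ m => N <= m) `<=` Ufilt c.
Proof.
have [i0 i0P] := lex_max_exists nu; have [N NP] := level_threshold c i0.
exists N; apply: (spanS Zsp) => i m; rewrite -NP; apply: lexle_trans.
by rewrite /level lexleD2r.
Qed.

(** Each [w i] lies in some [V], by exhaustion, and multiplication by [tt] lowers the index by 1. *)
Lemma V_contains b : exists N : int, span (fun _ m => N <= m) `<=` V b.
Proof.
have /choice[bi biP] : forall i, exists b, V b (w i).
  move=> i; apply: V_exh; rewrite -[w i]scale1r -(expr0z tt); exact: spanX.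
have [i0 i0P] := lex_max_exists (emb \o bi).
have [N NP] := lex_archi (emb (bi i0)) (emb b); exists N%:Z; apply: span_min.
- exact: (df_kspace dV).
- exact: (df_Z dV).
move=> i m Nm; suff : V (bi i0 - m%:~R) (tt ^ m *: w i).
  apply: (df_incr dV); rewrite emb_lex.(emb_le) -intrN emb_lex.(emb_int) intrN.
  exact/lexltW/NP.
have : V (bi i0) (w i) by apply: (df_incr dV) (biP i); rewrite emb_lex.(emb_le); apply: i0P.
have -> : m = `|m|%N%:Z by lia.
move: `|m|%N (w i) => j v Vv; elim: j => [|j IHj]; first by rewrite expr0z scale1r subr0.
by move/V_tt: IHj; rewrite scalerA -[in X in X -> _]exprnP -exprS -addn1 PoszD intrD opprD addrA.
Qed.

Lemma V_U b c :
  [/\ lexle (emb b) c -> V b `<=` Ufilt c & lexlt (emb b) c -> V b `<=` below (@lexle R) Ufilt c].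
Proof.
apply: (discrete_filtration_sub theta_lin emb_lex lex_id_embedding dV Ufilt_discrete).
  move=> {}c; have [N NP] := U_contains c; have [b' b'P] := V_deep N.
  by exists b'; apply: subset_trans NP.
move=> {}b u Vu; have [N NP] := V_bounded b.
have [i0 i0P] := lex_max_exists nu; exists (level i0 (- N%:Z)).
apply: (spanW Zsp (NP _ Vu)) => i m Nm; apply: (lexle_trans (y := level i0 m)).
  by rewrite /level lexleD2r.
by rewrite lexle_level.
Qed.

Lemma U_V c b :
  [/\ lexle c (emb b) -> Ufilt c `<=` V b & lexlt c (emb b) -> Ufilt c `<=` below le V b].
Proof.
apply: (discrete_filtration_sub theta_lin lex_id_embedding emb_lex Ufilt_discrete dV).
  move=> {}b; have [N NP] := V_contains b.
  have [i0 i0P] := lex_max_exists (fun i => - nu i).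
  exists (level i0 N); apply: subset_trans NP; apply: (spanS Zsp) => i m lm.
  rewrite -(lexle_level i); apply: lexle_trans lm _.
  by rewrite /level lexleD2r -lexleN2; apply: i0P.
move=> {}c u Uu; apply: V_exh; apply: (spanW Zsp Uu) => //.
Qed.

Lemma VE b : V b = Ufilt (emb b).
Proof.
by apply/seteqP; split; [apply: (V_U b (emb b)).1|apply: (U_V (emb b) b).1];
  apply: lexle_refl.
Qed.

Lemma Gminus_plus u : Gminus u -> Gplus u -> span (fun _ m => m = 0) u.
Proof.
by move=> u1 u2; apply: (spanW Zsp (span_cap Zsp tt0 Ztt indep u1 u2)) => i m; lia.
Qed.

Lemma scaled_Gminus : scaled tt^-1 Gminus = span (fun _ m => m < 0).
Proof.
apply/seteqP; split=> [_ [v Gv ->]|u].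
  rewrite -[tt^-1]/(tt ^ (-1)).
  by apply: (spanW Zsp (span_scale Zsp tt0 Ztt (E := fun _ m => m <= 0) (-1) Gv)) => i m; lia.
move=> Gu; exists (tt *: u); last by rewrite scalerA mulVf ?scale1r.
rewrite -[tt]expr1z; apply: (spanW Zsp (span_scale Zsp tt0 Ztt (E := fun _ m => m < 0) 1 Gu)).
by move=> i m; lia.
Qed.

Lemma span_split E E1 E2 : (forall i m, E i m -> E1 i m \/ E2 i m) ->
  forall u, span E u -> exists v x, [/\ span E1 v, span E2 x & u = v + x].
Proof.
move=> E12; apply: (span_min (S := [set u | exists v x, [/\ span E1 v, span E2 x & u = v + x]])).
- split=> [|a _ _ [v [x [v1 x1 ->]]] [v' [x' [v1' x1' ->]]]].
    by exists 0, 0; split; rewrite ?addr0 //; apply: (kspace0 (spank _)).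
  exists (k a *: v + v'), (k a *: x + x'); split; [by case: (spank E1) => _; apply
    |by case: (spank E2) => _; apply|by rewrite scalerDr addrACA].
- move=> u Zu; exists u, 0; split; rewrite ?addr0 //; first exact: spanZk.
  exact: (kspace0 (spank _)).
move=> i m /E12[E1im|E2im].
  exists (tt ^ m *: w i), 0; split; rewrite ?addr0 //; first exact: spanX.
  exact: (kspace0 (spank _)).
exists 0, (tt ^ m *: w i); split; rewrite ?add0r //; last exact: spanX.
exact: (kspace0 (spank _)).
Qed.

(** [V b] is spanned by monomials, hence so is its intersection with [Gminus]; the monomials with
    [m = 0] and with [m < 0] span the two summands. *)
Lemma Vplus_split b :
  (forall u, (Gminus `&` V b) u <-> exists v x, [/\ (Gminus `&` Gplus `&` V b) v,
     (scaled tt^-1 Gminus `&` V b) x & Z (u - (v + x))]) /\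
  (Gminus `&` Gplus `&` V b) `&` (scaled tt^-1 Gminus `&` V b) `<=` Z.
Proof.
rewrite scaled_Gminus VE; split=> [u|u [[[_ u2] _] [u3 _]]]; last first.
  by apply: (span0 Zsp _ (span_cap Zsp tt0 Ztt indep u2 u3)) => i m; lia.
split=> [[u1 u2]|[v [x [[[v1 v2] v3] [x1 x2] /spanZk uvx]]]].
  have := span_cap Zsp tt0 Ztt indep u1 u2.
  move=> /(span_split (E1 := fun i m => m = 0 /\ lexle (level i m) (emb b))
     (E2 := fun i m => m < 0 /\ lexle (level i m) (emb b)))[].
    move=> i m [m0 l]; have [e|ne] := eqVneq m 0; [by left|right].
    by rewrite lt_neqAle ne.
  move=> v [x [v1 x1 ->]]; exists v, x; split; [split; first split|split|].
  - by apply: (spanW Zsp v1) => i m []; lia.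
  - by apply: (spanW Zsp v1) => i m []; lia.
  - by apply: (spanW Zsp v1) => i m [].
  - by apply: (spanW Zsp x1) => i m [].
  - by apply: (spanW Zsp x1) => i m [].
  by rewrite subrr; case: Zsp.
have uE : u = (u - (v + x)) + (v + x) by rewrite subrK.
split; rewrite uE; apply: (kspaceD (spank _)) (uvx _) _; apply: (kspaceD (spank _)) => //.
by apply: (spanW Zsp x1) => i m; lia.
Qed.

(** On [w i] the residue is [(b - nu i) w_i + tau kc_i w_(i+1)]. The first term vanishes or has
    order [nu i < b]; the second is [tau] times an element of order at most [b + 1] by the cyclic
    inequality, unless [kc i = 0]. *)
Lemma Vplus_residue b u : (Gminus `&` Gplus `&` V b) u -> exists v x,
  [/\ (Gminus `&` Gplus `&` below le V b) v, (Gminus `&` Gplus `&` V (b + 1)) x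
    & Z (shift k theta (emb b) u - (v + tt *: x))].
Proof.
move=> [[u1 u2]]; rewrite VE => u3.
have zsub (E : int -> Prop) : E 0 -> span (fun _ m => m = 0) `<=` span (fun _ => E).
  by move=> E0; apply: (spanS Zsp) => i m ->.
have bk := below_kspace emb_lex dV b.
have emb1 : emb (b + 1) = emb b + 1 by have := emb_int emb_lex b 1.
have Gk : kspace k (Gminus `&` Gplus `&` below le V b).
  by apply: kspaceI => //; apply: kspaceI; apply: spank.
have Gk' : kspace k (Gminus `&` Gplus `&` V (b + 1)).
  by apply: kspaceI (df_kspace dV _); apply: kspaceI; apply: spank.
apply: (span_min (k := k) (tt := tt) (Z := Z) (w := w) (E := fun i m => m = 0 /\ lexle (level i m) (emb b))
  (S := [set u | exists v x, [/\ (Gminus `&` Gplus `&` below le V b) v,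
    (Gminus `&` Gplus `&` V (b + 1)) x & Z (shift k theta (emb b) u - (v + tt *: x))]])).
- split=> [|a u' v' [v1 [x1 [Hv1 Hx1 Z1]]] [v2 [x2 [Hv2 Hx2 Z2]]]].
    exists 0, 0; split; [by case: Gk|by case: Gk'|].
    by rewrite (shift0 theta_lin) scaler0 addr0 subrr; case: Zsp.
  exists (k a *: v1 + v2), (k a *: x1 + x2).
  split; [by case: Gk => _; apply|by case: Gk' => _; apply|].
  case: Zsp => _ /(_ a _ _ Z1 Z2); congr Z.
  rewrite (shift_lin theta_lin) scalerBr addrACA -opprD; congr (_ - _).
  by rewrite !scalerDr !scalerA [_ * k a]mulrC addrACA.
- move=> v Zv; exists 0, 0; split; [by case: Gk|by case: Gk'|].
  rewrite scaler0 addr0 subr0; apply: shift_stable => // y Zy.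
  by rewrite /theta -[tt]expr1z; apply/Ztt/Znab.
- move=> i m [-> lb]; rewrite expr0z scale1r.
  have w0 j : span (fun _ m => m = 0) (w j) by rewrite -[w j]scale1r -(expr0z tt); apply: spanX.
  exists (k (emb b - nu i) *: w i), (k (kc i) *: w (ordS i)); split.
  + split; first by split; apply: (kspaceZ _ (spank _)); apply: zsub (w0 i).
    have [->|ne] := eqVneq (emb b) (nu i).
      by rewrite subrr rmorph0 scale0r; case: bk.
    apply: (kspaceZ _ bk); apply: (U_V (nu i) b).2.
      by move: lb; rewrite /level subr0 lexlt_neqle eq_sym ne.
    by rewrite -[w i]scale1r -(expr0z tt); apply: spanX; rewrite /level subr0 lexle_refl.
  + split; first by split; apply: (kspaceZ _ (spank _)); apply: zsub (w0 _).
    have [->|ne] := eqVneq (kc i) 0; first by rewrite rmorph0 scale0r; case: (df_kspace dV (b + 1)).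
    apply: (kspaceZ _ (df_kspace dV _)); rewrite VE emb1.
    rewrite -[w _]scale1r -(expr0z tt); apply: spanX.
    have := level_tw lb ne; rewrite add0r /level subr0.
    by rewrite -(lexleD2r 1) subrK.
  have := theta_tw i 0; rewrite expr0z scale1r add0r expr1z; congr Z.
  rewrite /shift /level subr0 [tt *: _]scalerA [tt * _]mulrC -scalerA.
  by rewrite [k (emb b - _)]rmorphB scalerBl -[_ - _ + _]addrA [- _ + _]addrC addrKA.
exact: (span_cap Zsp tt0 Ztt indep (Gminus_plus u1 u2) u3).
Qed.

Lemma Vplus_direct b :
  (Gminus `&` Gplus `&` below le V b) `&` scaled tt (Gminus `&` Gplus `&` V (b + 1)) `<=` Z.
Proof.
move=> u [[[u1 u2] _] [x [[x1 x2] _] ux]].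
have u3 : span (fun _ m => m = 1) u.
  rewrite ux -[X in X *: x]expr1z.
  apply: (spanW Zsp (span_scale Zsp tt0 Ztt (E := fun _ m => m = 0) 1 (Gminus_plus x1 x2))).
  by move=> i m; lia.
by apply: (span0 Zsp _ (span_cap Zsp tt0 Ztt indep u1 u3)) => i m; lia.
Qed.

End VFiltration.

End LogarithmicLattice.

(** * Derivations and differential forms *)

Lemma fraction_repr {D : idomainType} (r : {fraction D}) :
  r = tofrac \n_(repr r) / tofrac \d_(repr r).
Proof.
have d0 : tofrac \d_(repr r) != 0 by rewrite tofrac_eq0 denom_ratioP.
apply: (mulIf d0); rewrite divfK //.
rewrite -{1}[r]reprK; move: (repr r) => x.
rewrite !piE; apply/eqP; rewrite FracField.equivf_def /FracField.mulf.
rewrite !numden_Ratio ?mulr1 ?mulf_neq0 ?denom_ratioP ?oner_eq0 //.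
by rewrite mulrC.
Qed.

Section FieldIdentities.
Variable F : fieldType.
Implicit Types a b c d : F.

(** Equal fractions whose cross-multiplied identity has been differentiated have equal derivatives.
    This makes the quotient rule independent of the representative. *)
Lemma quotient_rule_unique a b c d a' b' c' d' : b != 0 -> d != 0 ->
  a * d = c * b -> a' * d + a * d' = c' * b + c * b' ->
  (a' * b - a * b') / b ^+ 2 = (c' * d - c * d') / d ^+ 2.
Proof.
move=> b0 d0 e1 e2; apply/eqP; rewrite eqr_div ?expf_neq0 //; apply/eqP.
have e3 : a' * d = c' * b + c * b' - a * d' by rewrite -e2 addrK.
transitivity (b * d * (a' * d) - b' * d * (a * d)); first ring.
transitivity (b * d * (c' * b + c * b') - b * d' * (a * d) - b' * d * (a * d)).
  by rewrite e3; ring.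
by rewrite e1; ring.
Qed.

Lemma quotient_rule_add (x y z t x' y' z' t' : F) : y != 0 -> t != 0 ->
  ((x' * t + x * t' + (z' * y + z * y')) * (y * t)
     - (x * t + z * y) * (y' * t + y * t')) / (y * t) ^+ 2 =
  (x' * y - x * y') / y ^+ 2 + (z' * t - z * t') / t ^+ 2.
Proof. by move=> y0 t0; field; rewrite y0 t0. Qed.

Lemma quotient_rule_mul (x y z t x' y' z' t' : F) : y != 0 -> t != 0 ->
  ((x' * z + x * z') * (y * t) - x * z * (y' * t + y * t')) / (y * t) ^+ 2 =
  (x' * y - x * y') / y ^+ 2 * (z / t) + x / y * ((z' * t - z * t') / t ^+ 2).
Proof. by move=> y0 t0; field; rewrite y0 t0. Qed.

End FieldIdentities.

Section Derivations.
Variable F : fieldType.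
Implicit Types (D : F -> F) (a b : F).

Record derivation D : Prop := Derivation {
  derivD : forall a b, D (a + b) = D a + D b;
  derivM : forall a b, D (a * b) = D a * b + a * D b }.

Variable D : F -> F.
Hypothesis der : derivation D.

Lemma deriv0 : D 0 = 0.
Proof. by apply: (addrI (D 0)); rewrite -(derivD der) !addr0. Qed.

Lemma deriv1 : D 1 = 0.
Proof.
by apply: (addrI (D 1)); rewrite -[in RHS](mulr1 1) (derivM der) mulr1 mul1r addr0.
Qed.

Lemma derivN a : D (- a) = - D a.
Proof. by apply: (addrI (D a)); rewrite -(derivD der) !subrr deriv0. Qed.

Lemma derivB a b : D (a - b) = D a - D b.
Proof. by rewrite (derivD der) derivN. Qed.

Lemma derivV a : D a^-1 = - D a / a ^+ 2.
Proof.
have [->|a0] := eqVneq a 0; first by rewrite invr0 deriv0 oppr0 mul0r.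
apply: (mulfI a0); have := derivM der a a^-1; rewrite mulfV // deriv1.
move/eqP; rewrite eq_sym addrC addr_eq0 => /eqP->.
by field.
Qed.

Lemma deriv_sum (I : Type) (r : seq I) (P : pred I) (G : I -> F) :
  D (\sum_(i <- r | P i) G i) = \sum_(i <- r | P i) D (G i).
Proof. exact: (big_morph D (derivD der) deriv0). Qed.

Lemma derivXz a (m : int) : a != 0 -> D (a ^ m) = m%:~R * a ^ (m - 1) * D a.
Proof.
move=> a0; have aS (p : int) : a ^ p = a ^ (p - 1) * a.
  by rewrite -[X in _ * X]expr1z -expfzDr // subrK.
elim/int_ind: m => [|j IHj|j IHj]; first by rewrite deriv1 !mul0r.
  have -> : j.+1%:Z = j%:Z + 1 by lia.
  rewrite addrK [a ^ (_ + 1)]aS addrK (derivM der) IHj [a ^ j in RHS]aS.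
  by rewrite [a ^ j in X in _ + X]aS intrD; ring.
have := derivM der (a ^ (- j.+1%:Z)) a; have -> : - j.+1%:Z = - j%:Z - 1 by lia.
rewrite -aS IHj => /esym/(canRL (addrK _)) e.
apply: (mulIf a0); rewrite e [a ^ (- j%:Z - 1)]aS intrB.
ring.
Qed.

End Derivations.

(** * Extension of derivations to the fraction field *)

Section FractionDerivations.
Context {D : idomainType}.
Local Notation F := {fraction D}.

Lemma derivation_ext (d1 d2 : F -> F) : derivation d1 -> derivation d2 ->
  (forall p, d1 (tofrac p) = d2 (tofrac p)) -> d1 =1 d2.
Proof.
move=> der1 der2 d12 r; rewrite [r]fraction_repr.
by rewrite (derivM der1) (derivM der2) (derivV der1) (derivV der2) !d12.
Qed.

Definition frac_deriv (d : D -> D) (r : F) : F :=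
  let p := \n_(repr r) in let q := \d_(repr r) in
  tofrac (d p * q - p * d q) / tofrac (q ^+ 2).

Variable d : D -> D.
Hypothesis dD : forall p q, d (p + q) = d p + d q.
Hypothesis dM : forall p q, d (p * q) = d p * q + p * d q.

(** [frac_deriv] goes through a chosen representative, of which nothing is known; here the rule is
    freed from that choice. *)
Lemma frac_deriv_frac p q : q != 0 -> frac_deriv d (tofrac p / tofrac q) =
  (tofrac (d p) * tofrac q - tofrac p * tofrac (d q)) / tofrac q ^+ 2.
Proof.
move=> q0; rewrite /frac_deriv; set r := tofrac p / tofrac q.
have := fraction_repr r; rewrite {1}/r; set x := \n_(repr r); set y := \d_(repr r).
have y0 : y != 0 by apply: denom_ratioP.
move/eqP; rewrite eqr_div ?tofrac_eq0 // -!tofracM tofrac_eq => /eqP e.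
rewrite tofracXn tofracB !tofracM.
apply: quotient_rule_unique; rewrite ?tofrac_eq0 //; first by rewrite -!tofracM e.
by rewrite -!tofracM -!tofracD -!dM e.
Qed.

Lemma frac_deriv_tofrac p : frac_deriv d (tofrac p) = tofrac (d p).
Proof.
have d1 : d 1 = 0.
  by apply: (addrI (d 1)); rewrite addr0; have := dM 1 1; rewrite !mulr1 mul1r.
have := @frac_deriv_frac p 1 (oner_neq0 _).
by rewrite d1 tofrac0 mulr0 subr0 tofrac1 expr1n !mulr1 !invr1 !mulr1.
Qed.

Lemma frac_derivation : derivation (frac_deriv d).
Proof.
split=> a b; rewrite [a]fraction_repr [b]fraction_repr;
  move: (denom_ratioP (repr a)) (denom_ratioP (repr b));
  move: (\n_(repr a)) (\d_(repr a)) (\n_(repr b)) (\d_(repr b)) => x y z t y0 t0.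
  have -> : tofrac x / tofrac y + tofrac z / tofrac t =
      tofrac (x * t + z * y) / tofrac (y * t).
    by rewrite addf_div ?tofrac_eq0 // tofracD !tofracM.
  rewrite !frac_deriv_frac ?mulf_neq0 // !dD !dM !(tofracD, tofracM).
  by apply: quotient_rule_add; rewrite tofrac_eq0.
have -> : tofrac x / tofrac y * (tofrac z / tofrac t) = tofrac (x * z) / tofrac (y * t).
  by rewrite mulf_div !tofracM.
rewrite !frac_deriv_frac ?mulf_neq0 // !dM !(tofracD, tofracM).
by apply: quotient_rule_mul; rewrite tofrac_eq0.
Qed.

End FractionDerivations.

(** The commutator of two derivations is again a derivation, and it vanishes on [D], hence on all
    fractions. *)
Lemma frac_deriv_comm {D : idomainType} (d1 d2 : D -> D) :
    (forall p q, d1 (p + q) = d1 p + d1 q) ->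
    (forall p q, d1 (p * q) = d1 p * q + p * d1 q) ->
    (forall p q, d2 (p + q) = d2 p + d2 q) ->
    (forall p q, d2 (p * q) = d2 p * q + p * d2 q) ->
    (forall p, d1 (d2 p) = d2 (d1 p)) ->
  forall r, frac_deriv d1 (frac_deriv d2 r) = frac_deriv d2 (frac_deriv d1 r).
Proof.
move=> d1D d1M d2D d2M d12 r; apply/eqP; rewrite -subr_eq0; apply/eqP.
have der1 := frac_derivation d1D d1M; have der2 := frac_derivation d2D d2M.
pose D1 := frac_deriv d1; pose D2 := frac_deriv d2.
apply: (@derivation_ext _ (fun a => D1 (D2 a) - D2 (D1 a)) (fun=> 0)).
- split=> a b; rewrite /D1 /D2.
    by rewrite !(derivD der1, derivD der2); ring.
  by rewrite !(derivD der1, derivD der2, derivM der1, derivM der2); ring.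
- by split=> a b; rewrite ?mul0r ?mulr0 addr0.
by move=> p; rewrite /D1 /D2 !frac_deriv_tofrac // d12 subrr.
Qed.

Lemma mpoly_alg_ind {D : nzRingType} {n : nat} (P : {mpoly D[n]} -> Prop) :
    (forall a, P a%:MP) -> (forall i, P 'X_i) ->
    (forall p q, P p -> P q -> P (p + q)) ->
    (forall p q, P p -> P q -> P (p * q)) ->
  forall p, P p.
Proof.
move=> PC PX PD PM p; rewrite [p]mpolyE; elim/big_ind: _ => [|x y|m _]; [by rewrite -mpolyC0|exact: PD|].
 rewrite -mul_mpolyC; apply: (PM) => //.
rewrite mpolyXE_id; elim/big_ind: _ => [|x y|i _]; [by rewrite -mpolyC1|exact: PM|].
by elim: (m i) => [|k IHk]; rewrite ?expr0 -?mpolyC1 // exprS; apply: PM.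
Qed.

Section Widening.
Context {C : nzRingType} {n : nat}.
Implicit Types p q : {mpoly C[n]}.

Lemma widen_neq_max (i : 'I_n) : widen_ord (leqnSn n) i == ord_max = false.
Proof. by apply/eqP => /(congr1 val) /= e; have := ltn_ord i; rewrite e ltnn. Qed.

Lemma mwidenX_id i : mwiden ('X_i : {mpoly C[n]}) = 'X_(widen_ord (leqnSn n) i).
Proof. by rewrite /mwiden mmapX mmap1U. Qed.

Lemma mderivXU m (i j : 'I_m) : ('X_i : {mpoly C[m]})^`M(j) = (i == j)%:R.
Proof.
rewrite mderivX mnmE; case: eqP => [->|_]; last by rewrite scale0r.
by rewrite scale1r -{1}[U_(j)%MM]add0m addmK mpolyX0.
Qed.

Lemma mderiv_mwiden i p : (mwiden p)^`M(widen_ord (leqnSn n) i) = mwiden p^`M(i).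
Proof.
move: p; apply: mpoly_alg_ind => [x|j|p q IHp IHq|p q IHp IHq].
- by rewrite mwidenC !mderivC mwiden0.
- rewrite mwidenX_id !mderivXU rmorph_nat; congr (_ %:R).
- by rewrite mwidenD !mderivD mwidenD IHp IHq.
by rewrite mwidenM !mderivM mwidenD !mwidenM IHp IHq.
Qed.

Lemma mderiv_mwiden_max p : (mwiden p)^`M(ord_max) = 0.
Proof.
move: p; apply: mpoly_alg_ind => [x|j|p q IHp IHq|p q IHp IHq].
- by rewrite mwidenC mderivC.
- by rewrite mwidenX_id mderivXU widen_neq_max.
- by rewrite mwidenD mderivD IHp IHq addr0.
by rewrite mwidenM mderivM IHp IHq mul0r mulr0 addr0.
Qed.

End Widening.

(** * Partial derivatives on C(x, tau) *)

Section RationalFunctions.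
Context {R : realType} {n : nat}.
Local Notation C := R[i].
Local Notation F := (@xtfield R n).
Implicit Types (p q : {mpoly C[n]}) (a b : F).

Fact xfun_is_zmod_morphism : zmod_morphism (@xfun R n).
Proof. by move=> p q; rewrite /xfun mwidenB tofracB. Qed.
Fact xfun_is_monoid_morphism : monoid_morphism (@xfun R n).
Proof. by split=> [|p q]; rewrite /xfun ?mwiden1 ?tofrac1 // mwidenM tofracM. Qed.
HB.instance Definition _ :=
  GRing.isZmodMorphism.Build {mpoly C[n]} F (@xfun R n) xfun_is_zmod_morphism.
HB.instance Definition _ :=
  GRing.isMonoidMorphism.Build {mpoly C[n]} F (@xfun R n) xfun_is_monoid_morphism.

Fact constF_is_zmod_morphism : zmod_morphism (@constF R n).
Proof. by move=> x y; rewrite /constF mpolyCB rmorphB. Qed.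
Fact constF_is_monoid_morphism : monoid_morphism (@constF R n).
Proof. by split=> [|x y]; rewrite /constF ?mpolyC1 ?rmorph1 // mpolyCM rmorphM. Qed.
HB.instance Definition _ :=
  GRing.isZmodMorphism.Build C F (@constF R n) constF_is_zmod_morphism.
HB.instance Definition _ :=
  GRing.isMonoidMorphism.Build C F (@constF R n) constF_is_monoid_morphism.

Lemma fderE j : @fder R n j = frac_deriv (mderiv j).
Proof. by rewrite /fder /frac_deriv. Qed.

Lemma fder_derivation j : derivation (@fder R n j).
Proof.
rewrite fderE; apply: frac_derivation; [exact: mderivD|exact: mderivM].
Qed.

Lemma fder_tofrac j (p : {mpoly C[n.+1]}) : @fder R n j (tofrac p) = tofrac p^`M(j).
Proof. rewrite fderE; apply: frac_deriv_tofrac; exact: mderivM. Qed.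

Lemma fder_comm i j a : fder i (fder j a) = fder j (fder i a).
Proof.
rewrite !fderE; apply: frac_deriv_comm; [exact: mderivD|exact: mderivM|
  exact: mderivD|exact: mderivM|exact: mderiv_comm].
Qed.

Lemma dx_der i : derivation (@dx_ R n i). Proof. exact: fder_derivation. Qed.
Lemma dtau_der : derivation (@dtau R n). Proof. exact: fder_derivation. Qed.

Lemma dx_xfun i p : dx_ i (xfun p) = xfun p^`M(i).
Proof. by rewrite /dx_ /xfun fder_tofrac mderiv_mwiden. Qed.

Lemma dtau_xfun p : dtau (xfun p) = 0.
Proof. by rewrite /dtau /xfun fder_tofrac mderiv_mwiden_max tofrac0. Qed.

Lemma dx_constF i c : dx_ i (@constF R n c) = 0.
Proof. by rewrite /constF dx_xfun mderivC rmorph0. Qed.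

Lemma dtau_constF c : dtau (@constF R n c) = 0.
Proof. exact: dtau_xfun. Qed.

Lemma dx_tau i : dx_ i (@tau R n) = 0.
Proof.
by rewrite /dx_ /tau fder_tofrac mderivXU eq_sym widen_neq_max tofrac0.
Qed.

Lemma dtau_tau : dtau (@tau R n) = 1.
Proof. by rewrite /dtau /tau fder_tofrac mderivXU eqxx tofrac1. Qed.

Lemma dx_comm i j a : dx_ i (dx_ j a) = dx_ j (dx_ i a).
Proof. exact: fder_comm. Qed.

Lemma dx_dtau_comm i a : dx_ i (dtau a) = dtau (dx_ i a).
Proof. exact: fder_comm. Qed.

Lemma tau_neq0 : @tau R n != 0.
Proof.
apply/eqP => t0; have := dtau_tau; rewrite t0 (deriv0 dtau_der) => /eqP.
by rewrite eq_sym oner_eq0.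
Qed.

Lemma xfun_inj : injective (@xfun R n).
Proof. by move=> p q /eqP; rewrite /xfun tofrac_eq => /eqP /inj_mwiden. Qed.

End RationalFunctions.

(* Forms with coefficients in an arbitrary field: with the field abstract,
   unification never unfolds the fraction field of [Defs]. *)
Section FormOperations.
Context {F : fieldType} {n : nat}.

Definition aform := {ffun {set 'I_n} -> F^o}.
Local Notation form := aform.
Implicit Types (w : form) (a : F).

Definition asign (i : 'I_n) (I : {set 'I_n}) : F :=
  (-1) ^+ #|[pred j in I | (j < i)%N]|.

Definition awedge (i : 'I_n) w : form :=
  [ffun I : {set 'I_n} => if i \in I then asign i I * w (I :\ i)%SET else 0].

Definition acontract (i : 'I_n) w : form :=
  [ffun I : {set 'I_n} => if i \in I then 0 else asign i I * w (i |: I)%SET].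

Definition amap (D : F -> F) w : form := [ffun I => D (w I)].

Implicit Types (u v : form) (b : F) (I J : {set 'I_n}) (i j : 'I_n).

Lemma aformD u v I : (u + v) I = u I + v I. Proof. by rewrite ffunE. Qed.
Lemma aformN u I : (- u) I = - u I. Proof. by rewrite ffunE. Qed.
Lemma aform0 I : (0 : form) I = 0. Proof. by rewrite ffunE. Qed.
Lemma aformZ a u I : (a *: u) I = a * u I. Proof. by rewrite ffunE. Qed.
Definition aformE := (aformD, aformN, aform0, aformZ).

Lemma awedge_lin i a u v : awedge i (a *: u + v) = a *: awedge i u + awedge i v.
Proof.
apply/ffunP => I; rewrite !ffunE; case: ifP => _; last by rewrite scaler0 addr0.
by rewrite mulrDr; congr (_ + _); rewrite mulrCA.
Qed.
HB.instance Definition _ i := GRing.isLinear.Build F form form _ (awedge i)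
  (@awedge_lin i).

Lemma awedgeZ i a u : awedge i (a *: u) = a *: awedge i u.
Proof. exact: linearZ. Qed.

Lemma acontract_lin i a u v : acontract i (a *: u + v) = a *: acontract i u + acontract i v.
Proof.
apply/ffunP => I; rewrite !ffunE; case: ifP => _; first by rewrite scaler0 addr0.
by rewrite mulrDr; congr (_ + _); rewrite mulrCA.
Qed.
HB.instance Definition _ i := GRing.isLinear.Build F form form _ (acontract i)
  (@acontract_lin i).

Lemma asignD1 i j I : i \in I ->
  asign j (I :\ i)%SET = (if (i < j)%N then -1 else 1) * asign j I.
Proof.
move=> iI; rewrite /asign; case: ltnP => ij.
  rewrite (cardD1 i [pred k in I | (k < j)%N]) inE /= iI ij addSn add0n exprS mulrA.
  rewrite mulrNN !mul1r; congr (_ ^+ _); apply: eq_card => k; rewrite !inE.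
  by rewrite -andbA.
rewrite mul1r; congr (_ ^+ _); apply: eq_card => k; rewrite !inE.
have [->|//] := eqVneq k i.
by rewrite iI /= ltnNge ij.
Qed.

Lemma asignU1 i j I : i \notin I ->
  asign j (i |: I)%SET = (if (i < j)%N then -1 else 1) * asign j I.
Proof.
move=> iI; have := asignD1 j (setU11 i I); rewrite finset.setU1K // => ->.
by case: ifP => _; rewrite ?mulrA ?mulrNN ?mul1r.
Qed.

Lemma asignK i I : asign i I * asign i I = 1.
Proof. by rewrite /asign -expr2 sqrr_sign. Qed.

Lemma awedge_anti i j u : awedge i (awedge j u) = - awedge j (awedge i u).
Proof.
apply/ffunP => I; rewrite !ffunE; have [->|ij] := eqVneq i j.
  by rewrite !inE eqxx /=; case: ifP; rewrite ?mulr0 oppr0.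
rewrite !inE (negPf ij) eq_sym (negPf ij) /=.
case: (boolP (i \in I)) => iI; case: (boolP (j \in I)) => jI; rewrite ?mulr0 ?oppr0 //.
have -> : (I :\ i :\ j = I :\ j :\ i)%SET by apply/setP => x; rewrite !inE andbCA.
rewrite !asignD1 //; case: (ltngtP i j) ij => [_|_|/val_inj->]; last by rewrite eqxx.
  by move=> _; ring.
by move=> _; ring.
Qed.

Lemma acontract_awedge i j u :
  acontract j (awedge i u) + awedge i (acontract j u) = (i == j)%:R *: u.
Proof.
apply/ffunP => I; rewrite !ffunE; have [<-|ij] := eqVneq i j.
  rewrite setU11 scale1r; case: (boolP (i \in I)) => iI.
    rewrite !inE eqxx /= add0r asignD1 // ltnn mul1r mulrA asignK mul1r. by rewrite finset.setD1K.
  by rewrite addr0 asignU1 // ltnn mul1r mulrA asignK mul1r finset.setU1K.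
rewrite scale0r !inE (negPf ij) eq_sym (negPf ij) /=.
case: (boolP (i \in I)) => iI; case: (boolP (j \in I)) => jI; rewrite ?mulr0 ?addr0 //.
have -> : ((j |: I) :\ i = j |: I :\ i)%SET.
  apply/setP => x; rewrite !inE; have [->|//] := eqVneq x i.
  by rewrite (negPf ij).
rewrite asignU1 // asignD1 //; case: (ltngtP i j) ij => [_|_|/val_inj->]; last by rewrite eqxx.
  by move=> _; ring.
by move=> _; ring.
Qed.

Lemma sum_awedge_acontract u I : (\sum_i awedge i (acontract i u)) I = #|I|%:R * u I.
Proof.
rewrite sum_ffunE (bigID (mem I)) /= addrC big1 ?add0r => [|i /negPf iI]; last first.
  by rewrite ffunE iI.
rewrite (eq_bigr (fun=> u I)) => [|i iI]; first by rewrite sumr_const [RHS]mulr_natl.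
by rewrite !ffunE iI !inE eqxx /= asignD1 // ltnn mul1r mulrA asignK mul1r finset.setD1K.
Qed.

Section MapCoef.
Variable D : F -> F.
Hypothesis der : derivation D.

Lemma amapD u v : amap D (u + v) = amap D u + amap D v.
Proof. by apply/ffunP => I; rewrite !ffunE (derivD der). Qed.

Lemma amapZ a u : amap D (a *: u) = D a *: u + a *: amap D u.
Proof. by apply/ffunP => I; rewrite !ffunE (derivM der). Qed.

Lemma amap_awedge i u : amap D (awedge i u) = awedge i (amap D u).
Proof.
apply/ffunP => I; rewrite !ffunE; case: ifP => _; last exact: (deriv0 der).
rewrite (derivM der) /asign (_ : D _ = 0) ?mul0r ?add0r //.
rewrite -signr_odd; case: (odd _); rewrite ?expr1 ?expr0 ?(derivN der) (deriv1 der) ?oppr0 //.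
Qed.

Lemma amap_acontract i u : amap D (acontract i u) = acontract i (amap D u).
Proof.
apply/ffunP => I; rewrite !ffunE; case: ifP => _; first exact: (deriv0 der).
rewrite (derivM der) /asign (_ : D _ = 0) ?mul0r ?add0r //.
rewrite -signr_odd; case: (odd _); rewrite ?expr1 ?expr0 ?(derivN der) (deriv1 der) ?oppr0 //.
Qed.

Lemma amap_sum (I : Type) (r : seq I) (P : pred I) (G : I -> form) :
  amap D (\sum_(i <- r | P i) G i) = \sum_(i <- r | P i) amap D (G i).
Proof.
apply: (big_morph (amap D) amapD).
by apply/ffunP => J; rewrite !ffunE (deriv0 der).
Qed.
End MapCoef.

Lemma amap_comm (D D' : F -> F) u : (forall a, D (D' a) = D' (D a)) ->
  amap D (amap D' u) = amap D' (amap D u).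
Proof. by move=> DD'; apply/ffunP => I; rewrite !ffunE DD'. Qed.

End FormOperations.

Ltac form_ring := apply/ffunP => ?; rewrite !aformE; ring.

(** * Exterior derivative and Lie derivative along the Euler field *)

Section ExteriorCalculus.
Context {F : fieldType} {n : nat}.
Local Notation form := (@aform F n).
Hypothesis F2 : 2%:R != 0 :> F.
Variables (D : 'I_n -> F -> F) (X : 'I_n -> F).
Hypothesis der : forall i, derivation (D i).
Hypothesis D_comm : forall i j a, D i (D j a) = D j (D i a).
Hypothesis DX : forall i j, D i (X j) = (i == j)%:R.
Implicit Types (u v w : form) (a b : F) (I : {set 'I_n}).

Definition gd u : form := \sum_i awedge i (amap (D i) u).
Definition gwedge a u : form := \sum_i D i a *: awedge i u.
Definition giota u : form := \sum_i X i *: acontract i u.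
Definition glie u : form := gd (giota u) + giota (gd u).
Definition gE a : F := \sum_i X i * D i a.

Lemma gdD u v : gd (u + v) = gd u + gd v.
Proof.
rewrite /gd -big_split; apply: eq_bigr => i _.
by rewrite (amapD (der i)) raddfD.
Qed.

Lemma gd0 : gd 0 = 0.
Proof. by apply: (addrI (gd 0)); rewrite -gdD !addr0. Qed.

Lemma gdN u : gd (- u) = - gd u.
Proof. by apply: (addrI (gd u)); rewrite -gdD !subrr gd0. Qed.

Lemma gdZ a u : gd (a *: u) = gwedge a u + a *: gd u.
Proof.
rewrite /gd /gwedge scaler_sumr -big_split; apply: eq_bigr => i _.
by rewrite (amapZ (der i)) raddfD /= !linearZ.
Qed.

Lemma gwedge0 a u : (forall i, D i a = 0) -> gwedge a u = 0.
Proof. by move=> a0; rewrite /gwedge big1 // => i _; rewrite a0 scale0r. Qed.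

Lemma gwedge_lin a b u v : gwedge a (b *: u + v) = b *: gwedge a u + gwedge a v.
Proof.
rewrite /gwedge scaler_sumr -big_split; apply: eq_bigr => i _ /=.
by rewrite linearP scalerDr !scalerA mulrC.
Qed.

(** Symmetry of second derivatives against antisymmetry of the wedge makes the form its own
    opposite, so 2 has to be invertible. *)
Lemma gd_gd u : gd (gd u) = 0.
Proof.
have e : gd (gd u) = \sum_i \sum_j
    awedge i (awedge j (amap (D i) (amap (D j) u))).
  apply: eq_bigr => i _; rewrite (amap_sum (der i)) linear_sum.
  by apply: eq_bigr => j _; rewrite (amap_awedge (der i)).
have e' : gd (gd u) = - gd (gd u).
  rewrite {1}e exchange_big e -sumrN; apply: eq_bigr => i _; rewrite -sumrN.
  apply: eq_bigr => j _; rewrite awedge_anti.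
  by rewrite (amap_comm _ (D_comm _ _)).
have : (2%:R : F) *: gd (gd u) = 0.
  by rewrite -[2%:R]/(1 + 1) scalerDl !scale1r {2}e' subrr.
by move/eqP; rewrite scaler_eq0 (negPf F2) => /eqP.
Qed.

Lemma gwedge_gwedge a u : gwedge a (gwedge a u) = 0.
Proof.
have e : gwedge a (gwedge a u) = \sum_i \sum_j
    (D i a * D j a) *: awedge i (awedge j u).
  apply: eq_bigr => i _; rewrite linear_sum scaler_sumr.
  by apply: eq_bigr => j _; rewrite linearZ scalerA.
have e' : gwedge a (gwedge a u) = - gwedge a (gwedge a u).
  rewrite {1}e exchange_big e -sumrN; apply: eq_bigr => i _; rewrite -sumrN.
  by apply: eq_bigr => j _; rewrite awedge_anti scalerN mulrC.
have : (2%:R : F) *: gwedge a (gwedge a u) = 0.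
  by rewrite -[2%:R]/(1 + 1) scalerDl !scale1r {2}e' subrr.
by move/eqP; rewrite scaler_eq0 (negPf F2) => /eqP.
Qed.

(** Read off from [gd_gd] applied to [a *: u]. *)
Lemma gd_gwedge a u : gd (gwedge a u) = - gwedge a (gd u).
Proof.
have := gd_gd (a *: u); rewrite gdZ gdD gdZ gd_gd scaler0 addr0 => /eqP.
by rewrite addr_eq0 => /eqP.
Qed.

(** Cartan's formula: contraction and wedge anticommute up to a Kronecker symbol, so the mixed terms
    collapse to the derivative of the coefficients, and each factor [dx_i] contributes 1. *)
Lemma glieE u : glie u = [ffun I : {set 'I_n} => gE (u I) + #|I|%:R * u I].
Proof.
have -> : glie u = \sum_i X i *: amap (D i) u + \sum_i awedge i (acontract i u).
  rewrite /glie /gd /giota.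
  have -> : \sum_i awedge i (amap (D i) (\sum_j X j *: acontract j u)) =
     \sum_i awedge i (acontract i u) +
     \sum_i \sum_j X j *: awedge i (acontract j (amap (D i) u)).
    rewrite -big_split; apply: eq_bigr => i _ /=.
    rewrite (amap_sum (der i)) linear_sum.
    rewrite (eq_bigr (fun j => (i == j)%:R *: awedge i (acontract j u) +
       X j *: awedge i (acontract j (amap (D i) u)))) => [|j _].
      rewrite big_split /=; congr (_ + _); rewrite (bigD1 i) //= eqxx scale1r big1 ?addr0 //.
      by move=> j /negPf; rewrite eq_sym => ->; rewrite scale0r.
    rewrite (amapZ (der i)) DX (amap_acontract (der i)) linearD /=.
    by rewrite !awedgeZ.
  set S := \sum_i \sum_j X j *: awedge i _.
  rewrite -addrA; set T := _ + \sum_i X i *: _.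
  suff -> : T = \sum_i X i *: amap (D i) u by rewrite addrC.
  rewrite /T /S exchange_big -big_split /=; apply: eq_bigr => j _ /=.
  rewrite linear_sum scaler_sumr -big_split /=.
  rewrite (eq_bigr (fun i => X j *: ((i == j)%:R *: amap (D i) u))) => [|i _].
    rewrite (bigD1 j) //= eqxx scale1r big1 ?addr0 // => i /negPf->.
    by rewrite scale0r scaler0.
  by rewrite -scalerDr addrC acontract_awedge.
apply/ffunP => I; rewrite [in LHS]ffunE sum_awedge_acontract [in RHS]ffunE; congr (_ + _).
rewrite sum_ffunE; apply: eq_bigr => i _.
by rewrite !ffunE.
Qed.

Lemma gE_derivation : derivation gE.
Proof.
split=> a b; rewrite /gE.
  by rewrite -big_split; apply: eq_bigr => i _; rewrite (derivD (der i)) mulrDr.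
rewrite mulr_suml mulr_sumr -big_split; apply: eq_bigr => i _ /=.
by rewrite (derivM (der i)); ring.
Qed.

Lemma glieZ a u : glie (a *: u) = gE a *: u + a *: glie u.
Proof.
apply/ffunP => I; rewrite !glieE !ffunE (derivM gE_derivation).
by rewrite [_ *: (_ + _)]mulrDr -[_ *: _]/(_ * _) [a * (_ * _)]mulrCA -addrA.
Qed.

Lemma glieD u v : glie (u + v) = glie u + glie v.
Proof.
by apply/ffunP => I; rewrite !glieE !ffunE (derivD gE_derivation) mulrDr addrACA.
Qed.

Lemma giota0 : giota 0 = 0.
Proof. by rewrite /giota big1 // => i _; rewrite linear0 scaler0. Qed.

Lemma glie_gd u : glie (gd u) = gd (glie u).
Proof. by rewrite /glie gd_gd giota0 addr0 gdD gd_gd add0r. Qed.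

Lemma amap_gd (Dt : F -> F) u : derivation Dt ->
  (forall i a, D i (Dt a) = Dt (D i a)) -> amap Dt (gd u) = gd (amap Dt u).
Proof.
move=> dert comm; rewrite /gd (amap_sum dert); apply: eq_bigr => i _.
by rewrite (amap_awedge dert) (@amap_comm _ _ (D i) Dt).
Qed.

End ExteriorCalculus.

(** * The Gauss-Manin system *)

Section GaussManinCalculus.
Context {C : fieldType} {P : comNzRingType} {F : fieldType} {n : nat}.
Local Notation form := (@aform F n).
Hypothesis F2 : 2%:R != 0 :> F.
Variables (k : {rmorphism C -> F}) (xf : {rmorphism P -> F}) (kP : C -> P).
Variables (tau : F) (pd : 'I_n -> P -> P) (D : 'I_n -> F -> F) (Dt : F -> F).
Variable x : 'I_n -> P.
Hypothesis kE : forall a, k a = xf (kP a).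
Hypothesis der : forall i, derivation (D i).
Hypothesis dert : derivation Dt.
Hypothesis D_comm : forall i j a, D i (D j a) = D j (D i a).
Hypothesis D_Dt : forall i a, D i (Dt a) = Dt (D i a).
Hypothesis D_xf : forall i p, D i (xf p) = xf (pd i p).
Hypothesis D_k : forall i c, D i (k c) = 0.
Hypothesis D_tau : forall i, D i tau = 0.
Hypothesis Dt_xf : forall p, Dt (xf p) = 0.
Hypothesis Dt_tau : Dt tau = 1.
Hypothesis tau0 : tau != 0.
Hypothesis D_x : forall i j, D i (xf (x j)) = (i == j)%:R.
Variables h f : P.
Hypothesis h0 : xf h != 0.
Implicit Types (u v w : form) (a b : F) (I : {set 'I_n}) (p q : P) (m : int).

Local Notation X := (fun i => xf (x i)).
Local Notation d := (gd D).
Local Notation lie := (glie D X).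
Local Notation EF := (gE D X).

Hypothesis E_h : EF (xf h) = n%:R * xf h.
Hypothesis E_f : EF (xf f) = xf f.

Definition pwedge p u : form := \sum_i xf (pd i p) *: awedge i u.

Lemma pwedgeE p u : pwedge p u = gwedge D (xf p) u.
Proof. by apply: eq_bigr => i _; rewrite D_xf. Qed.

Lemma pwedge_lin p b u v : pwedge p (b *: u + v) = b *: pwedge p u + pwedge p v.
Proof. by rewrite !pwedgeE gwedge_lin. Qed.

Lemma pwedge0 p : pwedge p 0 = 0.
Proof. by rewrite /pwedge big1 // => i _; rewrite linear0 scaler0. Qed.

Lemma pwedgeZ p b u : pwedge p (b *: u) = b *: pwedge p u.
Proof. by have := pwedge_lin p b u 0; rewrite pwedge0 !addr0. Qed.

Lemma pwedgeD p u v : pwedge p (u + v) = pwedge p u + pwedge p v.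
Proof. by have := pwedge_lin p 1 u v; rewrite !scale1r. Qed.

Lemma d_xfZ p u : d (xf p *: u) = pwedge p u + xf p *: d u.
Proof. by rewrite (gdZ der) pwedgeE. Qed.

Lemma d_constZ a u : (forall i, D i a = 0) -> d (a *: u) = a *: d u.
Proof. by move=> a0; rewrite (gdZ der) gwedge0 // add0r. Qed.

Lemma d_pwedge p u : d (pwedge p u) = - pwedge p (d u).
Proof. by rewrite !pwedgeE (gd_gwedge F2 der D_comm). Qed.

Lemma dd u : d (d u) = 0. Proof. exact: (gd_gd F2 der D_comm). Qed.

Definition adegree m u : Prop := forall I, u I != 0 -> #|I|%:Z = m.
Definition aregular u : Prop := forall I, exists p, u I = xf p.

Lemma adegree_lin m a u v : adegree m u -> adegree m v -> adegree m (a *: u + v).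
Proof.
move=> du dv I; rewrite !ffunE; have [->|/du//] := eqVneq (u I) 0.
by rewrite scaler0 add0r => /dv.
Qed.

Lemma adegree0 m : adegree m 0.
Proof. by move=> I; rewrite ffunE eqxx. Qed.

Lemma adegreeZ m a u : adegree m u -> adegree m (a *: u).
Proof. by move=> du; rewrite -[_ *: _]addr0; apply: adegree_lin => //; apply: adegree0. Qed.

Lemma adegree_sum m (J : Type) (r : seq J) (Q : pred J) (G : J -> form) :
  (forall i, adegree m (G i)) -> adegree m (\sum_(i <- r | Q i) G i).
Proof.
move=> dG; elim/big_ind: _ => // [|u v du dv]; first exact: adegree0.
by rewrite -[u]scale1r; apply: adegree_lin.
Qed.

Lemma adegree_awedge m i u : adegree m u -> adegree (m + 1) (awedge i u).
Proof.
move=> du I; rewrite ffunE; case: ifP => [iI|]; last by rewrite eqxx.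
rewrite mulf_eq0 negb_or => /andP[_ /du <-].
by rewrite (cardsD1 i I) iI addnC PoszD.
Qed.

Lemma adegree_amap m g u : g 0 = 0 -> adegree m u -> adegree m (amap g u).
Proof.
move=> g0 du I; rewrite ffunE => ne; apply: du.
by apply: contraNneq ne => ->; rewrite g0.
Qed.

Lemma adegree_d m u : adegree m u -> adegree (m + 1) (d u).
Proof.
move=> du; apply: adegree_sum => i; apply: adegree_awedge.
by apply: adegree_amap => //; apply: (deriv0 (der i)).
Qed.

Lemma adegree_pwedge m p u : adegree m u -> adegree (m + 1) (pwedge p u).
Proof. by move=> du; apply: adegree_sum => i; apply/adegreeZ/adegree_awedge. Qed.

Lemma adegree_lie m u : adegree m u -> adegree m (lie u).
Proof.
move=> du I; rewrite (glieE der D_x) ffunE => ne; apply: du.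
by apply: contraNneq ne => ->; rewrite (deriv0 (gE_derivation _ der)) mulr0 addr0.
Qed.

Lemma aregular0 : aregular 0.
Proof. by move=> I; exists 0; rewrite ffunE rmorph0. Qed.

Lemma aregular_lin q u v : aregular u -> aregular v -> aregular (xf q *: u + v).
Proof.
move=> ru rv I; have [pu eu] := ru I; have [pv ev] := rv I.
by exists (q * pu + pv); rewrite !ffunE eu ev rmorphD rmorphM.
Qed.

Lemma aregularD u v : aregular u -> aregular v -> aregular (u + v).
Proof. by move=> ru rv; have := aregular_lin 1 ru rv; rewrite rmorph1 scale1r. Qed.

Lemma aregularZ q u : aregular u -> aregular (xf q *: u).
Proof. by move=> ru; have := aregular_lin q ru aregular0; rewrite addr0. Qed.

Lemma aregularN u : aregular u -> aregular (- u).
Proof. by move/(aregularZ (-1)); rewrite rmorphN1 scaleN1r. Qed.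

Lemma aregularB u v : aregular u -> aregular v -> aregular (u - v).
Proof. by move=> ru rv; apply/aregularD/aregularN. Qed.

Lemma aregular_sum (J : Type) (r : seq J) (Q : pred J) (G : J -> form) :
  (forall i, aregular (G i)) -> aregular (\sum_(i <- r | Q i) G i).
Proof.
move=> rG; elim/big_ind: _ => //; [exact: aregular0 | exact: aregularD].
Qed.

Lemma asignE i I : exists q, asign i I = xf q.
Proof.
by exists ((-1) ^+ #|[pred j in I | (j < i)%N]|); rewrite rmorphXn rmorphN1.
Qed.

Lemma aregular_awedge i u : aregular u -> aregular (awedge i u).
Proof.
move=> ru I; rewrite ffunE; case: ifP => _; last by exists 0; rewrite rmorph0.
have [q ->] := asignE i I; have [p ->] := ru (I :\ i)%SET.
by exists (q * p); rewrite rmorphM.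
Qed.

Lemma aregular_acontract i u : aregular u -> aregular (acontract i u).
Proof.
move=> ru I; rewrite ffunE; case: ifP => _; first by exists 0; rewrite rmorph0.
have [q ->] := asignE i I; have [p ->] := ru (i |: I)%SET.
by exists (q * p); rewrite rmorphM.
Qed.

Lemma aregular_d u : aregular u -> aregular (d u).
Proof.
move=> ru; apply: aregular_sum => i; apply: aregular_awedge => I.
by have [p e] := ru I; exists (pd i p); rewrite ffunE e D_xf.
Qed.

Lemma aregular_pwedge p u : aregular u -> aregular (pwedge p u).
Proof. by move=> ru; apply: aregular_sum => i; apply/aregularZ/aregular_awedge. Qed.

Lemma aregular_iota u : aregular u -> aregular (giota X u).
Proof. by move=> ru; apply: aregular_sum => i; apply/aregularZ/aregular_acontract. Qed.

Lemma aregular_lie u : aregular u -> aregular (lie u).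
Proof.
by move=> ru; apply: aregularD; [apply/aregular_d/aregular_iota|apply/aregular_iota/aregular_d].
Qed.

Definition alog m : set form := [set u |
  [/\ adegree m u, aregular (xf h *: u) & aregular (xf h *: d u)]].

Lemma alogZ m p u : alog m u -> alog m (xf p *: u).
Proof.
move=> [du ru rdu]; split; first exact: adegreeZ.
  by rewrite scalerA mulrC -scalerA; apply: aregularZ.
rewrite d_xfZ scalerDr -pwedgeZ scalerA mulrC -scalerA.
by apply: aregularD; [apply: aregular_pwedge|apply: aregularZ].
Qed.

Lemma alog_dh m u : alog m u -> aregular (pwedge h u).
Proof.
move=> [du ru rdu]; have -> : pwedge h u = d (xf h *: u) - xf h *: d u.
  by rewrite d_xfZ addrK.
by apply: aregularB => //; apply: aregular_d.
Qed.

Lemma alog_d m u : alog m u -> alog (m + 1) (d u).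
Proof.
move=> [du ru rdu]; split=> //; first exact: adegree_d.
by rewrite dd scaler0; apply: aregular0.
Qed.

Lemma alog_pwedge m p u : alog m u -> alog (m + 1) (pwedge p u).
Proof.
move=> [du ru rdu]; split; first exact: adegree_pwedge.
  by rewrite -pwedgeZ; apply: aregular_pwedge.
by rewrite d_pwedge scalerN -pwedgeZ; apply/aregularN/aregular_pwedge.
Qed.

(** Differentiating [h^-1] gives a multiple of [dh], which is killed by the [dh] already present. *)
Lemma alog_dlogh m u : alog m u -> alog (m + 1) ((xf h)^-1 *: pwedge h u).
Proof.
move=> lu; have [du ru rdu] := lu; split; first exact/adegreeZ/adegree_pwedge.
  by rewrite scalerA mulfV // scale1r; apply: alog_dh lu.
rewrite (gdZ der) -[pwedge h u]scale1r.
have -> : gwedge D (xf h)^-1 (1 *: pwedge h u) = 0.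
  rewrite scale1r pwedgeE.
  have -> v : gwedge D (xf h)^-1 v = (- (xf h) ^- 2) *: gwedge D (xf h) v.
    rewrite /gwedge scaler_sumr; apply: eq_bigr => i _.
    by rewrite (derivV (der i)) scalerA mulNr [_ / _]mulrC mulNr.
  by rewrite (gwedge_gwedge F2) scaler0.
rewrite add0r scale1r scalerA mulfV // scale1r d_pwedge.
exact/aregularN/alog_dh/alog_d/lu.
Qed.

Lemma alog_lie m u : alog m u -> alog m (lie u).
Proof.
have lie_h v : xf h *: lie v = lie (xf h *: v) - n%:R *: (xf h *: v).
  by rewrite (glieZ der D_x) E_h scalerA addrAC subrr add0r.
have nE : n%:R = xf n%:R :> F by rewrite rmorph_nat.
move=> [du ru rdu]; split; first exact: adegree_lie.
  by rewrite lie_h nE; apply: aregularB; [apply: aregular_lie|apply: aregularZ].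
rewrite -(glie_gd F2 _ der D_comm) lie_h nE.
by apply: aregularB; [apply: aregular_lie|apply: aregularZ].
Qed.

(** The coefficients are quotients by [h] of polynomials in the [x_i] only. *)
Lemma alog_amap m u : alog m u -> amap Dt u = 0.
Proof.
move=> [_ ru _]; apply/ffunP => I; rewrite !ffunE.
have [p] := ru I; rewrite ffunE => e.
have -> : u I = xf p / xf h by rewrite -e mulrAC divff // mul1r.
by rewrite (derivM dert) (derivV dert) !Dt_xf oppr0 !mul0r mulr0 addr0.
Qed.

Definition tspan (E : set int) (Q : set form) : set form :=
  [set u | exists N (e : 'I_N -> int) (w : 'I_N -> form),
     (forall j, E (e j) /\ Q (w j)) /\ u = \sum_j tau ^ e j *: w j].

Lemma tspanX E (Q : set form) e w : E e -> Q w -> tspan E Q (tau ^ e *: w).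
Proof.
move=> Ee Qw; exists 1%N, (fun=> e), (fun=> w); split=> //.
by rewrite big_ord1.
Qed.

Lemma tspan0 E (Q : set form) : tspan E Q 0.
Proof. by exists 0%N, (fun=> 0), (fun=> 0); split=> [[]//|]; rewrite big_ord0. Qed.

Lemma tspanD E (Q : set form) u v : tspan E Q u -> tspan E Q v -> tspan E Q (u + v).
Proof.
move=> [N1 [e1 [w1 [H1 ->]]]] [N2 [e2 [w2 [H2 ->]]]].
exists (N1 + N2)%N, (fun j => match split j with inl j => e1 j | inr j => e2 j end),
  (fun j => match split j with inl j => w1 j | inr j => w2 j end).
split=> [j|]; first by case: split.
rewrite big_split_ord; congr (_ + _); apply: eq_bigr => j _.
  by rewrite -[lshift _ _]/(unsplit (inl j)) unsplitK.
by rewrite -[rshift _ _]/(unsplit (inr j)) unsplitK.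
Qed.

Lemma tspan_ind E (Q S : set form) : S 0 -> (forall u v, S u -> S v -> S (u + v)) ->
  (forall e w, E e -> Q w -> S (tau ^ e *: w)) -> tspan E Q `<=` S.
Proof.
move=> S0 SD SX _ [N [e [w [H ->]]]]; elim/big_ind: _ => // j _.
by apply: SX; case: (H j).
Qed.

Lemma tspan_additive E E' (Q Q' : set form) (g : form -> form) :
    (forall u v, g (u + v) = g u + g v) ->
    (forall e w, E e -> Q w -> tspan E' Q' (g (tau ^ e *: w))) ->
  forall u, tspan E Q u -> tspan E' Q' (g u).
Proof.
move=> gD gX; apply: (tspan_ind (S := [set u | tspan E' Q' (g u)])) => //.
  rewrite /= (_ : g 0 = 0); first exact: tspan0.
  by apply: (addrI (g 0)); rewrite -gD !addr0.
by move=> u v Su Sv /=; rewrite gD; apply: tspanD.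
Qed.

Definition logtau m : set form := tspan setT (alog m).

Lemma logtauD m u v : logtau m u -> logtau m v -> logtau m (u + v).
Proof. exact: tspanD. Qed.

Lemma logtau0 m : logtau m 0. Proof. exact: tspan0. Qed.

Lemma logtau_tau m e u : logtau m u -> logtau m (tau ^ e *: u).
Proof.
apply: (tspan_additive (g := fun u => tau ^ e *: u)) => [v w|e' w _ lw]; first exact: scalerDr.
by rewrite scalerA -expfzDr //; apply: tspanX.
Qed.

Lemma logtau_xf m p u : logtau m u -> logtau m (xf p *: u).
Proof.
apply: (tspan_additive (g := fun u => xf p *: u)) => [v w|e w _ lw]; first exact: scalerDr.
by rewrite scalerA mulrC -scalerA; apply: tspanX => //; apply: alogZ.
Qed.

Lemma logtauN m u : logtau m u -> logtau m (- u).
Proof. by move/(logtau_xf (-1)); rewrite rmorphN1 scaleN1r. Qed.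

Lemma logtauB m u v : logtau m u -> logtau m v -> logtau m (u - v).
Proof. by move=> lu lv; apply/logtauD/logtauN. Qed.

Lemma D_tauz i e : D i (tau ^ e) = 0.
Proof. by rewrite (derivXz (der i)) // D_tau mulr0. Qed.

Lemma logtau_Dt m u : logtau m u -> logtau m (amap Dt u).
Proof.
apply: (tspan_additive (g := amap Dt)) => [v w|e w _ lw]; first exact: (amapD dert).
rewrite (amapZ dert) (alog_amap lw) scaler0 addr0.
rewrite (derivXz dert) // Dt_tau mulr1 -[e%:~R](rmorph_int xf) -scalerA.
by apply: logtau_xf; apply: tspanX.
Qed.

Lemma logtau_d m u : logtau m u -> logtau (m + 1) (d u).
Proof.
apply: (tspan_additive (g := d)) => [v w|e w _ lw]; first exact: (gdD der).
rewrite d_constZ => [|i]; last exact: D_tauz.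
by apply: tspanX => //; apply: alog_d.
Qed.

Lemma logtau_pwedge m p u : logtau m u -> logtau (m + 1) (pwedge p u).
Proof.
apply: (tspan_additive (g := pwedge p)) => [v w|e w _ lw]; first exact: pwedgeD.
by rewrite pwedgeZ; apply: tspanX => //; apply: alog_pwedge.
Qed.

Lemma logtau_dlogh m u : logtau m u -> logtau (m + 1) ((xf h)^-1 *: pwedge h u).
Proof.
apply: (tspan_additive (g := fun u => (xf h)^-1 *: pwedge h u)) => [v w|e w _ lw].
  by rewrite pwedgeD scalerDr.
rewrite pwedgeZ scalerA mulrC -scalerA.
by apply: tspanX => //; apply: alog_dlogh.
Qed.

Lemma EF_tau : EF tau = 0.
Proof. by rewrite /gE big1 // => i _; rewrite D_tau mulr0. Qed.

Lemma EF_k c : EF (k c) = 0.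
Proof. by rewrite /gE big1 // => i _; rewrite D_k mulr0. Qed.

Lemma logtau_lie m u : logtau m u -> logtau m (lie u).
Proof.
apply: (tspan_additive (g := lie)) => [v w|e w _ lw]; first exact: (glieD der D_x).
rewrite (glieZ der D_x).
rewrite (derivXz (gE_derivation _ der)) // EF_tau mulr0 scale0r add0r.
by apply: tspanX => //; apply: alog_lie.
Qed.

Definition aGnum : set form := logtau (n%:Z - 1).

Definition aGrel : set form := [set u | exists v w,
  [/\ logtau (n%:Z - 2) v, logtau (n%:Z - 2) w
    & u = d v - tau *: pwedge f v + (xf h)^-1 *: pwedge h w]].

Definition aGneg : set form := tspan [set e | e <= 0] (alog (n%:Z - 1)).

Definition anabla u : form := amap Dt u - xf f *: u.

(* The relations are homogeneous when [x_i], [dx_i] have weight 1 and [tau] has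
   weight -1; [Euler] is the derivation attached to this grading, and
   [n t nabla_t = Euler + tau nabla_tau]. *)
Definition Euler u : form := lie u - tau *: amap Dt u.

Definition Eweight a : F := EF a - tau * Dt a.

Lemma aGrelD u v : aGrel u -> aGrel v -> aGrel (u + v).
Proof.
move=> [u1 [u2 [l1 l2 ->]]] [v1 [v2 [m1 m2 ->]]].
exists (u1 + v1), (u2 + v2); split; [exact: logtauD|exact: logtauD|].
by rewrite (gdD der) !pwedgeD; form_ring.
Qed.

Lemma aGrel0 : aGrel 0.
Proof.
exists 0, 0; split; [exact: logtau0|exact: logtau0|].
by rewrite (gd0 der) !pwedge0 !scaler0 subr0 addr0.
Qed.

Lemma aGrel_const a u : (forall i, D i a = 0) ->
  (forall m v, logtau m v -> logtau m (a *: v)) -> aGrel u -> aGrel (a *: u).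
Proof.
move=> a0 la [v [w [lv lw ->]]]; exists (a *: v), (a *: w).
split; [exact: la|exact: la|].
by rewrite d_constZ // !pwedgeZ; form_ring.
Qed.

Lemma aGrel_k c u : aGrel u -> aGrel (k c *: u).
Proof.
by apply: aGrel_const => [i|m v lv]; rewrite ?D_k // kE; apply: logtau_xf.
Qed.

Lemma aGrel_tau e u : aGrel u -> aGrel (tau ^ e *: u).
Proof. by apply: aGrel_const => [i|m v lv]; [apply: D_tauz|apply: logtau_tau]. Qed.

Lemma aGrel_h u : aGrel u -> aGrel (xf h *: u).
Proof.
move=> [v [w [lv lw ->]]]; exists (xf h *: v), (xf h *: w - xf h *: v).
(* Moving [h] inside [d v] costs [dh /\ v], which is [h^-1 dh /\ (h v)] and is absorbed into the
   second witness. *)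
split; [exact: logtau_xf|by apply: logtauB; apply: logtau_xf|].
rewrite d_xfZ pwedgeD -[- (xf h *: v)]scaleN1r !pwedgeZ; apply/ffunP => I.
by rewrite !aformE; field.
Qed.

Lemma anablaD u v : anabla (u + v) = anabla u + anabla v.
Proof. by rewrite /anabla (amapD dert); form_ring. Qed.

Lemma anablaZ a u : anabla (a *: u) = Dt a *: u + a *: anabla u.
Proof. by rewrite /anabla (amapZ dert); form_ring. Qed.

(** [d/dtau - f] commutes with [d - tau df]: the derivative of [tau] and that of [f] each produce
    [df /\ v], with opposite signs. So it can be applied to the witnesses. *)
Lemma aGrel_nabla u : aGrel u -> aGrel (anabla u).
Proof.
move=> [v [w [lv lw ->]]].
exists (amap Dt v - xf f *: v), (amap Dt w - xf f *: w).
split; [by apply: logtauB; [apply: logtau_Dt|apply: logtau_xf]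
       |by apply: logtauB; [apply: logtau_Dt|apply: logtau_xf]|].
have amapN z : amap Dt (- z) = - amap Dt z.
  by apply/ffunP => I; rewrite !ffunE (derivN dert).
have amap_pwedge p z : amap Dt (pwedge p z) = pwedge p (amap Dt z).
  rewrite /pwedge (amap_sum dert); apply: eq_bigr => i _.
  by rewrite (amapZ dert) Dt_xf scale0r add0r (amap_awedge dert).
rewrite /anabla !(amapD dert) amapN !(amapZ dert) Dt_tau (derivV dert) Dt_xf.
rewrite !amap_pwedge (amap_gd _ dert) // -![- (xf f *: _)]scaleN1r.
rewrite !pwedgeD (gdD der) !pwedgeZ d_constZ => [|i]; last by rewrite (derivN (der i)) (deriv1 (der i)) oppr0.
by rewrite d_xfZ; form_ring.
Qed.

Lemma aGrel_Gnum : aGrel `<=` aGnum.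
Proof.
have -> : aGnum = logtau (n%:Z - 2 + 1) by rewrite /aGnum; congr logtau; lia.
move=> _ [v [w [lv lw ->]]]; apply: logtauD; last exact: logtau_dlogh.
apply: logtauB; first exact: logtau_d.
by rewrite -[X in X *: _]expr1z; apply/logtau_tau/logtau_pwedge.
Qed.

Lemma Eweight_derivation : derivation Eweight.
Proof.
have dE := gE_derivation X der.
split=> a b; rewrite /Eweight.
  by rewrite (derivD dE) (derivD dert); ring.
by rewrite (derivM dE) (derivM dert); ring.
Qed.

Lemma EulerZ a u : Euler (a *: u) = Eweight a *: u + a *: Euler u.
Proof. by rewrite /Euler /Eweight (glieZ der D_x) (amapZ dert); form_ring. Qed.

Lemma EulerD u v : Euler (u + v) = Euler u + Euler v.
Proof. by rewrite /Euler (glieD der D_x) (amapD dert); form_ring. Qed.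

Lemma EulerN u : Euler (- u) = - Euler u.
Proof.
rewrite -scaleN1r EulerZ (derivN Eweight_derivation) (deriv1 Eweight_derivation).
by form_ring.
Qed.

Lemma Euler_d u : Euler (d u) = d (Euler u).
Proof.
rewrite /Euler (glie_gd F2 _ der D_comm) (amap_gd _ dert) //.
by rewrite (gdD der) (gdN der) d_constZ.
Qed.

Lemma Eweight_xf p : Eweight (xf p) = EF (xf p).
Proof. by rewrite /Eweight Dt_xf mulr0 subr0. Qed.

Lemma Eweight_tau : Eweight tau = - tau.
Proof. by rewrite /Eweight EF_tau Dt_tau mulr1 sub0r. Qed.

Lemma Eweight_k c : Eweight (k c) = 0.
Proof. by rewrite /Eweight EF_k kE Dt_xf mulr0 subrr. Qed.

Lemma Euler_pwedge p a u : EF (xf p) = a * xf p -> (forall i, D i a = 0) ->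
  Euler (pwedge p u) = a *: pwedge p u + pwedge p (Euler u).
Proof.
move=> Ep a0; have -> : pwedge p u = d (xf p *: u) - xf p *: d u by rewrite d_xfZ addrK.
rewrite EulerD EulerN Euler_d !EulerZ Euler_d Eweight_xf Ep (gdD der) -scalerA.
by rewrite d_constZ // !d_xfZ; form_ring.
Qed.

Lemma D_nat i (m : nat) : D i m%:R = 0.
Proof.
elim: m => [|m IHm]; first exact: (deriv0 (der i)).
by rewrite -natr1 (derivD (der i)) IHm (deriv1 (der i)) addr0.
Qed.

(** The weights of [tau] and [df] cancel, as do those of [h^-1] and [dh], so [Euler] can be applied
    to the witnesses. *)
Lemma aGrel_Euler u : aGrel u -> aGrel (Euler u).
Proof.
move=> [v [w [lv lw ->]]]; exists (Euler v), (Euler w).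
have logE z : logtau (n%:Z - 2) z -> logtau (n%:Z - 2) (Euler z).
  move=> lz; apply: logtauB; first exact: logtau_lie.
  by rewrite -[X in X *: _]expr1z; apply/logtau_tau/logtau_Dt.
split; [exact: logE|exact: logE|].
rewrite !EulerD EulerN Euler_d !EulerZ Eweight_tau (derivV Eweight_derivation) Eweight_xf E_h.
rewrite (@Euler_pwedge h n%:R) => [|//|i]; last exact: D_nat.
rewrite (@Euler_pwedge f 1) => [||i]; rewrite ?mul1r ?(deriv1 (der i)) //.
have -> : - (n%:R * xf h) / xf h ^+ 2 = - n%:R * (xf h)^-1 by field.
move: (d (Euler v)) (pwedge f v) (pwedge f (Euler v)) (pwedge h w) (pwedge h (Euler w)).
by move: (n%:R : F) (xf h)^-1 => r s A B B' H H'; form_ring.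
Qed.

Lemma aGnegD u v : aGneg u -> aGneg v -> aGneg (u + v).
Proof. exact: tspanD. Qed.

Lemma aGneg0 : aGneg 0. Proof. exact: tspan0. Qed.

Lemma aGneg_tau (e : int) u : e <= 0 -> aGneg u -> aGneg (tau ^ e *: u).
Proof.
move=> e0; apply: (tspan_additive (g := fun u => tau ^ e *: u)) => [v w|e' w /= e'0 lw].
  exact: scalerDr.
rewrite scalerA -expfzDr //; apply: tspanX => //=.
by rewrite -[0]addr0; apply: lerD.
Qed.

Lemma aGneg_xf p u : aGneg u -> aGneg (xf p *: u).
Proof.
apply: (tspan_additive (g := fun u => xf p *: u)) => [v w|e w e0 lw]; first exact: scalerDr.
by rewrite scalerA mulrC -scalerA; apply: tspanX => //; apply: alogZ.
Qed.

Lemma aGneg_Gnum : aGneg `<=` aGnum.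
Proof.
apply: tspan_ind; [exact: tspan0|move=> u v; exact: tspanD|].
by move=> e w _ lw; apply: tspanX.
Qed.

Lemma aGnum_neg u : aGnum u -> exists N : nat, aGneg (tau ^ (- N%:Z) *: u).
Proof.
move: u; apply: (tspan_ind (S := [set u | exists N : nat, aGneg (tau ^ (- N%:Z) *: u)])).
- by exists 0%N; rewrite scaler0; apply: tspan0.
- move=> u v [N1 H1] [N2 H2]; exists (N1 + N2)%N; rewrite scalerDr; apply: tspanD.
    rewrite (_ : - (N1 + N2)%:Z = - N2%:Z + - N1%:Z); last by lia.
    by rewrite expfzDr // -scalerA; apply: aGneg_tau => //; lia.
  rewrite (_ : - (N1 + N2)%:Z = - N1%:Z + - N2%:Z); last by lia.
  by rewrite expfzDr // -scalerA; apply: aGneg_tau => //; lia.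
move=> e w _ lw; exists `|e|%N; rewrite scalerA -expfzDr //.
by apply: tspanX => //=; lia.
Qed.

Section Coordinate.
Variable t : F.
Definition anabla_t u : form :=
  (n%:R * t)^-1 *: (lie u - (tau * \sum_i xf (x i * pd i f)) *: u).

Lemma anabla_tE u : anabla_t u = (n%:R * t)^-1 *: (Euler u + tau *: anabla u).
Proof.
rewrite /anabla_t; have -> : \sum_i xf (x i * pd i f) = xf f.
  by rewrite -E_f /gE; apply: eq_bigr => i _; rewrite rmorphM D_xf.
by rewrite /Euler /anabla; congr (_ *: _); form_ring.
Qed.
End Coordinate.

Definition avol : form := [ffun I : {set 'I_n} => if #|I| == n then 1 else 0].
Definition aalpha : form := (xf h)^-1 *: giota X avol.
Definition aomega0 (j : nat) : form := (- xf f) ^+ j *: aalpha.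

(** A coefficient of the contracted volume form is linear in the [x_i] and sits in degree [n - 1],
    which adds up to [n]. For other sizes of [I] the coefficient is 0. *)
Lemma giota_avol I :
  lie (giota X avol) I = (if #|I|.+1 == n then n%:R else 0) * giota X avol I.
Proof.
rewrite (glieE der D_x) ffunE.
have [In|In] := eqVneq; last first.
  suff -> : giota X avol I = 0.
    by rewrite (deriv0 (gE_derivation X der)) !mulr0 addr0.
  rewrite /giota sum_ffunE big1 // => i _; rewrite !ffunE.
  case: (boolP (i \in I)) => iI; first by rewrite scaler0.
  by rewrite cardsU1 iI add1n (negPf In) mulr0 scaler0.
have -> : giota X avol I = \sum_(i | i \notin I) xf (x i) * asign i I.
  rewrite /giota sum_ffunE [RHS]big_mkcond; apply: eq_bigr => i _; rewrite !ffunE /=.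
  case: (boolP (i \in I)) => iI; first by rewrite scaler0.
  by rewrite cardsU1 iI add1n In eqxx mulr1.
have -> : EF (\sum_(i | i \notin I) xf (x i) * asign i I) =
    \sum_(i | i \notin I) xf (x i) * asign i I.
  rewrite (deriv_sum (gE_derivation X der)); apply: eq_bigr => i _.
  have [q qE] := asignE i I.
  rewrite (derivM (gE_derivation X der)).
  have -> : EF (asign i I) = 0.
    rewrite /gE big1 // => j _; rewrite /asign -signr_odd.
    by case: (odd _); rewrite ?expr1 ?expr0 ?(derivN (der j)) (deriv1 (der j)) ?oppr0 mulr0.
  rewrite mulr0 addr0 /gE (bigD1 i) //= D_x eqxx mulr1 big1 ?addr0 // => j /negPf ji.
  by rewrite D_x ji mulr0.
have -> : (n%:R : F) = #|I|%:R + 1 by rewrite natr1 In.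
by rewrite mulrDl mul1r addrC.
Qed.

(** The contracted volume form and [h] both have weight [n], so [alpha] has weight 0, and each
    factor [f] adds 1. *)
Lemma Euler_omega0 (j : nat) : Euler (aomega0 j) = j%:R *: aomega0 j.
Proof.
have EW := Eweight_derivation; have dE := gE_derivation X der.
have lieV : Euler (giota X avol) = n%:R *: giota X avol.
  rewrite /Euler (_ : amap Dt _ = 0) ?scaler0 ?subr0.
    apply/ffunP => I; rewrite giota_avol aformZ; case: eqVneq => // In; rewrite mul0r.
    suff -> : giota X avol I = 0 by rewrite mulr0.
    rewrite /giota sum_ffunE big1 // => i _; rewrite !ffunE.
    case: (boolP (i \in I)) => iI; first by rewrite scaler0.
    by rewrite cardsU1 iI add1n (negPf In) mulr0 scaler0.
  have : aregular (giota X avol).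
    apply: aregular_iota => I; rewrite ffunE; case: ifP => _.
      by exists 1; rewrite rmorph1.
    by exists 0; rewrite rmorph0.
  by move=> r; apply/ffunP => I; have [p] := r I; rewrite !ffunE => ->; rewrite Dt_xf.
rewrite /aomega0 /aalpha !EulerZ lieV (derivV EW) Eweight_xf E_h.
have -> : Eweight ((- xf f) ^+ j) = j%:R * (- xf f) ^+ j.
  elim: j => [|j IHj]; first by rewrite expr0 (deriv1 EW) mul0r.
  rewrite exprS (derivM EW) IHj (derivN EW) Eweight_xf E_f -natr1; ring.
have -> : - (n%:R * xf h) / xf h ^+ 2 = - n%:R * (xf h)^-1 by field.
move: (giota X avol) => W; move: (n%:R : F) (xf h)^-1 (j%:R : F) ((- xf f) ^+ j) => r s z y.
form_ring.
Qed.

End GaussManinCalculus.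

(** * Subalgebras, bases and the Birkhoff problem *)

Section GeneratedAlgebra.
Context {C F : fieldType}.
Variable k : {rmorphism C -> F}.
Implicit Types (s : seq F) (a b : F).

Definition calg s : set F :=
  [set a | exists p : {mpoly C[size s]}, a = mmap k (fun i => nth 0 s i) p].

Record algebra_closed (S : set F) : Prop := AlgebraClosed {
  acC : forall c, S (k c);
  acD : forall a b, S a -> S b -> S (a + b);
  acM : forall a b, S a -> S b -> S (a * b) }.

Lemma ac0 S : algebra_closed S -> S 0.
Proof. by move=> /acC/(_ 0); rewrite rmorph0. Qed.

Lemma ac1 S : algebra_closed S -> S 1.
Proof. by move=> /acC/(_ 1); rewrite rmorph1. Qed.

Lemma acN S a : algebra_closed S -> S a -> S (- a).
Proof.
by move=> Sac Sa; rewrite -mulN1r; apply: (acM Sac) => //; rewrite -(rmorphN1 k); apply: (acC Sac).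
Qed.

Lemma acB S a b : algebra_closed S -> S a -> S b -> S (a - b).
Proof. by move=> Sac Sa Sb; apply: (acD Sac) => //; apply: acN. Qed.

Lemma acX S a m : algebra_closed S -> S a -> S (a ^+ m).
Proof.
move=> Sac Sa; elim: m => [|m IHm]; first by rewrite expr0; apply: ac1.
by rewrite exprS; apply: (acM Sac).
Qed.

Lemma calg_closed s : algebra_closed (calg s).
Proof.
split=> [c|_ _ [p ->] [q ->]|_ _ [p ->] [q ->]].
- by exists c%:MP; rewrite mmapC.
- by exists (p + q); rewrite mmapD.
by exists (p * q); rewrite rmorphM.
Qed.

Lemma calg_gen s a : a \in s -> calg s a.
Proof.
move=> /(nthP 0)[i i_s <-]; exists 'X_(Ordinal i_s).
by rewrite mmapX mmap1U.
Qed.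

Lemma calg_min s S : algebra_closed S -> (forall a, a \in s -> S a) ->
  calg s `<=` S.
Proof.
move=> Sac sS _ [p ->]; move: p; apply: mpoly_alg_ind => [c|i|p q Sp Sq|p q Sp Sq].
- by rewrite mmapC; apply: (acC Sac).
- by rewrite mmapX mmap1U; apply/sS/mem_nth.
- by rewrite mmapD; apply: (acD Sac).
by rewrite rmorphM; apply: (acM Sac).
Qed.

Lemma calg_sub s s' : {subset s <= s'} -> calg s `<=` calg s'.
Proof.
move=> ss'; apply: calg_min => [|a /ss']; [exact: calg_closed|exact: calg_gen].
Qed.

Lemma calg1_poly a b : calg [:: a] b -> exists p : {poly C}, b = ptt k a p.
Proof.
move: b; apply: (calg_min (S := [set b | exists p, b = ptt k a p])).
  split=> [c|_ _ [p ->] [q ->]|_ _ [p ->] [q ->]].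
  - by exists c%:P; rewrite pttC.
  - by exists (p + q); rewrite pttD.
  by exists (p * q); rewrite pttM.
by move=> _ /[!inE] /eqP ->; exists 'X; rewrite /ptt map_polyX hornerX.
Qed.

(** Division by [t - c]: the remainder is obtained by putting [t = c]. *)
Lemma calg_reduce t x (c : C) a : calg [:: t; x] a ->
  exists a0 b, [/\ calg [:: x] a0, calg [:: t; x] b & a = a0 + (t - k c) * b].
Proof.
have ac := calg_closed [:: t; x]; have ac' := calg_closed [:: x].
have sub : calg [:: x] `<=` calg [:: t; x].
  by apply: calg_sub => y; rewrite !inE => ->; rewrite orbT.
have tA : calg [:: t; x] t by apply: calg_gen; rewrite inE eqxx.
have sA : calg [:: t; x] (t - k c) by apply: acB => //; apply: (acC ac).
move: a; apply: (calg_min (S := [set a | exists a0 b,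
  [/\ calg [:: x] a0, calg [:: t; x] b & a = a0 + (t - k c) * b]])).
  split=> [e|_ _ [a0 [b [h1 h2 ->]]] [a0' [b' [h1' h2' ->]]]|_ _ [a0 [b [h1 h2 ->]]] [a0' [b' [h1' h2' ->]]]].
  - by exists (k e), 0; split; [apply: (acC ac')|apply: ac0|rewrite mulr0 addr0].
  - exists (a0 + a0'), (b + b'); split; [exact: (acD ac')|exact: (acD ac)|ring].
  exists (a0 * a0'), (a0 * b' + b * a0' + (t - k c) * (b * b')); split; last by ring.
    exact: (acM ac').
  by apply: (acD ac); [apply: (acD ac)|]; apply: (acM ac) => //;
    [apply: sub|apply: sub|apply: (acM ac)].
move=> a; rewrite !inE => /orP[]/eqP->.
  by exists (k c), 1; split; [apply: (acC ac')|apply: ac1|rewrite mulr1 addrC subrK].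
by exists x, 0; split; [apply: calg_gen; rewrite inE|apply: ac0|rewrite mulr0 addr0].
Qed.

(* The elements of [calg s] whose product with a power of [y] lies in the
   algebra [S] form an algebra. *)
Lemma calg_denom S y s a : algebra_closed S -> S y ->
    (forall b, b \in s -> S b \/ S (y * b)) -> calg s a ->
  exists N : nat, forall m, (N <= m)%N -> S (y ^+ m * a).
Proof.
move=> Sac Sy sS; move: a.
apply: (calg_min (S := [set a | exists N : nat, forall m, (N <= m)%N -> S (y ^+ m * a)])).
  split=> [c|a b [N1 h1] [N2 h2]|a b [N1 h1] [N2 h2]].
  - by exists 0%N => m _; apply: (acM Sac); [apply: acX|apply: (acC Sac)].
  - exists (N1 + N2)%N => m le; rewrite mulrDr; apply: (acD Sac); [apply: h1|apply: h2]; lia.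
  exists (N1 + N2)%N => m le; rewrite -(subnKC (n := m) (m := N1)); last by lia.
  by rewrite exprD mulrACA; apply: (acM Sac); [apply: h1|apply: h2]; lia.
move=> b /sS[Sb|Syb].
  by exists 0%N => m _; apply: (acM Sac) => //; apply: acX.
exists 1%N => -[//|m] _; rewrite exprSr -mulrA; apply: (acM Sac) => //.
exact: acX.
Qed.

Lemma calg_deriv s (D : F -> F) a : derivation D -> (forall c, D (k c) = 0) ->
  (forall b, b \in s -> calg s (D b)) -> calg s a -> calg s (D a).
Proof.
move=> der Dk sD; have ac := calg_closed s => /[dup] Aa.
suff H : calg s `<=` [set a | calg s a /\ calg s (D a)] by case/H.
apply: calg_min => [|b bs]; last by split; [apply: calg_gen|apply: sD].
split=> [c|b b' [h1 h2] [h1' h2']|b b' [h1 h2] [h1' h2']].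
- by split; rewrite ?Dk; [apply: (acC ac)|apply: ac0].
- by split; rewrite ?(derivD der); apply: (acD ac).
split; first exact: (acM ac).
rewrite (derivM der).
by apply: (acD ac); apply: (acM ac).
Qed.

End GeneratedAlgebra.

Ltac in_calg := by apply: calg_gen; rewrite !inE eqxx ?orbT.

(** * Bases of subquotients and elementary changes of basis *)

Section Bases.
Context {F : fieldType} {M : lmodType F} {n : nat}.
Implicit Types (A : set F) (Z N : set M) (w : 'I_n -> M) (a : 'I_n -> F).

Definition asat Z (S : set M) : set M := [set u | exists2 v, S v & Z (u - v)].

Definition aspan A w : set M :=
  [set u | exists a : 'I_n -> F, (forall i, A (a i)) /\ u = \sum_i a i *: w i].

Definition abasis A Z N w : Prop :=
  [/\ forall i, N (w i),
      forall u, N u -> exists2 v, aspan A w v & Z (u - v)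
    & forall a : 'I_n -> F, (forall i, A (a i)) ->
        Z (\sum_i a i *: w i) -> forall i, a i = 0].

Record submodule A (S : set M) : Prop := Submodule {
  smD : forall u v, S u -> S v -> S (u + v);
  smZ : forall b u, A b -> S u -> S (b *: u) }.

Record subring A : Prop := Subring {
  srD : forall b c, A b -> A c -> A (b + c);
  srM : forall b c, A b -> A c -> A (b * c);
  srN1 : A (-1) }.

Lemma sum_coef_update a w l b :
  \sum_j (if j == l then a j + b else a j) *: w j = \sum_j a j *: w j + b *: w l.
Proof.
rewrite [in RHS](bigD1 l) //= [LHS](bigD1 l) //= eqxx scalerDl addrAC; congr (_ + _ + _).
by apply: eq_bigr => j /negPf->.
Qed.

Lemma sum_frame_update a w i v :
  \sum_j a j *: (if j == i then w j + v else w j) = \sum_j a j *: w j + a i *: v.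
Proof.
rewrite [in RHS](bigD1 i) //= [LHS](bigD1 i) //= eqxx scalerDr addrAC; congr (_ + _ + _).
by apply: eq_bigr => j /negPf->.
Qed.

Lemma smN A S u : subring A -> submodule A S -> S u -> S (- u).
Proof. by move=> Ar Sm Su; rewrite -scaleN1r; apply: (smZ Sm) => //; apply: srN1. Qed.

Lemma smB A S u v : subring A -> submodule A S -> S u -> S v -> S (u - v).
Proof. by move=> Ar Sm Su Sv; apply: (smD Sm) => //; apply: (smN Ar Sm). Qed.

Lemma sm_sum A S (I : Type) (r : seq I) (P : pred I) (G : I -> M) :
  S 0 -> submodule A S -> (forall i, P i -> S (G i)) -> S (\sum_(i <- r | P i) G i).
Proof. by move=> S0 Sm SG; elim/big_ind: _ => // u v; apply: (smD Sm). Qed.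

Section OneBasis.
Variables (A : set F) (Z N : set M).
Hypotheses (Ar : subring A) (Zm : submodule A Z) (Nm : submodule A N) (ZN : Z `<=` N).

Lemma abasis_cong w w' : Z 0 -> (forall i, Z (w' i - w i)) ->
  abasis A Z N w -> abasis A Z N w'.
Proof.
move=> Z0 ww' [wN wgen wfree].
have Zsum a : (forall i, A (a i)) -> Z (\sum_i a i *: w' i - \sum_i a i *: w i).
  move=> aA; rewrite -sumrB; apply: sm_sum Z0 Zm _ => i _.
  by rewrite -scalerBr; apply: (smZ Zm).
split.
- by move=> i; rewrite -(subrK (w i) (w' i)); apply: (smD Nm) => //; apply: ZN.
- move=> u /wgen[_ [a [aA ->]] Zu]; exists (\sum_i a i *: w' i); first by exists a.
  have -> : u - \sum_i a i *: w' i =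
     u - \sum_i a i *: w i - (\sum_i a i *: w' i - \sum_i a i *: w i).
    by rewrite opprB addrA subrK.
  by apply: (smB Ar Zm) => //; apply: Zsum.
move=> a aA Za; apply: wfree => //.
have -> : \sum_i a i *: w i = \sum_i a i *: w' i - (\sum_i a i *: w' i - \sum_i a i *: w i).
  by rewrite opprB addrC subrK.
by apply: (smB Ar Zm) => //; apply: Zsum.
Qed.

Lemma abasis_add w (i l : 'I_n) b : i != l -> A b ->
  abasis A Z N w -> abasis A Z N (fun j => if j == i then w j + b *: w l else w j).
Proof.
move=> il Ab [wN wgen wfree]; split.
- move=> j; case: ifP => // _.
  by apply: (smD Nm) => //; apply: (smZ Nm).
- move=> u /wgen[_ [a [aA ->]] Zu].
  pose a' j := if j == l then a j + (- (a i * b)) else a j.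
  exists (\sum_j a' j *: (if j == i then w j + b *: w l else w j)).
    exists a'; split=> // j; rewrite /a'; case: ifP => // _.
    apply: (srD Ar) => //; rewrite -mulN1r; apply: (srM Ar); first exact: srN1.
    exact: (srM Ar).
  rewrite sum_frame_update sum_coef_update /a' (negPf il) scalerA -addrA.
  by rewrite -scalerDl addNr scale0r addr0.
move=> a aA; rewrite sum_frame_update scalerA -sum_coef_update => Za.
have Z' : forall j, (if j == l then a j + a i * b else a j) = 0.
  apply: (wfree (fun j => if j == l then a j + a i * b else a j)) => // j.
  by case: ifP => // _; apply: (srD Ar) => //; apply: (srM Ar).
move=> j; have := Z' j; case: eqVneq => // ->.
by have := Z' i; rewrite (negPf il) => ->; rewrite mul0r addr0.
Qed.

Lemma abasis_scale w s : s != 0 -> A s -> A s^-1 ->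
  abasis A Z N w -> abasis A Z N (fun j => s *: w j).
Proof.
move=> s0 As AsV [wN wgen wfree]; split.
- by move=> j; apply: (smZ Nm).
- move=> u /wgen[_ [a [aA ->]] Zu].
  exists (\sum_j (a j * s^-1) *: (s *: w j)).
    by exists (fun j => a j * s^-1); split=> // j; apply: (srM Ar).
  move: Zu; congr (Z (_ - _)); apply: eq_bigr => j _.
  by rewrite scalerA mulrVK ?unitfE.
move=> a aA Za j; have : a j * s = 0.
  apply: (wfree (fun j => a j * s)) => [i|]; first exact: (srM Ar).
  by move: Za; congr Z; apply: eq_bigr => i _; rewrite scalerA.
by move/eqP; rewrite mulf_eq0 (negPf s0) orbF => /eqP.
Qed.

End OneBasis.

Lemma asat_aspan_submodule A Z w : subring A -> submodule A Z ->
  submodule A (asat Z (aspan A w)).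
Proof.
move=> Ar Zm; split=> [u v [_ [a [aA ->]] Zu] [_ [b [bA ->]] Zv]|b u Ab [_ [a [aA ->]] Zu]].
  exists (\sum_i (a i + b i) *: w i).
    by exists (fun i => a i + b i); split=> // i; apply: (srD Ar).
  have := smD Zm Zu Zv; congr Z; rewrite addrACA -opprD; congr (_ - _).
  by rewrite -big_split; apply: eq_bigr => i _ /=; rewrite scalerDl.
exists (\sum_i (b * a i) *: w i).
  by exists (fun i => b * a i); split=> // i; apply: (srM Ar).
have := smZ Zm Ab Zu; congr Z; rewrite scalerBr scaler_sumr; congr (_ - _).
by apply: eq_bigr => i _; rewrite scalerA.
Qed.

Lemma asat_aspan_Z A Z w : A 0 -> Z `<=` asat Z (aspan A w).
Proof.
move=> A0 u Zu; exists 0; last by rewrite subr0.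
by exists (fun=> 0); split=> //; rewrite big1 // => i _; rewrite scale0r.
Qed.

Lemma asat_aspan_gen A Z w i b : Z 0 -> A 0 -> A b -> asat Z (aspan A w) (b *: w i).
Proof.
move=> Z0 A0 Ab; exists (b *: w i); last by rewrite subrr.
exists (fun j => if j == i then b else 0); split=> [j|]; first by case: ifP.
by rewrite (bigD1 i) //= eqxx big1 ?addr0 // => j /negPf->; rewrite scale0r.
Qed.

End Bases.

Section CalgModules.
Context {C F : fieldType} {M : lmodType F}.
Variable k : {rmorphism C -> F}.
Implicit Types (S : set M) (s : seq F).

Lemma calg_submodule s S : kspace k S ->
  (forall b u, b \in s -> S u -> S (b *: u)) -> submodule (calg k s) S.
Proof.
move=> Ssp sS; split=> [u v|b u Ab]; first by apply: kspaceD Ssp.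
move: b Ab u; apply: (calg_min (S := [set b | forall u, S u -> S (b *: u)])).
  split=> [c u Su|a b Sa Sb u Su|a b Sa Sb u Su].
  - exact: (kspaceZ c Ssp Su).
  - by rewrite scalerDl; apply: (kspaceD Ssp); [apply: Sa|apply: Sb].
  by rewrite -scalerA; apply: Sa; apply: Sb.
by move=> b bs u; apply: sS.
Qed.

Lemma calg_subring s : subring (calg k s).
Proof.
have ac := calg_closed k s; split; [exact: (acD ac)|exact: (acM ac)|].
by rewrite -(rmorphN1 k); apply: (acC ac).
Qed.

Lemma submodule_kspace s S : S 0 -> submodule (calg k s) S -> kspace k S.
Proof.
move=> S0 Sm; split=> // a u v Su Sv; apply: (smD Sm) => //; apply: (smZ Sm) => //.
exact: (acC (calg_closed k s)).
Qed.

End CalgModules.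

(** * The Birkhoff problem in one fibre *)

Section AbstractBirkhoff.
Context {R : realType} {F : fieldType} {M : lmodType F} {n : nat}.
Local Notation C := R[i].
Variables (k : {rmorphism C -> F}) (tau : F) (Z N : set M) (nab : M -> M).
Implicit Types (u v : M) (S : set M).

Definition adsum (S1 S2 S : set M) : Prop :=
  (forall u, S u <-> exists v w, [/\ S1 v, S2 w & Z (u - (v + w))]) /\
  S1 `&` S2 `<=` Z.

Section Index.
Context {K : nzRingType}.
Variables (le : rel K) (emb : K -> C).

Record aKM (V : K -> set M) : Prop := AKM {
  aKM_sub : forall b, [/\ kspace k (V b), Z `<=` V b & V b `<=` N];
  aKM_incr : forall b b', le b b' -> V b `<=` V b';
  aKM_exh : forall u, N u -> exists b, V b u;
  aKM_jumps : exists s : seq K, forall b, exists2 a, a \in s &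
    exists m : int, le (a + m%:~R) b /\ V b = V (a + m%:~R);
  aKM_tau : forall b u, V b u -> V (b - 1) (tau *: u);
  aKM_dtau : forall b u, V b u -> V (b + 1) (nab u);
  aKM_fg : forall b, exists s : seq M, (forall u, u \in s -> V b u) /\
    forall S, kspace k S -> Z `<=` S -> (forall u, u \in s -> S u) ->
      (forall u, S u -> S (tau *: u)) ->
      (forall u, S u -> S (tau *: nab u)) -> V b `<=` S;
  aKM_good : forall b, exists J : nat, forall j : nat, (J <= j)%N ->
    V (b - j%:R - 1) = asat Z (scaled tau (V (b - j%:R)));
  aKM_nilp : forall b, exists J : nat, forall u, V b u ->
    below le V b (iter J (fun u => tau *: nab u + k (emb b) *: u) u) }.

Definition aVplus_cond (Gt : set M) (V : K -> set M) (G' : set M) : Prop :=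
  forall b,
    [/\ adsum (Gt `&` G' `&` V b) (scaled tau^-1 Gt `&` V b) (Gt `&` V b),
        forall u, (Gt `&` G' `&` V b) u -> exists v w,
          [/\ (Gt `&` G' `&` below le V b) v, (Gt `&` G' `&` V (b + 1)) w
            & Z (tau *: nab u + k (emb b) *: u - (v + tau *: w))]
      & (Gt `&` G' `&` below le V b) `&` scaled tau (Gt `&` G' `&` V (b + 1))
          `<=` Z].
End Index.

Definition aCtau_lattice (G' : set M) : Prop :=
  [/\ kspace k G' /\ (forall u, G' u -> G' (tau *: u)),
      Z `<=` G' /\ G' `<=` N,
      exists s : seq M, (forall u, u \in s -> G' u) /\
        forall S, kspace k S -> Z `<=` S -> (forall u, u \in s -> S u) ->
          (forall u, S u -> S (tau *: u)) -> G' `<=` S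
    & forall u, N u -> exists J : nat, G' (tau ^+ J *: u)].

Definition abirkhoff (Gt G' : set M) : Prop :=
  [/\ aCtau_lattice G', forall u, G' u -> G' (tau *: nab u)
    & adsum (Gt `&` G') (scaled tau^-1 Gt) Gt].

Variables (L : set M) (w : 'I_n -> M).
Hypothesis tau0 : tau != 0.
Hypothesis Zsp : kspace k Z.
Hypothesis Nsp : kspace k N.
Hypothesis Lsp : kspace k L.
Hypothesis ZN : Z `<=` N.
Hypothesis LN : L `<=` N.
Hypothesis Ztau : forall u m, Z u -> Z (tau ^ m *: u).
Hypothesis Ntau : forall u m, N u -> N (tau ^ m *: u).
Hypothesis Ltau : forall u (m : int), m <= 0 -> L u -> L (tau ^ m *: u).
Hypothesis N_L : forall u, N u -> exists m : nat, L (tau ^ (- m%:Z) *: u).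
Hypothesis nab_lin : forall a u v,
  nab (k a *: u + v) = k a *: nab u + nab v.
Hypothesis nab_tt : forall m u,
  nab (tau ^ m *: u) = tau ^ m *: nab u + (m%:~R * tau ^ (m - 1)) *: u.
Hypothesis Znab : forall u, Z u -> Z (nab u).
Hypothesis ptt_inj : forall p, ptt k tau p = 0 -> p = 0.
Local Notation Gt := (asat Z L).
Hypothesis w_basis : abasis (calg k [:: tau^-1]) Z Gt w.
Variables (nu kc : 'I_n -> C).
Hypothesis nab_w : forall i,
  Z (nab (w i) - (k (kc i) *: w (ordS i) - (tau^-1 * k (nu i)) *: w i)).
Hypothesis nu_kc : forall i, kc i != 0 -> lexle (nu (ordS i) - 1) (nu i).
Hypothesis n_gt0 : (0 < n)%N.

Local Notation span := (span k tau Z w).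
Let acV := calg_closed k [:: tau^-1].
Let acT := calg_closed k [:: tau].

Lemma invtau_mem : calg k [:: tau^-1] tau^-1.
Proof. in_calg. Qed.

(** Multiplying by a large negative power of [tau] brings the coefficients into C[1/tau], where the
    basis property applies; [tau] being transcendental, the polynomials vanish. *)
Lemma fibre_indep (p : 'I_n -> {poly C}) :
  Z (\sum_i ptt k tau (p i) *: w i) -> forall i, p i = 0.
Proof.
move=> Zp; pose J := (\sum_i size (p i))%N.
have szJ i : (size (p i) <= J)%N by rewrite /J (bigD1 i) //= leq_addr.
have [_ _ free] := w_basis.
have H : forall i, tau ^ (- J%:Z) * ptt k tau (p i) = 0.
  apply: free => [i|]; last first.
    have := Ztau (- J%:Z) Zp; congr Z; rewrite scaler_sumr.
    by apply: eq_bigr => i _; rewrite scalerA.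
  rewrite pttE mulr_sumr; elim/big_ind: _ => [|x y|j _].
  - exact: (ac0 acV).
  - exact: (acD acV).
  rewrite mulrCA; apply: (acM acV); first exact: (acC acV).
  have jJ : (j <= J)%N by apply: leq_trans (szJ i); apply: ltnW.
  rewrite -(subnK jJ) PoszD opprD expfzDr // -mulrA.
  rewrite [tau ^+ j]exprnP -expfzDr // addNr expr0z mulr1.
  by rewrite -exprnN -exprVn; apply: (acX _ acV); apply: invtau_mem.
move=> i; apply: ptt_inj; have /eqP := H i.
by rewrite mulf_eq0 expfz_eq0 (negPf tau0) andbF => /eqP.
Qed.

Lemma Gt_kspace : kspace k Gt.
Proof.
split; first by exists 0; [apply: kspace0 Lsp|rewrite subr0; apply: kspace0 Zsp].
move=> a u v [u' Lu Zu] [v' Lv Zv]; exists (k a *: u' + v').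
  by case: Lsp => _; apply.
have [_ /(_ a _ _ Zu Zv)] := Zsp; congr Z.
by rewrite scalerBr opprD addrACA.
Qed.

Lemma Gt_Z : Z `<=` Gt.
Proof. by move=> u Zu; exists 0; [apply: kspace0 Lsp|rewrite subr0]. Qed.

Lemma Gt_N : Gt `<=` N.
Proof. by move=> u [v /LN Nv /ZN Zuv]; rewrite -(subrK v u); apply: (kspaceD Nsp Zuv Nv). Qed.

Lemma Gt_tau u (m : int) : m <= 0 -> Gt u -> Gt (tau ^ m *: u).
Proof.
move=> m0 [v Lv Zuv]; exists (tau ^ m *: v); first exact: Ltau.
by rewrite -scalerBr; apply: Ztau.
Qed.

Lemma w_Gt i : Gt (w i). Proof. by case: w_basis. Qed.

Lemma GtE : Gt = Gminus k tau Z w.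
Proof.
have [_ gen _] := w_basis; apply/seteqP; split=> [u /gen[v [a [aA ->]] Zuv]|].
  apply: (span_cong Zsp _ Zuv); apply: kspace_sum (span_kspace _ _ Zsp _) _ => i _.
  have [p ->] := calg1_poly (aA i); rewrite pttE scaler_suml.
  apply: kspace_sum (span_kspace _ _ Zsp _) _ => j _; rewrite -scalerA.
  apply: (kspaceZ _ (span_kspace _ _ Zsp _)).
  rewrite exprVn -[_ ^-1]/(tau ^- j) exprnN; apply: spanX.
  by rewrite oppr_le0.
apply: span_min; [exact: Gt_kspace|exact: Gt_Z|move=> i m m0].
by apply: Gt_tau => //; apply: w_Gt.
Qed.

(** Every element of the system enters the Brieskorn lattice after division by a power of [tau]. *)
Lemma NE : N = Gall k tau Z w.
Proof.
apply/seteqP; split=> [u /N_L[m Lu]|].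
  have : Gminus k tau Z w (tau ^ (- m%:Z) *: u).
    by rewrite -GtE; exists (tau ^ (- m%:Z) *: u) => //; rewrite subrr; case: Zsp.
  move/(span_scale Zsp tau0 Ztau m%:Z); rewrite scalerA -expfzDr // subrr scale1r.
  by apply: spanS.
apply: span_min => // i m _; apply/Ntau/Gt_N/w_Gt.
Qed.

Lemma GplusE : asat Z (aspan (calg k [:: tau]) w) = Gplus k tau Z w.
Proof.
apply/seteqP; split=> [u [v [a [aA ->]] Zuv]|].
  apply: (span_cong Zsp _ Zuv); apply: kspace_sum (span_kspace _ _ Zsp _) _ => i _.
  have [p ->] := calg1_poly (aA i); rewrite pttE scaler_suml.
  apply: kspace_sum (span_kspace _ _ Zsp _) _ => j _; rewrite -scalerA.
  apply: (kspaceZ _ (span_kspace _ _ Zsp _)).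
  by rewrite exprnP; apply: spanX.
have Zm : submodule (calg k [:: tau]) Z.
  apply: calg_submodule => // b u; rewrite inE => /eqP-> /(Ztau 1).
  by rewrite expr1z.
have Gm := asat_aspan_submodule w (calg_subring k [:: tau]) Zm.
have GZ := @asat_aspan_Z _ _ _ _ Z w (ac0 acT).
have Z0 := kspace0 Zsp; apply: span_min => //.
  by apply: submodule_kspace Gm; apply: GZ.
move=> i m m0; apply: asat_aspan_gen Z0 (ac0 acT) _.
have -> : m = `|m|%N%:Z by lia.
by rewrite -exprnP; apply: (acX _ acT); in_calg.
Qed.

Local Notation G' := (asat Z (aspan (calg k [:: tau]) w)).
Let spk E : kspace k (span E). Proof. exact: span_kspace. Qed.

Lemma fibre_birkhoff : abirkhoff Gt G'.
Proof.
rewrite GtE GplusE; split.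
- split.
  + split; first exact: (spk _).
    by move=> u /(span_ge_tt tau0 Zsp Ztau n_gt0) H; apply: (spanW Zsp H) => i m; lia.
  + by split; [move=> u; apply: spanZ|rewrite NE; apply: spanS].
  + exists [seq w i | i <- enum 'I_n]; split.
      move=> _ /mapP[i _ ->]; rewrite -[w i]scale1r -(expr0z tau).
      exact: spanX.
    move=> S Ssp ZS wS Stau; apply: span_min => // i m m0.
    have -> : m = `|m|%N%:Z by lia.
    elim: `|m|%N => [|j IHj]; first by rewrite expr0z scale1r; apply/wS/map_f; rewrite mem_enum.
    by rewrite -exprnP exprS -scalerA exprnP; apply: Stau.
  move=> u; rewrite NE => /(span_fin Zsp)[J HJ]; exists J.
  rewrite exprnP; apply: (spanW Zsp (span_scale Zsp tau0 Ztau J%:Z HJ)) => i m [_].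
  by lia.
- exact: (span_ge_theta tau0 Zsp Ztau nab_lin nab_tt Znab nab_w n_gt0).
rewrite (scaled_Gminus tau0 w Zsp Ztau n_gt0); split=> [u|u [[u1 u2] u3]]; last first.
  by apply: (span0 Zsp _ (span_cap Zsp tau0 Ztau fibre_indep u2 u3)) => i m; lia.
split=> [|[v [x [[v1 _] x1 /(@spanZ _ _ _ _ k tau Z w (fun _ m => m <= 0)) uvx]]]].
  move/(span_split Zsp (E1 := fun _ m => m = 0) (E2 := fun _ m => m < 0))=> [].
    by move=> i m m0; case: (ltgtP m 0) m0 => // [mn|mz] _; [right|left].
  move=> v [x [v1 x1 ->]]; exists v, x; split=> //.
  - by split; apply: (spanW Zsp v1) => i m ->.
  by rewrite subrr; case: Zsp.
rewrite -(subrK (v + x) u); apply: (kspaceD (spk _)) => //; apply: (kspaceD (spk _)) => //.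
by apply: (spanW Zsp x1) => i m; lia.
Qed.

Lemma fibre_Vplus (K : nzRingType) (le : rel K) (emb : K -> C) (V : K -> set M) :
  lex_embedding le emb -> aKM le emb V -> aVplus_cond le emb Gt V G'.
Proof.
move=> e [Vsub Vincr Vexh Vjumps Vtau Vdtau Vfg Vgood Vnilp].
pose theta u := tau *: nab u.
have dV : discrete_filtration k Z theta le emb V.
  split=> //.
  - by move=> b; case: (Vsub b).
  - by move=> b; case: (Vsub b).
  - by move=> b u /Vdtau/Vtau; rewrite addrK.
  by move=> b u Vu; have [J JP] := Vnilp b; exists J; apply: JP.
have VG b : V b `<=` Gall k tau Z w by rewrite -NE; case: (Vsub b).
have Gexh u : Gall k tau Z w u -> exists b, V b u by rewrite -NE; apply: Vexh.
have good b : exists J : nat, forall j : nat, (J <= j)%N ->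
    forall u, V (b - j%:R - 1) u -> exists2 v, V (b - j%:R) v & Z (u - tau *: v).
  have [J JP] := Vgood b; exists J => j /JP-> u [_ [v Vv ->] Zuv].
  by exists v.
rewrite GtE GplusE => b; split.
- exact: (Vplus_split tau0 Zsp Ztau fibre_indep nab_lin nab_tt
    Znab nab_w nu_kc n_gt0 e dV VG Gexh Vtau Vfg good).
- move=> u; exact: (Vplus_residue tau0 Zsp Ztau fibre_indep nab_lin nab_tt
    Znab nab_w nu_kc n_gt0 e dV VG Gexh Vtau Vfg good).
exact: (Vplus_direct tau0 Zsp Ztau fibre_indep n_gt0).
Qed.

End AbstractBirkhoff.

(** * Frames of the Gauss-Manin system *)

Section AbstractSystem.
Context {R : realType} {F : fieldType} {n : nat}.
Local Notation C := R[i].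
Local Notation M := (@aform F n).
Variables (k : {rmorphism C -> F}) (tau t : F) (Z N L : set M).
Variables (nab Eu : M -> M) (DT EW : F -> F).
Implicit Types (u v : M) (S : set M) (w : 'I_n -> M) (nu : 'I_n -> C).
Hypothesis tau0 : tau != 0.
Hypothesis t0 : t != 0.
Hypothesis Zsp : kspace k Z.
Hypothesis Nsp : kspace k N.
Hypothesis Lsp : kspace k L.
Hypothesis ZN : Z `<=` N.
Hypothesis LN : L `<=` N.
Hypothesis Ztau : forall u m, Z u -> Z (tau ^ m *: u).
Hypothesis Ntau : forall u m, N u -> N (tau ^ m *: u).
Hypothesis Ltau : forall u (m : int), m <= 0 -> L u -> L (tau ^ m *: u).
Hypothesis N_L : forall u, N u -> exists m : nat, L (tau ^ (- m%:Z) *: u).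
Hypothesis Zt : forall u, Z u -> Z (t *: u).
Hypothesis Nt : forall u, N u -> N (t *: u).
Hypothesis Lt : forall u, L u -> L (t *: u).
Hypothesis nabD : forall u v, nab (u + v) = nab u + nab v.
Hypothesis nabZ : forall a u, nab (a *: u) = DT a *: u + a *: nab u.
Hypothesis DTder : derivation DT.
Hypothesis DTk : forall c, DT (k c) = 0.
Hypothesis DTt : DT t = 0.
Hypothesis DTtau : DT tau = 1.
Hypothesis Znab : forall u, Z u -> Z (nab u).
Hypothesis Nnab : forall u, N u -> N (nab u).
Hypothesis EuD : forall u v, Eu (u + v) = Eu u + Eu v.
Hypothesis EuZ : forall a u, Eu (a *: u) = EW a *: u + a *: Eu u.
Hypothesis EWder : derivation EW.
Hypothesis EWk : forall c, EW (k c) = 0.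
Hypothesis EWt : EW t = n%:R * t.
Hypothesis EWtau : EW tau = - tau.
Hypothesis ZEu : forall u, Z u -> Z (Eu u).
Hypothesis transc : forall (p : {poly C}) c K b, calg k [:: t; tau^-1] b ->
  ptt k tau p = (t - k c) * (tau ^+ K * b) -> p = 0.
Hypothesis n_gt0 : (0 < n)%N.

Let ttau : seq F := [:: t; tau; tau^-1].

Lemma Z_submodule : submodule (calg k ttau) Z.
Proof.
apply: calg_submodule => // b u; rewrite !inE => /or3P[]/eqP-> Zu; first exact: Zt.
  by rewrite -[tau]expr1z; apply: Ztau.
exact: (Ztau (-1)).
Qed.

Lemma N_submodule : submodule (calg k ttau) N.
Proof.
apply: calg_submodule => // b u; rewrite !inE => /or3P[]/eqP-> Nu; first exact: Nt.
  by rewrite -[tau]expr1z; apply: Ntau.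
exact: (Ntau (-1)).
Qed.

Lemma submodule_sub A A' S : A `<=` A' -> submodule A' S -> submodule A S.
Proof. by move=> AA' [SD SZ]; split=> // b u /AA'; apply: SZ. Qed.

Lemma nab_lin a u v : nab (k a *: u + v) = k a *: nab u + nab v.
Proof. by rewrite nabD nabZ DTk scale0r add0r. Qed.

Lemma nab_tt m u :
  nab (tau ^ m *: u) = tau ^ m *: nab u + (m%:~R * tau ^ (m - 1)) *: u.
Proof. by rewrite nabZ (derivXz DTder) // DTtau mulr1 addrC. Qed.

Lemma ptt_inj p : ptt k tau p = 0 -> p = 0.
Proof.
move=> p0; apply: (@transc p 0 0 0); last by rewrite p0 !mulr0.
exact: (ac0 (calg_closed k _)).
Qed.

Section Fibre.
Variable c0 : C.

Definition afib : set M := [set u | exists v g,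
  [/\ Z v, N g & u = v + (t - k c0) *: g]].

Lemma Z_fib : Z `<=` afib.
Proof.
move=> u Zu; exists u, 0; split=> //; first exact: kspace0 Nsp.
by rewrite scaler0 addr0.
Qed.

Lemma fib_cong u : N u -> afib (t *: u - k c0 *: u).
Proof.
move=> Nu; exists 0, u; split=> //; first exact: kspace0 Zsp.
by rewrite add0r scalerBl.
Qed.

Lemma fib_kspace : kspace k afib.
Proof.
split; first exact/Z_fib/(kspace0 Zsp).
move=> a _ _ [v [w [Zv Nw ->]]] [v' [w' [Zv' Nw' ->]]].
exists (k a *: v + v'), (k a *: w + w'); split.
- by case: Zsp => _; apply.
- by case: Nsp => _; apply.
form_ring.
Qed.

Lemma fib_N : afib `<=` N.
Proof.
move=> _ [v [w [Zv Nw ->]]]; apply: (kspaceD Nsp); first exact: ZN.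
rewrite scalerBl; apply: (kspaceB Nsp); [exact: Nt|exact: kspaceZ].
Qed.

Lemma fib_tau u m : afib u -> afib (tau ^ m *: u).
Proof.
move=> [v [w [Zv Nw ->]]]; exists (tau ^ m *: v), (tau ^ m *: w).
by split; [apply: Ztau|apply: Ntau|form_ring].
Qed.

Lemma fib_t u : afib u -> afib (t *: u).
Proof.
move=> [v [w [Zv Nw ->]]]; exists (t *: v), (t *: w).
by split; [apply: Zt|apply: Nt|form_ring].
Qed.

Lemma fib_nab u : afib u -> afib (nab u).
Proof.
move=> [v [w [Zv Nw ->]]]; exists (nab v), (nab w).
split; [exact: Znab|exact: Nnab|].
by rewrite nabD nabZ (derivB DTder) DTt DTk subrr scale0r add0r.
Qed.

Lemma fib_submodule : submodule (calg k ttau) afib.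
Proof.
apply: calg_submodule; first exact: fib_kspace.
move=> b u; rewrite !inE => /or3P[]/eqP->; first exact: fib_t.
  by rewrite -[X in X *: _]expr1z; apply: fib_tau.
exact: (@fib_tau _ (-1)).
Qed.

End Fibre.

Definition aloc S : set M := [set u | exists j : nat, S (t ^+ j *: u)].

(* the column of Omega_0 has a single entry, in row [ordS j] *)
Definition acoef (j : 'I_n) : F := if j.+1 == n then t else 1.

Definition aform_nab w nu : Prop := forall j,
  Z (nab (w j) - (acoef j *: w (ordS j) - (tau^-1 * k (nu j)) *: w j)).

Definition aOmega : 'M[F]_n := \matrix_(i, j)
  ((if (i == j.+1 :> nat) then 1 else 0) +
   (if (i == 0 :> nat) && (j.+1 == n) then t else 0)).

Definition aA nu : 'M[F]_n := diag_mx (\row_i - k (nu i)).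

Definition aframe_mul w (m : 'M[F]_n) : 'I_n -> M := fun j => \sum_i m i j *: w i.

Lemma val_ordS (j : 'I_n) : val (ordS j) = if j.+1 == n then 0%N else j.+1.
Proof.
rewrite /=; case: eqVneq => [->|ne]; first by rewrite modnn.
by rewrite modn_small // ltn_neqAle ne ltn_ord.
Qed.

Lemma aframe_mulD w m1 m2 j : aframe_mul w (m1 + m2) j = aframe_mul w m1 j + aframe_mul w m2 j.
Proof. by rewrite /aframe_mul -big_split; apply: eq_bigr => i _; rewrite mxE scalerDl. Qed.

Lemma aframe_mulZ w a m j : aframe_mul w (a *: m) j = a *: aframe_mul w m j.
Proof. by rewrite /aframe_mul scaler_sumr; apply: eq_bigr => i _; rewrite mxE scalerA. Qed.

Lemma aframe_mul_diag w (d : 'rV[F]_n) j : aframe_mul w (diag_mx d) j = d 0 j *: w j.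
Proof.
rewrite /aframe_mul (bigD1 j) //= mxE eqxx mulr1n big1 ?addr0 // => i /negPf ij.
by rewrite mxE ij mulr0n scale0r.
Qed.

Lemma aframe_mul_Omega w j : aframe_mul w aOmega j = acoef j *: w (ordS j).
Proof.
rewrite /aframe_mul (bigD1 (ordS j)) //= [X in _ + X]big1 ?addr0 => [|i ij]; last first.
  rewrite mxE; have : val i != val (ordS j) by [].
  rewrite val_ordS; case: (eqVneq j.+1 n) => [e|ne] /negPf ij'.
    by rewrite ij' addr0 e; have := ltn_ord i; case: ltngtP => //; rewrite scale0r.
  by rewrite ij' andbF addr0 scale0r.
congr (_ *: _); rewrite mxE /acoef -[nat_of_ord (ordS j)]/(val (ordS j)) val_ordS.
by case: (eqVneq j.+1 n) => [e|ne]; rewrite /= ?add0r // eqxx addr0.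
Qed.

Lemma aform_nabE w nu : aform_nab w nu <-> forall j,
  Z (nab (w j) - aframe_mul w (aOmega + tau^-1 *: aA nu) j).
Proof.
suff e j : aframe_mul w (aOmega + tau^-1 *: aA nu) j =
    acoef j *: w (ordS j) - (tau^-1 * k (nu j)) *: w j.
  by split=> H j; have := H j; rewrite e.
rewrite aframe_mulD aframe_mulZ aframe_mul_diag aframe_mul_Omega mxE.
by rewrite scaleNr scalerN scalerA.
Qed.

Definition astep w (i' i : 'I_n) (c : C) : 'I_n -> M :=
  fun j => if j == i then w i + (tau^-1 * k c) *: w i' else w j.

Definition abase w (a b : 'I_n) (c : C) : 'I_n -> M :=
  fun j => if j == a then t *: w a + (tau^-1 * k c) *: w b else t *: w j.

Lemma ordS_inj : injective (@ordS n).
Proof. by move=> i j ij; rewrite -(ordSK i) ij ordSK. Qed.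

Lemma DT_tauV c : DT (tau^-1 * k c) = - (tau^-1 * (tau^-1 * k c)).
Proof. by rewrite (derivM DTder) (derivV DTder) DTk DTtau mulr0 addr0; field. Qed.

(** With [c = nu i - nu i' - 1] one has [nu i - c = nu i' + 1], so in the derivative of
    [w_i + c tau^-1 w_i'] the terms in [tau^-1 w_i] and [tau^-2 w_i'] combine to
    [-(nu i' + 1) tau^-1] times the new element. Only the columns [i'] and [i] are affected. *)
Lemma aform_nab_step w nu (i' i : 'I_n) : i = i'.+1 :> nat -> aform_nab w nu ->
  aform_nab (astep w i' i (nu i - nu i' - 1)) (swap nu i i').
Proof.
move=> ii H; have ne : (i' == i) = false by rewrite -val_eqE /= ii ltn_eqF.
have Si : ordS i' = i by apply: val_inj; rewrite val_ordS -ii ltn_eqF.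
have co : acoef i' = 1 by rewrite /acoef -ii ltn_eqF.
have Snei (j : 'I_n) : j != i' -> (ordS j == i) = false.
  by move=> ji; rewrite -Si (inj_eq ordS_inj) (negPf ji).
move=> j; rewrite /astep /swap; have [->|ji'] := eqVneq j i'.
  rewrite ne Si eqxx co; have := H i'; rewrite Si co; congr Z.
  by rewrite !rmorphB rmorph1; form_ring.
rewrite (Snei _ ji'); have [->|ji] := eqVneq j i; last exact: H.
have := kspaceD Zsp (H i) (kspaceZ (nu i - nu i' - 1) Zsp (Ztau (-1) (H i'))).
rewrite Si co nabD nabZ DT_tauV -[tau ^ (-1)]/(tau^-1) !rmorphB rmorphD rmorph1.
by move: tau^-1 => s; congr Z; form_ring.
Qed.

(** The step of Algorithm 1 carried out across the corner entry [t] of [Omega_0]. It would add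
    [c (t tau)^-1 w_b] to [w_a]; multiplying the whole frame by [t] removes this pole. *)
Lemma aform_nab_base w nu (a b : 'I_n) : a = 0%N :> nat -> b.+1 = n -> a != b ->
  aform_nab w nu -> aform_nab (abase w a b (nu a - nu b - 1)) (swap nu a b).
Proof.
move=> a0 bn ab H; have Sb : ordS b = a by apply: val_inj; rewrite val_ordS bn eqxx /= a0.
have cb : acoef b = t by rewrite /acoef bn eqxx.
have ca : acoef a = 1.
  rewrite /acoef a0; case: eqP => // n1; case/eqP: ab; apply: val_inj => /=; lia.
have Snea (j : 'I_n) : j != b -> (ordS j == a) = false.
  by move=> jb; rewrite -Sb (inj_eq ordS_inj) (negPf jb).
move=> j; rewrite /abase /swap; have [->|jb] := eqVneq j b.
  rewrite eq_sym (negPf ab) Sb eqxx cb; have := Zt (H b); rewrite Sb cb; congr Z.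
  by rewrite nabZ DTt !rmorphB rmorph1; form_ring.
rewrite (Snea _ jb); have [->|ja] := eqVneq j a; last first.
  have := Zt (H j); congr Z; rewrite nabZ DTt; form_ring.
have := kspaceD Zsp (Zt (H a)) (kspaceZ (nu a - nu b - 1) Zsp (Ztau (-1) (H b))).
rewrite Sb cb ca nabD !nabZ DTt DT_tauV -[tau ^ (-1)]/(tau^-1) !rmorphB rmorphD rmorph1.
by move: tau^-1 => s; congr Z; form_ring.
Qed.

(* The connection matrix gives [w_(j+1) = (nabla_tau + nu_j / tau) w_j], so the
   frame is determined by its first element and by [nu]. *)
Lemma aform_nab_unique w w' nu (i0 : 'I_n) : i0 = 0%N :> nat ->
    aform_nab w nu -> aform_nab w' nu -> Z (w' i0 - w i0) ->
  forall j, Z (w' j - w j).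
Proof.
move=> i00 H H' Z0; suff S m (j : 'I_n) : j = m :> nat -> Z (w' j - w j) by move=> j; apply: S.
elim: m j => [|m IHm] j jm; first by rewrite (_ : j = i0) //; apply: val_inj; rewrite /= jm.
have mn : (m < n)%N by have := ltn_ord j; rewrite jm; apply: ltnW.
pose i := Ordinal mn; have Si : ordS i = j.
  by apply: val_inj; rewrite val_ordS /= -jm ltn_eqF.
have ci : acoef i = 1 by rewrite /acoef /= -jm ltn_eqF.
have IH := IHm i erefl.
have := kspaceB Zsp (H i) (H' i); rewrite Si ci => Zd.
have nabN x : nab (- x) = - nab x.
  by rewrite -scaleN1r nabZ (derivN DTder) (deriv1 DTder); form_ring.
have -> : w' j - w j = nab (w' i - w i) + k (nu i) *: (tau ^ (-1) *: (w' i - w i)) +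
   (nab (w i) - (1 *: w j - (tau^-1 * k (nu i)) *: w i) -
    (nab (w' i) - (1 *: w' j - (tau^-1 * k (nu i)) *: w' i))).
  by rewrite nabD nabN -[tau ^ (-1)]/(tau^-1); form_ring.
apply: (kspaceD Zsp) Zd; apply: (kspaceD Zsp); first exact: Znab.
by apply: (kspaceZ _ Zsp); apply: Ztau.
Qed.

Let acL := calg_closed k [:: t; tau^-1].
Let acV := calg_closed k [:: tau^-1].

Lemma sat_fib c0 : asat Z L `<=` asat (afib c0) L.
Proof. by move=> u [v Lv /(Z_fib c0)]; exists v. Qed.

Lemma asat_submodule Z' : kspace k Z' -> (forall u m, Z' u -> Z' (tau ^ m *: u)) ->
  (forall u, Z' u -> Z' (t *: u)) -> submodule (calg k [:: t; tau^-1]) (asat Z' L).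
Proof.
move=> Zsp' Ztau' Zt'; apply: calg_submodule; first exact: Gt_kspace.
move=> b u; rewrite !inE => /orP[]/eqP-> [v Lv Zv].
  by exists (t *: v); [apply: Lt|rewrite -scalerBr; apply: Zt'].
exists (tau^-1 *: v); first exact: (@Ltau _ (-1)).
by rewrite -scalerBr; apply: (@Ztau' _ (-1)).
Qed.

Lemma calg_sub1 : calg k [:: tau^-1] `<=` calg k [:: t; tau^-1].
Proof. by apply: calg_sub => b; rewrite !inE => ->; rewrite orbT. Qed.

Lemma calg_sub2 : calg k [:: t; tau^-1] `<=` calg k ttau.
Proof. by apply: calg_sub => b; rewrite !inE => /orP[]->; rewrite ?orbT. Qed.

Lemma calg_sub12 : calg k [:: tau^-1] `<=` calg k ttau.
Proof. exact: (subset_trans calg_sub1 calg_sub2). Qed.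

Variable w1 : 'I_n -> M.
Hypothesis w1_basis : abasis (calg k [:: t; tau^-1]) Z (asat Z L) w1.

Lemma w1_mem i : asat Z L (w1 i). Proof. by case: w1_basis. Qed.

Lemma frame_N w (a : 'I_n -> F) : (forall i, asat Z L (w i)) ->
  (forall i, calg k ttau (a i)) -> N (\sum_i a i *: w i).
Proof.
move=> wL aA; apply: kspace_sum Nsp _ => i _; apply: (smZ N_submodule) => //.
exact: (Gt_N Nsp ZN LN (wL i)).
Qed.

(** Generation: put [t = c0] in the coefficients. Freeness: a relation in the fibre, divided by a
    power of [tau] so that the multiple of [t - c0] enters the lattice, becomes a relation over
    C[t, 1/tau]. It gives [a_i = (t - c0) tau^K b_i], which [transc] excludes unless [a_i = 0]. *)
Lemma fibre_basis c0 :
  abasis (calg k [:: tau^-1]) (afib c0) (asat (afib c0) L) w1.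
Proof.
have [_ gen free] := w1_basis; split.
- by move=> i; apply/sat_fib/w1_mem.
- move=> u [v Lv Zuv]; have [|_ [a [aA ->]] Zv] := gen v.
    by exists v => //; rewrite subrr; case: Zsp.
  have /choice[ab abP] : forall i, exists ab : F * F,
      [/\ calg k [:: tau^-1] ab.1, calg k [:: t; tau^-1] ab.2
        & a i = ab.1 + (t - k c0) * ab.2].
    by move=> i; have [x [y H]] := calg_reduce c0 (aA i); exists (x, y).
  exists (\sum_i (ab i).1 *: w1 i); first by exists (fun i => (ab i).1); split=> // i; case: (abP i).
  have -> : u - \sum_i (ab i).1 *: w1 i = (u - v) + (v - \sum_i a i *: w1 i)
      + (t - k c0) *: \sum_i (ab i).2 *: w1 i.
    rewrite addrA subrK -addrA; congr (_ + _); rewrite scaler_sumr -!sumrN -big_split.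
    apply: eq_bigr => i _ /=; have [_ _ ->] := abP i.
    by form_ring.
  apply: (kspaceD (fib_kspace c0)); first exact: (kspaceD (fib_kspace c0) Zuv (Z_fib c0 Zv)).
  exists 0, (\sum_i (ab i).2 *: w1 i); split; [exact: kspace0 Zsp| |by rewrite add0r].
  by apply: frame_N => i; [apply: w1_mem|apply: calg_sub2; case: (abP i)].
move=> a aA [v [g [Zv Ng e]]] i.
have [K LK] := N_L Ng; have [|_ [b [bA ->]] Zg] := gen (tau ^ (- K%:Z) *: g).
  by exists (tau ^ (- K%:Z) *: g) => //; rewrite subrr; case: Zsp.
have H : forall i, tau ^ (- K%:Z) * a i - (t - k c0) * b i = 0.
  apply: free => [j|].
    apply: (acB acL); apply: (acM acL).
    - by rewrite -exprnN -exprVn; apply: (acX _ acL); in_calg.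
    - exact: calg_sub1.
    - by apply: (acB acL); [in_calg|apply: (acC acL)].
    exact: bA.
  have -> : \sum_j (tau ^ (- K%:Z) * a j - (t - k c0) * b j) *: w1 j =
      tau ^ (- K%:Z) *: v + (t - k c0) *: (tau ^ (- K%:Z) *: g - \sum_j b j *: w1 j).
    rewrite scalerBr addrA [X in _ = X + _](_ : _ = tau ^ (- K%:Z) *: \sum_j a j *: w1 j).
      rewrite !scaler_sumr -sumrB; apply: eq_bigr => j _; form_ring.
    by rewrite e; form_ring.
  apply: (kspaceD Zsp); first exact: Ztau.
  apply: (smZ Z_submodule) => //; have ac := calg_closed k ttau.
  by apply: (acB ac); [in_calg|apply: (acC ac)].
have [J] : exists J : nat, forall m, (J <= m)%N -> calg k [:: tau] (tau ^+ m * a i).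
  apply: calg_denom (calg_closed k [:: tau]) _ _ (aA i).
    in_calg.
  by move=> b' /[!inE] /eqP->; right; rewrite mulfV //; apply: (ac1 (calg_closed k _)).
move=> /(_ _ (leqnn _)) /calg1_poly[p pE].
have p0 : p = 0.
  apply: (@transc p c0 (J + K) (b i)); first exact: bA.
  rewrite -pE; have /eqP := H i; rewrite subr_eq0 => /eqP Hi.
  have -> : a i = tau ^+ K * (tau ^ (- K%:Z) * a i).
    by rewrite mulrA exprnP -expfzDr // subrr mul1r.
  by rewrite Hi exprD; ring.
have /eqP := pE; rewrite p0 ptt0 mulf_eq0 expf_eq0 (negPf tau0) andbF /= => /eqP.
by [].
Qed.

Section Steps.
Variables (A : set F) (Z' N' : set M).
Hypotheses (Ar : subring A) (Zm : submodule A Z') (Nm : submodule A N') (ZN' : Z' `<=` N').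

Lemma astep_basis w (i' i : 'I_n) c : i != i' -> A (tau^-1 * k c) ->
  abasis A Z' N' w -> abasis A Z' N' (astep w i' i c).
Proof.
move=> ii Ac /(abasis_add Ar Nm ii Ac); congr abasis.
by apply/funext => j; rewrite /astep; case: eqVneq => // ->.
Qed.

(** Modulo [Z'] the base change is an elementary operation with coefficient [s^-1 tau^-1 c] followed
    by scaling by a unit [s] that acts as [t]. In the localisation [s] is [t], in a fibre it is the
    value of [t]. *)
Lemma abase_basis w (a b : 'I_n) c (s : F) : Z' 0 -> a != b -> s != 0 -> A s -> A s^-1 ->
  A (tau^-1 * k c) -> (forall j, Z' (t *: w j - s *: w j)) ->
  abasis A Z' N' w -> abasis A Z' N' (abase w a b c).
Proof.
move=> Z0 ab s0 As AsV Ac ts.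
move/(abasis_add Ar Nm ab (srM Ar AsV Ac))/(abasis_scale Ar Nm s0 As AsV).
apply: (abasis_cong Ar Zm Nm ZN' Z0) => j; rewrite /abase; case: eqVneq => [->|_] //.
by rewrite scalerDr scalerA mulrA mulfV // mul1r opprD addrACA subrr addr0.
Qed.
End Steps.

(** * Leading terms of the frames modulo tau^-1 G *)

Section Close.
Variables (om : nat -> M) (c0 : C).

(** [j] counts base changes: each multiplies the frame by [t], which acts as [c0] on the fibre. *)
Definition aclose (j : nat) w : Prop := forall i,
  scaled tau^-1 (asat (afib c0) L) (w i - k (c0 ^+ j) *: om i).

Let Gtf := asat (afib c0) L.
Lemma scaled_lin : kspace k (scaled tau^-1 Gtf).
Proof.
have [G0 G1] := Gt_kspace (fib_kspace c0) Lsp.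
split; first by exists 0 => //; rewrite scaler0.
move=> a _ _ [u Gu ->] [v Gv ->]; exists (k a *: u + v); first exact: G1.
by form_ring.
Qed.

Lemma scaled_fib u : afib c0 u -> scaled tau^-1 Gtf u.
Proof.
move=> Zu; exists (tau *: u); last by rewrite scalerA mulVf // scale1r.
apply: (Gt_Z Lsp); rewrite -[X in X *: _]expr1z; exact: fib_tau.
Qed.

Lemma aclose_step j w (i' i : 'I_n) c : (forall l, asat Z L (w l)) ->
  aclose j w -> aclose j (astep w i' i c).
Proof.
move=> wL H l; rewrite /astep; case: (eqVneq l i) => [->|_]; last exact: H.
rewrite addrAC; apply: (kspaceD scaled_lin) (H i) _.
exists (k c *: w i'); last by rewrite scalerA.
exact: (kspaceZ _ (Gt_kspace (fib_kspace c0) Lsp) (sat_fib c0 (wL i'))).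
Qed.

Lemma aclose_base j w (a b : 'I_n) c : (forall l, asat Z L (w l)) ->
  aclose j w -> aclose j.+1 (abase w a b c).
Proof.
move=> wL H l.
have Hl : scaled tau^-1 Gtf (t *: w l - k (c0 ^+ j.+1) *: om l).
  have -> : t *: w l - k (c0 ^+ j.+1) *: om l =
     (t *: w l - k c0 *: w l) + k c0 *: (w l - k (c0 ^+ j) *: om l).
    by rewrite exprS rmorphM; form_ring.
  apply: (kspaceD scaled_lin); last exact: (kspaceZ _ scaled_lin).
  by apply/scaled_fib/fib_cong/(Gt_N Nsp ZN LN (wL l)).
rewrite /abase; case: (eqVneq l a) => [la|_] //; rewrite -la addrAC.
apply: (kspaceD scaled_lin Hl); exists (k c *: w b); last by rewrite scalerA.
exact: (kspaceZ _ (Gt_kspace (fib_kspace c0) Lsp) (sat_fib c0 (wL b))).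
Qed.

(** The frame [w1] is unitriangular in the forms [om j], so these are recovered from it one after
    the other. *)
Lemma expansion_mem (b : nat -> nat -> C) :
    (forall j : 'I_n, Z (w1 j - (om j +
       \sum_(1 <= i < j.+1) (k (b i j) * tau ^- i) *: om (j - i)%N))) ->
  forall j, (j < n)%N -> asat Z L (om j).
Proof.
move=> wE j; elim/ltn_ind: j => j IH jn.
have G := asat_submodule Zsp Ztau Zt; have Gk := Gt_kspace Zsp Lsp.
have /= := wE (Ordinal jn); set S := \sum_(_ <= _ < _) _ => Zw.
have GS : asat Z L S.
  rewrite /S big_nat_cond; apply: kspace_sum Gk _ => i /andP[/andP[i1 ij] _].
  apply: (smZ G); last by apply: IH; lia.
  apply: (acM acL); first exact: (acC acL).
  by rewrite -exprVn; apply: (acX _ acL); in_calg.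
have -> : om j = w1 (Ordinal jn) - S - (w1 (Ordinal jn) - (om j + S)).
  by form_ring.
apply: (kspaceB Gk); last exact: (Gt_Z Lsp).
exact: (kspaceB Gk (w1_mem _)).
Qed.

Lemma aclose_expansion (b : nat -> nat -> C) :
    (forall j : 'I_n, Z (w1 j - (om j +
       \sum_(1 <= i < j.+1) (k (b i j) * tau ^- i) *: om (j - i)%N))) ->
  aclose 0 w1.
Proof.
move=> wE l; have := wE l; set S := \sum_(_ <= _ < _) _ => Zw.
rewrite expr0 rmorph1 scale1r.
have -> : w1 l - om l = (w1 l - (om l + S)) + S by form_ring.
apply: (kspaceD scaled_lin); first exact/scaled_fib/Z_fib.
rewrite /S big_nat_cond; apply: kspace_sum scaled_lin _ => i /andP[/andP[i1 il] _].
exists ((k (b i l) * tau ^- i.-1) *: om (l - i)%N); last first.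
  rewrite scalerA; congr (_ *: _); case: i i1 {il} => // i _ /=.
  by rewrite exprS invfM; ring.
apply: sat_fib; apply: (smZ (asat_submodule Zsp Ztau Zt)).
  apply: (acM acL); first exact: (acC acL).
  by rewrite -exprVn; apply: (acX _ acL); in_calg.
by apply: (expansion_mem wE); have := ltn_ord l; lia.
Qed.
End Close.

Lemma astep_mem w (i' i : 'I_n) c : (forall l, asat Z L (w l)) ->
  forall l, asat Z L (astep w i' i c l).
Proof.
move=> wL l; rewrite /astep; case: ifP => // _; have G := asat_submodule Zsp Ztau Zt.
apply: (smD G) => //; apply: (smZ G) => //.
by apply: (acM acL); [in_calg|apply: (acC acL)].
Qed.

Lemma abase_mem w (a b : 'I_n) c : (forall l, asat Z L (w l)) ->
  forall l, asat Z L (abase w a b c l).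
Proof.
move=> wL l; rewrite /abase; have G := asat_submodule Zsp Ztau Zt.
have tA : calg k [:: t; tau^-1] t by in_calg.
case: ifP => // _; last exact: (smZ G).
apply: (smD G); apply: (smZ G) => //.
by apply: (acM acL); [in_calg|apply: (acC acL)].
Qed.

Definition aweight (r : F) w : Prop := forall j : 'I_n,
  Z (Eu (w j) - (j%:R + r) *: w j).

Lemma EW_tauV c : EW (tau^-1 * k c) = tau^-1 * k c.
Proof. by rewrite (derivM EWder) (derivV EWder) EWk EWtau; field. Qed.

(** [tau^-1] has weight 1, so [tau^-1 w_i'] has the weight of [w_i]. *)
Lemma aweight_step r w (i' i : 'I_n) c : i = i'.+1 :> nat ->
  aweight r w -> aweight r (astep w i' i c).
Proof.
move=> ii H j; rewrite /astep; case: (eqVneq j i) => [->|_]; last exact: H.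
have := kspaceD Zsp (H i) (kspaceZ c Zsp (Ztau (-1) (H i'))).
rewrite EuD EuZ EW_tauV -[tau ^ (-1)]/(tau^-1) ii -natr1.
by move: tau^-1 => s; congr Z; form_ring.
Qed.

(** [t] has weight [n], which is also what separates the weight of [tau^-1 w_b] from that of
    [w_a]. *)
Lemma aweight_base r w (a b : 'I_n) c : a = 0%N :> nat -> b.+1 = n ->
  aweight r w -> aweight (r + n%:R) (abase w a b c).
Proof.
move=> a0 bn H j; rewrite /abase.
have Ht l : Z (Eu (t *: w l) - (l%:R + (r + n%:R)) *: (t *: w l)).
  by have := Zt (H l); congr Z; rewrite EuZ EWt; form_ring.
case: (eqVneq j a) => [->|_] //.
have := kspaceD Zsp (Ht a) (kspaceZ c Zsp (Ztau (-1) (H b))).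
have -> : (n%:R : F) = b%:R + 1 by rewrite natr1 bn.
rewrite EuD [Eu (_ *: w b)]EuZ EW_tauV -[tau ^ (-1)]/(tau^-1) a0.
by move: tau^-1 => s; congr Z; form_ring.
Qed.

Lemma aweight_expansion (om : nat -> M) (b : nat -> nat -> C) :
    (forall j, Eu (om j) = j%:R *: om j) ->
    (forall j : 'I_n, Z (w1 j - (om j +
       \sum_(1 <= i < j.+1) (k (b i j) * tau ^- i) *: om (j - i)%N))) ->
  aweight 0 w1.
Proof.
move=> omE wE j; have := wE j; set S := \sum_(_ <= _ < _) _ => Zw.
have EuN u : Eu (- u) = - Eu u.
  by rewrite -scaleN1r EuZ (derivN EWder) (deriv1 EWder); form_ring.
have ES : Eu S = j%:R *: S.
  rewrite /S; have Eu0 : Eu 0 = 0 by apply: (addrI (Eu 0)); rewrite -EuD !addr0.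
  rewrite (big_morph Eu EuD Eu0) scaler_sumr; apply: eq_big_nat => i /andP[i1 ij].
  rewrite EuZ omE (derivM EWder) EWk mul0r add0r exprnN (derivXz EWder) // EWtau.
  rewrite natrB; last by lia.
  have -> : tau ^ (- i%:Z - 1) = tau ^ (- i%:Z) * tau^-1 by rewrite expfzDr.
  have -> : ((- i%:Z)%:~R : F) = - i%:R by rewrite intrN -pmulrn.
  move: (tau ^ (- i%:Z)) (om (j - i)%N) (k _) (i%:R : F) (j%:R : F) => x y z r s.
  apply/ffunP => I; rewrite !aformE; field.
  by [].
have := kspaceB Zsp (ZEu Zw) (kspaceZ j%:R Zsp Zw).
rewrite EuD EuN EuD omE ES rmorph_nat; congr Z; form_ring.
Qed.

(** * The localised system over T without the origin *)

Section Family.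
Let tt3 : seq F := [:: t; t^-1; tau^-1].
Let tt4 : seq F := [:: t; t^-1; tau].
Let ac3 := calg_closed k tt3.
Let ac4 := calg_closed k tt4.
Let tX_neq0 j : t ^+ j != 0. Proof. by rewrite expf_neq0. Qed.

Lemma stable_tX S u j : (forall v, S v -> S (t *: v)) -> S u -> S (t ^+ j *: u).
Proof.
move=> St Su; elim: j => [|j IHj]; first by rewrite expr0 scale1r.
by rewrite exprS -scalerA; apply: St.
Qed.

Lemma aloc_sub S : S `<=` aloc S.
Proof. by move=> u Su; exists 0%N; rewrite expr0 scale1r. Qed.

Lemma aloc_mono S S' : S `<=` S' -> aloc S `<=` aloc S'.
Proof. by move=> SS' u [j Su]; exists j; apply: SS'. Qed.

Lemma aloc_kspace S : kspace k S -> (forall v, S v -> S (t *: v)) -> kspace k (aloc S).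
Proof.
move=> Ssp St; split; first exact/aloc_sub/(kspace0 Ssp).
move=> a u v [i Su] [j Sv]; exists (i + j)%N.
have -> : t ^+ (i + j) *: (k a *: u + v) =
    k a *: (t ^+ j *: (t ^+ i *: u)) + t ^+ i *: (t ^+ j *: v).
  by rewrite exprD; form_ring.
by case: (Ssp) => _; apply; apply: stable_tX.
Qed.

Lemma aloc_submodule S s : kspace k S -> (forall v, S v -> S (t *: v)) ->
  (forall b u, b \in s -> S u -> S (b *: u)) ->
  submodule (calg k (t :: t^-1 :: s)) (aloc S).
Proof.
move=> Ssp St Ss; apply: calg_submodule; first exact: aloc_kspace.
move=> b u; rewrite !inE => /or3P[/eqP->|/eqP->|bs] [j Su].
- by exists j; rewrite scalerA mulrC -scalerA; apply: St.
- by exists j.+1; rewrite scalerA exprSr mulfK.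
by exists j; rewrite scalerA mulrC -scalerA; apply: Ss.
Qed.

Lemma calg_denom_all (x : F) (a : 'I_n -> F) : (forall i, calg k [:: t; t^-1; x] (a i)) ->
  exists J : nat, forall m i, (J <= m)%N -> calg k [:: t; x] (t ^+ m * a i).
Proof.
move=> aA; have ac := calg_closed k [:: t; x].
have /choice[J JP] : forall i, exists J : nat, forall m, (J <= m)%N ->
    calg k [:: t; x] (t ^+ m * a i).
  move=> i; apply: calg_denom (ac) _ _ (aA i); first in_calg.
  move=> b; rewrite !inE => /or3P[]/eqP->.
  - by left; in_calg.
  - by right; rewrite mulfV //; apply: (ac1 ac).
  by left; in_calg.
exists (\sum_i J i)%N => m i le; apply: JP; apply: leq_trans le.
by rewrite (bigD1 i) //= leq_addr.
Qed.

Let Z_tauV b u : b \in [:: tau^-1] -> Z u -> Z (b *: u).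
Proof. by rewrite inE => /eqP->; apply: (Ztau (-1)). Qed.

Let Z_tau b u : b \in [:: tau] -> Z u -> Z (b *: u).
Proof. by rewrite inE => /eqP-> Zu; rewrite -[X in X *: _]expr1z; apply: Ztau. Qed.

Lemma loc_basis :
  abasis (calg k tt3) (aloc Z) (aloc (asat Z L)) w1.
Proof.
have [_ gen free] := w1_basis; split.
- by move=> i; apply/aloc_sub/w1_mem.
- move=> u [j /gen[_ [a [aA ->]] Zu]].
  exists (\sum_i (t^-1 ^+ j * a i) *: w1 i).
    exists (fun i => t^-1 ^+ j * a i); split=> // i; apply: (acM ac3).
      by apply: (acX _ ac3); in_calg.
    apply: calg_sub (aA i) => b; rewrite !inE.
    by case/orP=> ->; rewrite ?orbT.
  exists j; move: Zu; congr Z; rewrite scalerBr scaler_sumr; congr (_ - _).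
  apply: eq_bigr => i _; rewrite scalerA exprVn mulrA mulfV ?mul1r //.
move=> a aA [j Za] i; have [J JP] := calg_denom_all aA.
have /eqP : t ^+ (J + j) * a i = 0.
  move: i; apply: free => [i|]; first by apply: JP; apply: leq_addr.
  have := stable_tX J Zt Za; congr Z; rewrite !scaler_sumr; apply: eq_bigr => i _.
  by rewrite !scalerA exprD.
by rewrite mulf_eq0 (negPf (tX_neq0 _)) => /eqP.
Qed.

Let locZ_sub : aloc Z `<=` aloc (asat Z L).
Proof. by apply: aloc_mono; apply: (Gt_Z Lsp). Qed.

Let locZ_sm3 : submodule (calg k tt3) (aloc Z).
Proof. exact: aloc_submodule. Qed.

Let locG_sm3 : submodule (calg k tt3) (aloc (asat Z L)).
Proof.
have G := asat_submodule Zsp Ztau Zt.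
apply: aloc_submodule; first exact: Gt_kspace.
  by move=> v; apply: (smZ G); in_calg.
by move=> b v; rewrite inE => /eqP->; apply: (smZ G); in_calg.
Qed.

Let tauVk_mem c : calg k tt3 (tau^-1 * k c).
Proof.
by apply: (acM ac3); [in_calg|apply: (acC ac3)].
Qed.

Lemma loc_basis_step w (i' i : 'I_n) c : i != i' ->
  abasis (calg k tt3) (aloc Z) (aloc (asat Z L)) w ->
  abasis (calg k tt3) (aloc Z) (aloc (asat Z L)) (astep w i' i c).
Proof. by move=> ii; apply: astep_basis => //; apply: calg_subring. Qed.

Lemma loc_basis_base w (a b : 'I_n) c : a != b ->
  abasis (calg k tt3) (aloc Z) (aloc (asat Z L)) w ->
  abasis (calg k tt3) (aloc Z) (aloc (asat Z L)) (abase w a b c).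
Proof.
move=> ab; apply: (@abase_basis _ _ _ (calg_subring _ _) locZ_sm3 locG_sm3 locZ_sub _ _ _ _ t) => //.
- exact/aloc_sub/(kspace0 Zsp).
- in_calg.
- in_calg.
by move=> j; rewrite subrr; apply/aloc_sub/(kspace0 Zsp).
Qed.

Variables (w : 'I_n -> M) (nu : 'I_n -> C) (r : nat).
Hypothesis w_mem : forall l, asat Z L (w l).
Hypothesis w_basis : abasis (calg k tt3) (aloc Z) (aloc (asat Z L)) w.
Hypothesis w_nab : aform_nab w nu.
Hypothesis w_weight : aweight r%:R w.
Variable nabt : M -> M.
Hypothesis nabtE : forall u, nabt u = (n%:R * t)^-1 *: (Eu u + tau *: nab u).

Let M0 := asat (aloc Z) (aspan (calg k tt4) w).

Let n0 : (n%:R : F) != 0.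
Proof. by rewrite -(rmorph_nat k) fmorph_eq0 pnatr_eq0 -lt0n. Qed.

Let locZk : kspace k (aloc Z). Proof. exact: aloc_kspace. Qed.

Let locZ_sm4 : submodule (calg k tt4) (aloc Z).
Proof. exact: aloc_submodule. Qed.

(** A relation over C[t, 1/t, tau] becomes one over C[t, 1/t, 1/tau] after division by a power of
    [tau], where freeness is known. *)
Lemma family_frame : abasis (calg k tt4) (aloc Z) M0 w.
Proof.
have [_ _ free] := w_basis; split.
- move=> i; rewrite -[w i]scale1r; apply: asat_aspan_gen; first exact: kspace0 locZk.
    exact: (ac0 ac4).
  exact: (ac1 ac4).
- by move=> u [v Av Zuv]; exists v.
move=> a aA Za i.
have /choice[J JP] : forall i, exists J : nat, forall m, (J <= m)%N ->
    calg k tt3 (tau^-1 ^+ m * a i).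
  move=> l; apply: calg_denom (ac3) _ _ (aA l).
    in_calg.
  move=> b; rewrite !inE => /or3P[]/eqP->.
  - by left; in_calg.
  - by left; in_calg.
  by right; rewrite mulVf //; apply: (ac1 ac3).
pose m := (\sum_i J i)%N.
have /eqP : tau^-1 ^+ m * a i = 0.
  move: i; apply: free => [i|]; first by apply: JP; rewrite /m (bigD1 i) //= leq_addr.
  have -> : \sum_i (tau^-1 ^+ m * a i) *: w i = tau^-1 ^+ m *: \sum_i a i *: w i.
    by rewrite scaler_sumr; apply: eq_bigr => i _; rewrite scalerA.
  apply: (smZ locZ_sm3) Za; apply: (acX _ ac3).
  in_calg.
by rewrite mulf_eq0 expf_eq0 invr_eq0 (negPf tau0) andbF => /eqP.
Qed.

Lemma M0_submodule : submodule (calg k tt4) M0.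
Proof. by apply: asat_aspan_submodule => //; apply: calg_subring. Qed.

Lemma M0_Z : aloc Z `<=` M0.
Proof. by apply: asat_aspan_Z; apply: (ac0 ac4). Qed.

Let w_M0 i : M0 (w i). Proof. by case: family_frame. Qed.

Let t_mem : calg k tt4 t. Proof. in_calg. Qed.
Let tV_mem : calg k tt4 t^-1. Proof. in_calg. Qed.
Let tau_mem : calg k tt4 tau. Proof. in_calg. Qed.

Let nat_mem m : calg k tt4 m%:R.
Proof. by rewrite -(rmorph_nat k); apply: (acC ac4). Qed.

(* Both connections are derivations over derivations of the coefficient
   algebra, so only the frame and the relations need to be checked. *)
Lemma derivation_M0 (g : M -> M) (D : F -> F) : derivation D ->
    (forall c, D (k c) = 0) -> (forall b, b \in tt4 -> calg k tt4 (D b)) ->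
    (forall u v, g (u + v) = g u + g v) ->
    (forall a u, g (a *: u) = D a *: u + a *: g u) ->
    (forall u, aloc Z u -> aloc Z (g u)) -> (forall i, M0 (g (w i))) ->
  forall u, M0 u -> M0 (g u).
Proof.
move=> der Dk Dt4 gD gZ gloc gw u [_ [a [aA ->]] Zu].
rewrite -(subrK (\sum_i a i *: w i) u) gD; apply: (smD M0_submodule).
  exact/M0_Z/gloc.
have g0 : g 0 = 0 by apply: (addrI (g 0)); rewrite -gD !addr0.
rewrite (big_morph g gD g0); apply: sm_sum M0_submodule _ => [|i _].
  by apply: M0_Z; apply: kspace0 locZk.
rewrite gZ; apply: (smD M0_submodule); apply: (smZ M0_submodule) => //.
exact: calg_deriv.
Qed.

Let nab_loc u : aloc Z u -> aloc Z (nab u).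
Proof.
move=> [j /Znab]; rewrite nabZ; have -> : DT (t ^+ j) = 0.
  elim: j => [|j IHj]; first by rewrite expr0 (deriv1 DTder).
  by rewrite exprS (derivM DTder) DTt IHj mul0r mulr0 addr0.
by rewrite scale0r add0r; exists j.
Qed.

Lemma EW_tX j : EW (t ^+ j) = (j * n)%:R * t ^+ j.
Proof.
elim: j => [|j IHj]; first by rewrite expr0 (deriv1 EWder) mul0n mul0r.
by rewrite exprS (derivM EWder) EWt IHj mulSn natrD; ring.
Qed.

Let Eu_loc u : aloc Z u -> aloc Z (Eu u).
Proof.
move=> [j Zu]; exists j; have := kspaceB Zsp (ZEu Zu) (kspaceZ (j * n)%:R Zsp Zu).
rewrite EuZ EW_tX rmorph_nat; congr Z.
by rewrite scalerA addrAC subrr add0r.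
Qed.

Lemma M0_nab u : M0 u -> M0 (tau *: nab u).
Proof.
apply: (derivation_M0 (g := fun u => tau *: nab u) (D := fun a => tau * DT a)).
- split=> a b; first by rewrite (derivD DTder) mulrDr.
  by rewrite (derivM DTder); ring.
- by move=> c; rewrite DTk mulr0.
- move=> b; rewrite !inE => /or3P[]/eqP->; rewrite ?(derivV DTder) ?DTt ?DTtau.
  + by rewrite mulr0; apply: (ac0 ac4).
  + by rewrite oppr0 mul0r mulr0; apply: (ac0 ac4).
  by rewrite mulr1.
- by move=> x y; rewrite nabD scalerDr.
- by move=> a x; rewrite nabZ; form_ring.
- move=> x /nab_loc; apply: (smZ locZ_sm4) => //.
move=> i; have := w_nab i; set X := _ - _ => ZX.
have -> : tau *: nab (w i) = tau *: X + (tau * acoef i) *: w (ordS i) - k (nu i) *: w i.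
  rewrite /X; apply/ffunP => I; rewrite !aformE; field.
  by [].
apply: (smB (calg_subring _ _) M0_submodule); last by apply: (smZ M0_submodule) => //; apply: (acC ac4).
apply: (smD M0_submodule).
  by apply/M0_Z/(smZ locZ_sm4) => //; apply: aloc_sub.
apply: (smZ M0_submodule) => //; apply: (acM ac4) => //; rewrite /acoef.
by case: ifP => // _; apply: (ac1 ac4).
Qed.

Lemma M0_Eu u : M0 u -> M0 (Eu u).
Proof.
apply: (derivation_M0 (D := EW)) => //.
- move=> b; rewrite !inE => /or3P[]/eqP->; rewrite ?(derivV EWder) ?EWt ?EWtau.
  + exact: (acM ac4).
  + have -> : - (n%:R * t) / t ^+ 2 = - (n%:R * t^-1) by field.
    by apply: (acN ac4); apply: (acM ac4).
  exact: (acN ac4).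
move=> i; rewrite -(subrK ((i%:R + r%:R) *: w i) (Eu (w i))); apply: (smD M0_submodule).
  exact/M0_Z/aloc_sub.
by apply: (smZ M0_submodule) => //; rewrite -natrD.
Qed.

Lemma M0_nabt u : M0 u -> M0 (nabt u).
Proof.
move=> Mu; rewrite nabtE invfM; apply: (smZ M0_submodule).
  apply: (acM ac4) => //; rewrite -(rmorph_nat k) -fmorphV.
  exact: (acC ac4).
by apply: (smD M0_submodule); [apply: M0_Eu|apply: M0_nab].
Qed.

Definition arestrict (c0 : C) (S : set M) : set M :=
  [set u | N u /\ exists2 v, S v & aloc (afib c0) (u - v)].

Lemma tX_cong c0 u j : N u -> afib c0 (t ^+ j *: u - k (c0 ^+ j) *: u).
Proof.
move=> Nu; elim: j => [|j IHj].
  by rewrite !expr0 rmorph1 subrr; apply: kspace0 (fib_kspace c0).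
have -> : t ^+ j.+1 *: u - k (c0 ^+ j.+1) *: u =
    t *: (t ^+ j *: u - k (c0 ^+ j) *: u) + k (c0 ^+ j) *: (t *: u - k c0 *: u).
  by rewrite !exprS rmorphM; form_ring.
apply: (kspaceD (fib_kspace c0)); first exact: fib_t.
by apply: (kspaceZ _ (fib_kspace c0)); apply: fib_cong.
Qed.

(** At [c0 <> 0] the function [t] acts as an invertible scalar, so a power of [t] clears the
    denominators of the coefficients and can be divided out again as a power of [c0]. *)
Lemma arestrictE c0 : c0 != 0 ->
  arestrict c0 M0 = asat (afib c0) (aspan (calg k [:: tau]) w).
Proof.
move=> c00; have wN i : N (w i) by apply: (Gt_N Nsp ZN LN (w_mem i)).
have fk := fib_kspace c0.
have sub4 : calg k [:: tau] `<=` calg k tt4.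
  by apply: calg_sub => b; rewrite !inE => ->; rewrite !orbT.
have subN x : {subset x <= ttau} -> forall a : 'I_n -> F, (forall i, calg k x (a i)) ->
    N (\sum_i a i *: w i).
  move=> xt a aA; apply: frame_N => // i; exact: calg_sub (aA i).
apply/seteqP; split=> [u [Nu [v [_ [a [aA ->]] Zv] uv]]|u [v [a [aA ->]] Zuv]]; last first.
  split.
    rewrite -(subrK (\sum_i a i *: w i) u); apply: (kspaceD Nsp); first exact: (fib_N Zuv).
    by apply: (subN [:: tau]) => // b; rewrite !inE => ->; rewrite orbT.
  exists (\sum_i a i *: w i); last exact: aloc_sub.
  exists (\sum_i a i *: w i); first by exists a; split=> // i; apply: sub4.
  by rewrite subrr; apply: kspace0 locZk.
have lfk : kspace k (aloc (afib c0)) by apply: aloc_kspace => // x; apply: fib_t.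
have [j uj] : aloc (afib c0) (u - \sum_i a i *: w i).
  have -> : u - \sum_i a i *: w i = (u - v) + (v - \sum_i a i *: w i) by rewrite addrA subrK.
  by apply: (kspaceD lfk) => //; apply: aloc_mono Zv; apply: Z_fib.
have [J JP] := calg_denom_all aA; pose m := (J + j)%N.
have /choice[ab abP] : forall i, exists ab : F * F,
    [/\ calg k [:: tau] ab.1, calg k [:: t; tau] ab.2
      & t ^+ m * a i = ab.1 + (t - k c0) * ab.2].
  move=> i; have [x [y H]] := calg_reduce c0 (JP m i (leq_addr _ _)).
  by exists (x, y).
have Nb : N (\sum_i (ab i).2 *: w i).
  apply: (subN [:: t; tau]) => [b|i]; last by case: (abP i).
  by rewrite !inE => /orP[]->; rewrite ?orbT.
have um : afib c0 (t ^+ m *: u - \sum_i (t ^+ m * a i) *: w i).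
  have := stable_tX J (@fib_t c0) uj; congr afib.
  rewrite scalerA -exprD scalerBr scaler_sumr; congr (_ - _).
  by apply: eq_bigr => i _; rewrite scalerA.
(* [ab.1] is the coefficient [t ^+ m * a i] at [t = c0], and [t ^+ m] itself has become
   [c0 ^+ m]. *)
exists (k (c0 ^+ m)^-1 *: \sum_i (ab i).1 *: w i).
  exists (fun i => k (c0 ^+ m)^-1 * (ab i).1); split=> [i|]; last first.
    by rewrite scaler_sumr; apply: eq_bigr => i _; rewrite scalerA.
  have ac := calg_closed k [:: tau]; case: (abP i) => h _ _.
  by apply: (acM ac) => //; apply: (acC ac).
have -> : u - k (c0 ^+ m)^-1 *: \sum_i (ab i).1 *: w i =
    k (c0 ^+ m)^-1 *: (k (c0 ^+ m) *: u - \sum_i (ab i).1 *: w i).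
  by rewrite scalerBr scalerA -rmorphM mulVf ?expf_neq0 // rmorph1 scale1r.
apply: (kspaceZ _ fk).
have -> : k (c0 ^+ m) *: u - \sum_i (ab i).1 *: w i =
   (t ^+ m *: u - \sum_i (t ^+ m * a i) *: w i) - (t ^+ m *: u - k (c0 ^+ m) *: u)
   + (t *: (\sum_i (ab i).2 *: w i) - k c0 *: \sum_i (ab i).2 *: w i).
  have -> : \sum_i (t ^+ m * a i) *: w i =
      \sum_i (ab i).1 *: w i + (t - k c0) *: \sum_i (ab i).2 *: w i.
    rewrite scaler_sumr -big_split; apply: eq_bigr => i _ /=.
    by have [_ _ ->] := abP i; form_ring.
  move: (\sum_i (ab i).1 *: w i) (\sum_i (ab i).2 *: w i) => x y.
  form_ring.
apply: (kspaceD fk); last exact: fib_cong.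
by apply: (kspaceB fk) => //; apply: tX_cong.
Qed.

Lemma nabt_frame (kk : nat) : r = (kk * n)%N -> forall j,
  aloc Z (nabt (w j) - aframe_mul w ((n%:R * t)^-1 *:
    (diag_mx (\row_(i < n) i%:R) + (kk * n)%:R%:M + tau *: aOmega + aA nu)) j).
Proof.
(* One factor [t] clears the denominator of [nabt]. What remains is the sum of the weight relation
   and [tau] times the connection relation, divided by [n]. *)
move=> re j; exists 1%N; rewrite nabtE aframe_mulZ !aframe_mulD aframe_mulZ.
rewrite !aframe_mul_diag aframe_mul_Omega !mxE.
have -> : aframe_mul w (kk * n)%:R%:M j = (kk * n)%:R *: w j.
  by rewrite -diag_const_mx aframe_mul_diag mxE.
have H1 := w_weight j; have H2 := Ztau 1 (w_nab j).
have := kspaceZ n%:R^-1 Zsp (kspaceD Zsp H1 H2); congr Z.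
rewrite re fmorphV rmorph_nat expr1z expr1.
move: (w j) (w (ordS j)) (Eu (w j)) (nab (w j)) (acoef j) (k (nu j)) => u z x y e g.
move: (j%:R : F) ((kk * n)%:R : F) (n%:R : F) n0 => a b c c0.
by apply/ffunP => I; rewrite !aformE; field; rewrite t0 c0 tau0.
Qed.

End Family.

Variable om : nat -> M.

(** Invariant of both algorithms after [j] base changes. [U] is the set of values of [t] at which
    the frame is known to be a basis: it is arbitrary for runs of Algorithm 1, but must avoid 0 for
    (B). *)
Record frame_inv (U : set C) (j : nat) w nu : Prop := FrameInv {
  inv_mem : forall l, asat Z L (w l);
  inv_nab : aform_nab w nu;
  inv_fibre : forall c0, U c0 -> abasis (calg k [:: tau^-1]) (afib c0) (asat (afib c0) L) w;
  inv_close : forall c0, aclose om c0 j w;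
  inv_loc : abasis (calg k [:: t; t^-1; tau^-1]) (aloc Z) (aloc (asat Z L)) w;
  inv_weight : aweight (j * n)%:R w }.

Lemma frame_inv_init (b : nat -> nat -> C) nu :
    (forall j, Eu (om j) = j%:R *: om j) ->
    (forall j : 'I_n, Z (w1 j - (om j +
       \sum_(1 <= i < j.+1) (k (b i j) * tau ^- i) *: om (j - i)%N))) ->
    aform_nab w1 nu ->
  forall U, frame_inv U 0 w1 nu.
Proof.
move=> omE wE w1_nab U; split.
- exact: w1_mem.
- exact: w1_nab.
- by move=> c0 _; apply: fibre_basis.
- by move=> c0; apply: aclose_expansion wE.
- exact: loc_basis.
by rewrite mul0n; apply: aweight_expansion wE.
Qed.

Let fib_sm c0 : submodule (calg k [:: tau^-1]) (afib c0).
Proof. exact: submodule_sub calg_sub12 (fib_submodule c0). Qed.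

Let fib_G_sm c0 : submodule (calg k [:: tau^-1]) (asat (afib c0) L).
Proof.
apply: submodule_sub calg_sub1 _.
by apply: asat_submodule; [apply: fib_kspace|apply: fib_tau|apply: fib_t].
Qed.

Let tauVk_mem1 c : calg k [:: tau^-1] (tau^-1 * k c).
Proof. by apply: (acM acV); [in_calg|apply: (acC acV)]. Qed.

Lemma frame_inv_step U j w nu (i' i : 'I_n) : i = i'.+1 :> nat ->
  frame_inv U j w nu ->
  frame_inv U j (astep w i' i (nu i - nu i' - 1)) (swap nu i i').
Proof.
move=> ii [wL wnab wfib wcl wloc wwt].
have ne : i != i' by rewrite -val_eqE /= ii gtn_eqF.
split.
- exact: astep_mem.
- exact: aform_nab_step.
- move=> c0 /wfib; apply: (astep_basis (calg_subring _ _) (fib_G_sm c0)) => //.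
- by move=> c0; apply: aclose_step.
- exact: loc_basis_step.
exact: aweight_step.
Qed.

Lemma frame_inv_base U j w nu (a b : 'I_n) : ~ U 0 ->
    a = 0%N :> nat -> b.+1 = n -> a != b ->
  frame_inv U j w nu ->
  frame_inv U j.+1 (abase w a b (nu a - nu b - 1)) (swap nu a b).
Proof.
move=> U0 a0 bn ab [wL wnab wfib wcl wloc wwt]; split.
- exact: abase_mem.
- exact: aform_nab_base.
(* In this fibre [t] is the scalar [c0], a unit because [U] avoids 0. *)
- move=> c0 Uc0; have c00 : c0 != 0 by apply: contra_not_neq U0 => <-.
  have := wfib c0 Uc0.
  apply: (@abase_basis _ _ _ (calg_subring _ _) (fib_sm c0) (fib_G_sm c0)
    (@Gt_Z _ _ _ _ _ _ Lsp) _ _ _ _ (k c0)) => //.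
  + exact: kspace0 (fib_kspace c0).
  + by rewrite fmorph_eq0.
  + exact: (acC acV).
  + by rewrite -fmorphV; apply: (acC acV).
  by move=> l; apply/fib_cong/(Gt_N Nsp ZN LN (wL l)).
- by move=> c0; apply: aclose_base.
- exact: loc_basis_base.
by rewrite mulSn addnC natrD; apply: aweight_base.
Qed.

Section FinalFrame.
Variables (U : set C) (j : nat) (w : 'I_n -> M) (nu : 'I_n -> C).
Hypothesis w_inv : frame_inv U j w nu.
Hypothesis nu_step : forall i' i : 'I_n, i = i'.+1 :> nat -> lexle (nu i - nu i') 1.
Variable c0 : C.
Hypothesis c0_U : U c0.
Hypothesis nu_base : c0 != 0 -> forall a b : 'I_n, a = 0%N :> nat -> b.+1 = n ->
  lexle (nu a - nu b) 1.

Let kc (i : 'I_n) : C := if i.+1 == n then c0 else 1.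

Let nu_kc i : kc i != 0 -> lexle (nu (ordS i) - 1) (nu i).
Proof.
have lexle_sub1 x y : lexle (x - y) 1 -> lexle (x - 1) y.
  by rewrite -(lexleD2r (y - 1)); congr (is_true (lexle _ _)); ring.
rewrite /kc; case: (eqVneq i.+1 n) => [e c00|ne _]; apply: lexle_sub1.
  by apply: nu_base => //; have := val_ordS i; rewrite e eqxx.
by apply: nu_step; have := val_ordS i; rewrite (negPf ne).
Qed.

Let fibre_nab i : afib c0 (nab (w i) - (k (kc i) *: w (ordS i) - (tau^-1 * k (nu i)) *: w i)).
Proof.
have := Z_fib c0 (inv_nab w_inv i); rewrite /acoef /kc.
case: (i.+1 == n); last by rewrite rmorph1.
move=> H; have H' := fib_cong c0 (Gt_N Nsp ZN LN (inv_mem w_inv (ordS i))).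
by have := kspaceD (fib_kspace c0) H H'; congr afib; form_ring.
Qed.

Let Gt := asat (afib c0) L.
Let G' := asat (afib c0) (aspan (calg k [:: tau]) w).

Lemma frame_birkhoff : abirkhoff k tau (afib c0) N nab Gt G'.
Proof.
apply: (fibre_birkhoff tau0 (fib_kspace c0) Nsp Lsp (@fib_N c0) LN _ Ntau Ltau N_L
  nab_lin nab_tt _ ptt_inj (inv_fibre w_inv c0_U) fibre_nab n_gt0).
  exact: fib_tau.
exact: fib_nab.
Qed.

Lemma frame_Vplus (K : nzRingType) (le : rel K) (emb : K -> C) (V : K -> set M) :
  lex_embedding le emb -> aKM k tau (afib c0) N nab le emb V ->
  aVplus_cond k tau (afib c0) nab le emb Gt V G'.
Proof.
apply: (fibre_Vplus tau0 (fib_kspace c0) Nsp Lsp (@fib_N c0) LN _ Ntau Ltau N_L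
  nab_lin nab_tt _ ptt_inj (inv_fibre w_inv c0_U) fibre_nab nu_kc n_gt0).
  exact: fib_tau.
exact: fib_nab.
Qed.

End FinalFrame.

End AbstractSystem.

(** * Homogeneous and Laurent polynomials *)

Lemma euler_homog {C : comNzRingType} {n : nat} (d : nat) (p : {mpoly C[n]}) :
  p \is d.-homog -> \sum_i 'X_i * p^`M(i) = d%:R * p.
Proof.
move=> /dhomogP hp; have E (m : 'X_{1..n}) :
    \sum_i 'X_i * ('X_[m] : {mpoly C[n]})^`M(i) = (mdeg m)%:R * 'X_[m].
  rewrite mdegE natr_sum mulr_suml; apply: eq_bigr => i _.
  rewrite mderivX -scalerAr -mpolyXD scaler_nat mulr_natl.
  (* If [x_i] does not occur, the truncated exponent of the derivative is wrong, but its coefficient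
     is 0. *)
  have [->|mi] := posnP (m i); first by rewrite !mulr0n.
  congr ('X_[_] *+ _); rewrite addmC submK //.
  by apply/mnm_lepP => j; rewrite mnm1E; case: eqP => // <-.
rewrite [p]mpolyE; under eq_bigr => i _ do rewrite raddf_sum mulr_sumr.
rewrite exchange_big mulr_sumr /=; apply: eq_big_seq => m /hp <-.
under eq_bigr => i _ do rewrite mderivZ -scalerAr.
by rewrite -scaler_sumr E scalerAr.
Qed.

(** ['X * p] cannot vanish at as many distinct integers as its size; the factor ['X] ensures that
    the point found is nonzero. *)
Lemma poly_nonroot {C : numFieldType} (p : {poly C}) : p != 0 ->
  exists2 s, s != 0 & p.[s] != 0.
Proof.
move=> p0; have q0 : 'X * p != 0 by rewrite mulf_neq0 ?polyX_eq0.
pose rs : seq C := [seq j%:R | j <- iota 0 (size ('X * p))].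
have [] := boolP (all (root ('X * p)) rs).
  move/(max_poly_roots q0); rewrite size_map size_iota ltnn map_inj_uniq ?iota_uniq => [/(_ isT)//|].
  by move=> i j /eqP; rewrite eqr_nat => /eqP.
case/allPn=> s _; rewrite /root hornerM hornerX mulf_eq0 negb_or => /andP[s0 ps].
by exists s.
Qed.

Section Specialisation.
Context {C : numFieldType} {n : nat}.
Implicit Types (p q : {mpoly C[n]}).

Definition specialise (s : C) : {mpoly C[n.+1]} -> {mpoly C[n]} :=
  mmap (@mpolyC n C) (fun i => if insub (val i) is Some j then 'X_j else s%:MP).

Lemma specialise_widen s p : specialise s (mwiden p) = p.
Proof.
move: p; apply: mpoly_alg_ind => [a|i|p q IHp IHq|p q IHp IHq].
- by rewrite mwidenC /specialise mmapC.
- rewrite mwidenX_id /specialise mmapX mmap1U; case: insubP => [j _ /= ij|].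
    by congr 'X__; apply: val_inj.
  by rewrite /= ltn_ord.
- by rewrite mwidenD /specialise mmapD; congr (_ + _).
by rewrite mwidenM /specialise rmorphM; congr (_ * _).
Qed.

Lemma specialise_max s : specialise s 'X_ord_max = s%:MP.
Proof. by rewrite /specialise mmapX mmap1U insubF //= ltnn. Qed.

Lemma specialiseM s : {morph specialise s : p q / p * q}.
Proof. by move=> p q; rewrite /specialise rmorphM. Qed.

Lemma specialiseX s m : {morph specialise s : p / p ^+ m}.
Proof. by move=> p; rewrite /specialise rmorphXn. Qed.

Lemma specialise_poly s (p : {poly C}) :
  specialise s (map_poly (@mpolyC n.+1 C) p).['X_ord_max] = p.[s]%:MP.
Proof.
rewrite !horner_coef size_map_inj_poly ?mpolyC0 //; last first.
  by move=> a b /eqP; rewrite mpolyC_eq => /eqP.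
rewrite /specialise !raddf_sum; apply: eq_bigr => i _ /=.
rewrite coef_map rmorphM mpolyCM; congr (_ * _); first exact: mmapC.
rewrite /= !rmorphXn; congr (_ ^+ _); apply: specialise_max.
Qed.

(* The last variable is specialised to [s], which turns the left side into a
   nonzero constant. *)
Lemma poly_multiple_nonconst p (g : {poly C}) s K (q : {mpoly C[n.+1]}) :
    (forall a, p <> a%:MP) -> s != 0 -> g.[s] != 0 ->
  'X_ord_max ^+ K * (map_poly (@mpolyC n.+1 C) g).['X_ord_max] <> mwiden p * q.
Proof.
move=> pc s0 gs /(congr1 (specialise s)); rewrite !specialiseM specialiseX.
rewrite specialise_max specialise_poly specialise_widen -rmorphXn -mpolyCM => e.
have c0 : s ^+ K * g.[s] != 0 by rewrite mulf_neq0 ?expf_neq0.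
have : p * specialise s q != 0 by rewrite -e mpolyC_eq0.
rewrite mulf_eq0 negb_or => /andP[p0 q0].
have := congr1 (fun u : {mpoly C[n]} => msize u) e.
rewrite msizeC c0 msizeM // (mpolySpred _ q0) addnS /= => sz.
have : (msize p <= 1)%N by rewrite sz leq_addr.
by move/msize1_polyC; apply: pc.
Qed.

End Specialisation.

Lemma ratr_lex_embedding {R : realType} :
  lex_embedding (fun x y : rat => x <= y) (ratr : rat -> R[i]).
Proof.
have E (x : rat) : (ratr x : R[i]) = (ratr x : R)%:C%C.
  by rewrite (fmorph_rat (@real_complex R)).
split=> [|x y|x m]; first exact: fmorph_inj.
  by rewrite /lexle !E /= lexx andbT ltr_rat (inj_eq (fmorph_inj _)) orbC -le_eqVlt.
by rewrite rmorphD rmorph_int.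
Qed.

(** After clearing the powers of [tau^-1] in [b], the equation says that the polynomial [c h - c0]
    in the [x_i] divides a power of [tau] times [p]. It is not constant, since [h] is not and [c] is
    nonzero, so [poly_multiple_nonconst] applies at a point where [p] does not vanish. *)
Lemma laurent_transcendental {C : numFieldType} {n : nat} (h : {mpoly C[n]})
    (k : {rmorphism C -> {fraction {mpoly C[n.+1]}}}) (t tau : {fraction {mpoly C[n.+1]}})
    (c c0 : C) K b (p : {poly C}) :
    t = k c * tofrac (mwiden h) -> tau = tofrac 'X_ord_max ->
    (forall a, k a = tofrac a%:MP) -> (forall a, h <> a%:MP) -> c != 0 ->
    calg k [:: t; tau^-1] b -> ptt k tau p = (t - k c0) * (tau ^+ K * b) ->
  p = 0.
Proof.
move=> tE tauE kE h_nonconst cn0 bA e; apply/eqP; apply: contraT => p0.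
have [s s0 ps] := poly_nonroot p0.
have tau0 : tau != 0 by rewrite tauE tofrac_eq0 -msize_poly_eq0 mmeasureX.
pose S : set {fraction {mpoly C[n.+1]}} := [set a | exists q, a = tofrac q].
have Sac : algebra_closed k S.
  split=> [a|_ _ [q ->] [q' ->]|_ _ [q ->] [q' ->]]; first by exists a%:MP.
    by exists (q + q'); rewrite tofracD.
  by exists (q * q'); rewrite tofracM.
have [J JP] : exists J : nat, forall m, (J <= m)%N -> S (tau ^+ m * b).
  apply: calg_denom (Sac) _ _ bA; first by exists 'X_ord_max; apply: tauE.
  move=> a; rewrite !inE => /orP[]/eqP->.
    by left; exists (c%:MP * mwiden h); rewrite tofracM -kE.
  by right; rewrite mulfV //; apply: ac1 Sac.
have [q qE] := JP J (leqnn _).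
have hc : forall a, c%:MP * h - c0%:MP <> a%:MP.
  move=> a /(canRL (subrK _)) ha; apply: (@h_nonconst (c^-1 * (a + c0))).
  by rewrite mpolyCM mpolyCD -ha mulrA -mpolyCM mulVf // mul1r.
case: (@poly_multiple_nonconst _ _ _ p s J ('X_ord_max ^+ K * q) hc s0 ps).
apply/eqP; rewrite -tofrac_eq; apply/eqP.
rewrite !(tofracM, tofracXn) mwidenB mwidenM !mwidenC tofracB tofracM -qE -!kE.
rewrite -horner_map -map_poly_comp -tauE -tE.
have -> : map_poly (@tofrac _ \o @mpolyC n.+1 C) p = map_poly k p.
  by apply: eq_map_poly => a; rewrite /= kE.
rewrite /= -tauE; move: e; rewrite /ptt => ->; ring.
Qed.

(** * The system of a linear free divisor *)

(* Up to conversion, the forms, relations and filtrations of [Gnum h] and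
   [Grel h f] are the generic ones for these ring morphisms and derivations. *)
Section Instances.
Context {R : realType} {n : nat}.
Local Notation C := R[i].
Local Notation F := (@xtfield R n).

Definition cst : {rmorphism C -> F} := @constF R n.
Definition xpol : {rmorphism {mpoly C[n]} -> F} := @xfun R n.
Definition partial (i : 'I_n) (p : {mpoly C[n]}) : {mpoly C[n]} := p^`M(i).
Definition coord (i : 'I_n) : {mpoly C[n]} := 'X_i.

Lemma base_change_BE (h : {mpoly C[n]}) c s a b : a != b ->
  base_change_B h c s a b =
  (abase cst (@tau R n) (tfun h c) s.1 a b (s.2 a - s.2 b - 1), swap s.2 a b).
Proof. by move=> ab; rewrite -(base_change_B_nu h c s ab). Qed.

End Instances.

Lemma morph_mul_neq0 {C F : fieldType} (k : {rmorphism C -> F}) c y :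
  c != 0 -> y != 0 -> k c * y != 0.
Proof. by move=> c0 y0; rewrite mulf_neq0 // fmorph_eq0. Qed.

Lemma morph_nat_neq0 {C : numFieldType} {F : fieldType} (k : {rmorphism C -> F}) m :
  (0 < m)%N -> m%:R != 0 :> F.
Proof. by move=> m0; rewrite -(rmorph_nat k) fmorph_eq0 pnatr_eq0 -lt0n. Qed.

Lemma deriv_const_mul {F : fieldType} (D : F -> F) a y e : derivation D ->
  D a = 0 -> D y = e * y -> D (a * y) = e * (a * y).
Proof. by move=> der Da Dy; rewrite (derivM der) Da Dy mul0r add0r mulrCA. Qed.

Section System.
Context {R : realType} {n : nat}.
Local Notation C := R[i].
Local Notation F := (@xtfield R n).
Local Notation form := (@rform R n).
Local Notation ta := (@tau R n).
Local Notation D := (@dx_ R n).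
Local Notation Dt := (@dtau R n).
Local Notation x := (@coord R n).
Local Notation k := (@cst R n).
Local Notation xf := (@xpol R n).
Local Notation pd := (@partial R n).
Variables (h f : {mpoly C[n]}) (c : C).
Hypothesis h_nonconst : forall a : C, h <> a%:MP.
Hypothesis h_homog : h \is n.-homog.
Hypothesis f_homog : f \is 1.-homog.
Hypothesis c_neq0 : c != 0.
Implicit Types (u v : form).

Local Notation t := (tfun h c).
Local Notation Z := (Grel h f).
Local Notation N := (Gnum h).
Local Notation L := (aGneg xf ta D h).
Local Notation nab := (nabla_tau f).
Local Notation Eu := (Euler xf ta D Dt x).
Local Notation EW := (Eweight xf ta D Dt x).
Local Notation X := (fun i => xf (x i)).

Let F2 : 2%:R != 0 :> F.
Proof. exact: (@morph_nat_neq0 _ _ k). Qed.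
Let der i : derivation (D i). Proof. exact: dx_der. Qed.
Let dert : derivation Dt. Proof. exact: dtau_der. Qed.
Let D_comm i j a : D i (D j a) = D j (D i a). Proof. exact: dx_comm. Qed.
Let D_Dt i a : D i (Dt a) = Dt (D i a). Proof. exact: dx_dtau_comm. Qed.
Let D_xf i p : D i (xf p) = xf (pd i p). Proof. exact: dx_xfun. Qed.
Let D_k i a : D i (k a) = 0. Proof. exact: dx_constF. Qed.
Let D_tau i : D i ta = 0. Proof. exact: dx_tau. Qed.
Let Dt_xf p : Dt (xf p) = 0. Proof. exact: dtau_xfun. Qed.
Let Dt_tau : Dt ta = 1. Proof. exact: dtau_tau. Qed.
Let tau0 : ta != 0. Proof. exact: tau_neq0. Qed.
Let kE a : k a = xf a%:MP. Proof. by []. Qed.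
Let D_x i j : D i (xf (x j)) = (i == j)%:R.
Proof.
rewrite D_xf /partial /coord mderivXU eq_sym; exact: rmorph_nat.
Qed.
Let h0 : xf h != 0.
Proof.
apply/eqP => xh0; apply: (@h_nonconst 0); rewrite mpolyC0.
by apply: (@xfun_inj R n); rewrite [RHS]rmorph0.
Qed.

Let E_homog d p : p \is d.-homog -> gE D X (xf p) = d%:R * xf p.
Proof.
move=> hp; transitivity (xf (\sum_i 'X_i * p^`M(i))).
  by rewrite [RHS]rmorph_sum; apply: eq_bigr => i _; rewrite D_xf -rmorphM.
by rewrite (euler_homog hp) rmorphM rmorph_nat.
Qed.
Let E_h : gE D X (xf h) = n%:R * xf h. Proof. exact: E_homog. Qed.
Let E_f : gE D X (xf f) = xf f. Proof. by rewrite (E_homog f_homog) mul1r. Qed.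

Let tE : t = k c * xf h. Proof. by []. Qed.
Let tE' : t = xf (c%:MP * h). Proof. by rewrite rmorphM. Qed.
Let t0 : t != 0.
Proof. exact: (@morph_mul_neq0 _ _ k c (xf h) c_neq0 h0). Qed.

Let n_gt0 : (0 < n)%N.
Proof.
case: posnP => // n0; case: (h_nonconst (nvar0_mpolyC_eq _ n0)).
Qed.

Let Zsp : kspace k Z.
Proof.
split; first exact: (aGrel0 xf ta pd der).
move=> a u v Zu Zv; apply: (@aGrelD _ _ _ xf ta pd D) => //.
exact: (@aGrel_k _ _ _ _ k xf (fun a => a%:MP) ta pd D).
Qed.
Let Nsp : kspace k N.
Proof.
split; first exact: (logtau0 xf ta D).
move=> a u v Nu Nv; apply: (logtauD _ Nv); rewrite kE.
exact: (@logtau_xf _ _ _ xf ta pd D).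
Qed.
Let Lsp : kspace k L.
Proof.
split; first exact: (aGneg0 xf ta D).
move=> a u v Nu Nv; apply: (aGnegD _ Nv); rewrite kE.
exact: (@aGneg_xf _ _ _ xf ta pd D).
Qed.
Let ZN : Z `<=` N. Proof. exact (aGrel_Gnum F2 der D_comm D_xf D_tau tau0 h0 (f := f)). Qed.
Let LN : L `<=` N. Proof. exact: (@aGneg_Gnum _ _ _ xf ta D). Qed.
Let Ztau u m : Z u -> Z (ta ^ m *: u). Proof. exact: (@aGrel_tau _ _ _ xf ta pd D). Qed.
Let Ntau u m : N u -> N (ta ^ m *: u). Proof. exact: (@logtau_tau _ _ _ xf ta D). Qed.
Let Ltau u (m : int) : m <= 0 -> L u -> L (ta ^ m *: u).
Proof. exact: (@aGneg_tau _ _ _ xf ta D). Qed.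
Let N_L u : N u -> exists m : nat, L (ta ^ (- m%:Z) *: u).
Proof. by move=> Nu; apply: (@aGnum_neg _ _ _ F2 xf ta D tau0 h h0 u Nu). Qed.
Let Zt u : Z u -> Z (t *: u).
Proof.
move=> Zu; rewrite -[_ *: _](scalerA (k c) (xf h) u).
apply: (@aGrel_k _ _ _ _ k xf (fun a => a%:MP) ta pd D) => //.
exact: (@aGrel_h _ _ _ xf ta pd D der D_xf h f h0 u Zu).
Qed.
Let Nt u : N u -> N (t *: u).
Proof. by rewrite tE'; apply: (@logtau_xf _ _ _ xf ta pd D). Qed.
Let Lt u : L u -> L (t *: u).
Proof. by rewrite tE'; apply: (@aGneg_xf _ _ _ xf ta pd D). Qed.
Let nabZ a u : nab (a *: u) = Dt a *: u + a *: nab u.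
Proof. exact: (anablaZ xf dert). Qed.
Let nabD u v : nab (u + v) = nab u + nab v.
Proof. exact: (anablaD xf dert). Qed.
Let DTk a : Dt (k a) = 0. Proof. exact: dtau_constF. Qed.
Let DTt : Dt t = 0. Proof. rewrite tE'; exact: Dt_xf. Qed.
Let Znab u : Z u -> Z (nab u).
Proof. by move=> Zu; apply: (aGrel_nabla der dert D_Dt D_xf Dt_xf Dt_tau tau0 h0 Zu). Qed.
Let Nnab u : N u -> N (nab u).
Proof.
move=> Nu; apply: (@logtauB _ _ _ xf ta pd D) => //.
  by apply: (logtau_Dt der dert D_xf Dt_xf Dt_tau tau0 h0 Nu).
by apply: (logtau_xf der D_xf f Nu).
Qed.
Let EuD u v : Eu (u + v) = Eu u + Eu v.
Proof. exact: (EulerD (xf := xf) ta der dert D_x). Qed.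
Let EuZ a u : Eu (a *: u) = EW a *: u + a *: Eu u.
Proof. exact: (EulerZ (xf := xf) ta der dert D_x). Qed.
Let EWder : derivation EW. Proof. exact: Eweight_derivation. Qed.
Let EWk a : EW (k a) = 0.
Proof. exact: (@Eweight_k _ _ _ _ k xf (fun a => a%:MP) ta D Dt x). Qed.
Let EWt : EW t = n%:R * t.
Proof.
apply: (deriv_const_mul EWder (EWk c)).
by have := Eweight_xf ta D x Dt_xf h; rewrite E_h.
Qed.
Let EWtau : EW ta = - ta.
Proof. exact: (@Eweight_tau _ _ _ xf ta D Dt x). Qed.
Let ZEu u : Z u -> Z (Eu u).
Proof.
move=> Zu.
by apply: (aGrel_Euler F2 der dert D_comm D_Dt D_xf D_tau Dt_xf Dt_tau tau0 D_x h0 E_h E_f Zu).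
Qed.
Let constFE (a : C) : k a = tofrac (a%:MP : {mpoly C[n.+1]}).
Proof. exact: (congr1 (@tofrac _) (mwidenC n a)). Qed.
Let transc (p : {poly C}) c0 K b : calg k [:: t; ta^-1] b ->
  ptt k ta p = (t - k c0) * (ta ^+ K * b) -> p = 0.
Proof.
move=> bA e.
have tauE : ta = tofrac ('X_ord_max : {mpoly C[n.+1]}) by [].
exact (laurent_transcendental tE tauE constFE h_nonconst c_neq0 bA e).
Qed.
Let nabtE u : nabla_t h f c u = (n%:R * t)^-1 *: (Eu u + ta *: nab u).
Proof. by apply: (anabla_tE ta Dt D_xf E_f t u). Qed.
Let Eu_omega0 j : Eu (omega0 h f j) = j%:R *: omega0 h f j.
Proof. by apply: (Euler_omega0 ta der dert Dt_xf D_x h0 E_h E_f j). Qed.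

Variables (w1 : 'I_n -> form) (nu1 : 'I_n -> C).
Hypothesis w1_omega : is_omega1 h f c w1 nu1.
Local Notation om := (omega0 h f).
Local Notation inv := (frame_inv k ta t Z N L nab Eu om).

Let w1_basis : abasis (calg k [:: t; ta^-1]) Z (asat Z L) w1.
Proof. by case: w1_omega. Qed.

Lemma omega1_inv U : inv U 0 w1 nu1.
Proof.
have [_ [b [bE _]] w1_nab] := w1_omega.
have w1n : aform_nab k ta t Z nab w1 nu1 by apply/aform_nabE.
exact (frame_inv_init tau0 t0 Zsp Nsp Lsp ZN LN Ztau Ntau Ltau N_L Zt Nt Lt
  EuD EuZ EWder EWk EWtau ZEu transc n_gt0 w1_basis Eu_omega0 bE w1n U).
Qed.

Let step_inv U j (s : state) i' i : alg1_cond s i' i -> inv U j s.1 s.2 ->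
  inv U j (alg1_step s i' i).1 (alg1_step s i' i).2.
Proof.
move=> [ii _] sinv.
exact (frame_inv_step tau0 t0 Zsp Nsp Lsp Ztau Ntau Ltau Zt Nt Lt nabD nabZ
  dert DTk Dt_tau EuD EuZ EWder EWk EWtau ii sinv).
Qed.

Lemma alg1_frame_inv U s : alg1 (w1, nu1) s -> inv U 0 s.1 s.2.
Proof.
move=> s1; apply: (alg1_inv (P := fun s => inv U 0 s.1 s.2) _ s1).
  exact: step_inv.
exact: omega1_inv.
Qed.

Lemma alg2_frame_inv j s : alg2 h c (w1, nu1) j s ->
  inv [set c0 | c0 <> 0] j s.1 s.2.
Proof.
move=> s2; rewrite -[j]add0n.
apply: (alg2_inv (P := fun j s => inv [set c0 | c0 <> 0] j s.1 s.2) _ _ s2).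
- by move=> i s' i' i''; apply: step_inv.
- move=> i s' a b [a0 bn lt] sinv; have ab := lexlt_sub1_neq lt.
  rewrite (base_change_BE _ _ _ ab).
  have U0 : ~ [set c0 : C | c0 <> 0] 0 by move=> /(_ erefl).
  exact (frame_inv_base tau0 t0 Zsp Nsp Lsp ZN LN Ztau Ntau Ltau Zt Nt Lt nabD nabZ
    dert DTk DTt Dt_tau EuD EuZ EWder EWk EWt EWtau n_gt0 U0 a0 bn ab sinv).
exact: omega1_inv.
Qed.

(** Algorithm 2 starts with its own run of Algorithm 1, but all runs end with the same [nu], so no
    base change follows. Algorithm 1 never alters the first frame element, and that element together
    with [nu] determines the frame modulo the relations. *)
Lemma algorithms_agree w2 nu2 j w3 nu3 : alg1 (w1, nu1) (w2, nu2) ->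
    alg2 h c (w1, nu1) j (w3, nu3) -> (forall a b, ~ alg2_cond (w2, nu2) a b) ->
  forall i, Z (w3 i - w2 i).
Proof.
move=> A1 A2 nobase; have inv2 := alg1_frame_inv setT A1.
have first_fixed s : alg1 (w1, nu1) s -> s.1 (Ordinal n_gt0) = w1 (Ordinal n_gt0).
  move=> s1; apply: (alg1_inv (P := fun s => s.1 (Ordinal n_gt0) = w1 (Ordinal n_gt0)) _ s1) => //.
  by move=> s' i' i [ii _] /= <-; rewrite -val_eqE /= ii.
have A2s : alg1 (w1, nu1) (w3, nu3).
  inversion A2 => //; case: (nobase i1 il).
  by move: H0 => [a0 bn]; rewrite (alg1_nu H A1).
have inv3 := alg1_frame_inv setT A2s.
have nu23 : nu3 = nu2 := alg1_nu A2s A1.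
have w3n := inv_nab inv3; rewrite /= nu23 in w3n.
have Z0 : Z (w3 (Ordinal n_gt0) - w2 (Ordinal n_gt0)).
  rewrite (first_fixed _ A2s : w3 _ = _) (first_fixed _ A1 : w2 _ = _) subrr.
  exact: kspace0 Zsp.
exact (aform_nab_unique Zsp Ztau nabD nabZ dert Znab
  (erefl : Ordinal n_gt0 = 0%N :> nat) (inv_nab inv2) w3n Z0).
Qed.

Section FinalFrame.
Variables (U : set C) (j : nat) (w : 'I_n -> form) (nu : 'I_n -> C).
Hypothesis w_inv : inv U j w nu.
Hypothesis nu_step : forall i' i, ~ alg1_cond (w, nu) i' i.

Let le_step (i' i : 'I_n) : i = i'.+1 :> nat -> lexle (nu i - nu i') 1.
Proof. exact: (lexle_final nu_step). Qed.

Lemma final_Vplus_solution c0 : U c0 ->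
    (c0 <> 0 -> forall a b, ~ alg2_cond (w, nu) a b) ->
  Vplus_solution h f c c0 (sat (Zfib h f c c0) (rspan (Calg [:: ta]) w)).
Proof.
move=> Uc0 nu_base.
have le_base : c0 != 0 -> forall a b : 'I_n, a = 0%N :> nat -> b.+1 = n ->
    lexle (nu a - nu b) 1.
  move=> /eqP c00 a b a0 bn; rewrite lexleNgt; apply/negP => lt.
  exact: (nu_base c00 a b).
have V (K : nzRingType) le emb (V : K -> set form) : lex_embedding le emb ->
    KM_filtration h f c c0 le emb V ->
    Vplus_cond h f c c0 le emb V (sat (Zfib h f c c0) (rspan (Calg [:: ta]) w)).
  move=> e [V1 V2 V3 V4 V5 V6 V7 V8 _ V10].
  exact (frame_Vplus tau0 Zsp Nsp Lsp ZN LN Ztau Ntau Ltau N_L Nt nabD nabZ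
    dert DTk DTt Dt_tau Znab Nnab transc n_gt0 w_inv le_step Uc0 le_base e
    (AKM V1 V2 V3 V4 V5 V6 V7 V8 V10)).
split.
- exact (frame_birkhoff tau0 Zsp Nsp Lsp ZN LN Ztau Ntau Ltau N_L Nt nabD nabZ
    dert DTk DTt Dt_tau Znab Nnab transc n_gt0 w_inv Uc0).
- by move=> _ W; apply: V; apply: lex_id_embedding.
by move=> _ W; apply: V; apply: ratr_lex_embedding.
Qed.

Lemma final_basis_Vplus_solution c0 : U c0 ->
    (c0 <> 0 -> forall a b, ~ alg2_cond (w, nu) a b) ->
  basis_Vplus_solution h f c c0 w.
Proof.
move=> Uc0 nu_base; split; last exact: final_Vplus_solution.
exact (inv_fibre w_inv Uc0).
Qed.

Lemma frame_nabla_tau i : loc h c Z (nabla_tau f (w i) -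
  frame_mul w (Omega_0 h c + ta^-1 *: A_infty nu) i).
Proof. by apply: aloc_sub; move: i; apply/aform_nabE; apply: inv_nab w_inv. Qed.

Lemma frame_nabla_t i : loc h c Z (nabla_t h f c (w i) -
  frame_mul w ((n%:R * t)^-1 *: (Dtilde j + ta *: Omega_0 h c + A_infty nu)) i).
Proof.
exact (nabt_frame tau0 t0 Zsp Ztau n_gt0 (inv_nab w_inv) (inv_weight w_inv) nabtE (kk := j) erefl i).
Qed.

Lemma final_family_Vplus_solution : (forall c0, c0 <> 0 -> U c0) ->
  (forall a b, ~ alg2_cond (w, nu) a b) -> family_Vplus_solution h f c w.
Proof.
move=> Unz nu_base; split.
- split; first exact (inv_loc w_inv).
  exact (family_frame tau0 t0 Zsp Ztau Zt (inv_loc w_inv)).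
- move=> u Mu; split.
    exact (M0_nab tau0 t0 Zsp Ztau Zt nabD nabZ dert DTk DTt Dt_tau Znab (inv_loc w_inv)
      (inv_nab w_inv) Mu).
  exact (M0_nabt tau0 t0 Zsp Ztau Zt nabD nabZ dert DTk DTt Dt_tau Znab EuD EuZ EWder EWk
    EWt EWtau ZEu (inv_loc w_inv) (inv_nab w_inv) (inv_weight w_inv) nabtE Mu).
move=> c0 c00; have c0' : c0 != 0 by apply/eqP.
have -> : Defs.restrict h f c c0 (sat (loc h c Z) (rspan (Calg [:: t; t^-1; ta]) w)) =
    sat (Zfib h f c c0) (rspan (Calg [:: ta]) w).
  exact (arestrictE t0 Zsp Nsp ZN LN Ntau Zt Nt (inv_mem w_inv) c0').
by apply: final_Vplus_solution => //; apply: Unz.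
Qed.

End FinalFrame.
End System.

Theorem corollary4p12 (R : realType) (n : nat) (h f : {mpoly R[i][n]})
    (hD : linear_free_divisor h) (hh : h \is n.-homog)
    (hf : f \is 1.-homog) (hfin : Rh_finite h f)
    (c : R[i]) (hc : c != 0)
    (w1 : 'I_n -> @rform R n) (nu1 : 'I_n -> R[i])
    (hw1 : is_omega1 h f c w1 nu1) :
  (exists s2, alg1 (w1, nu1) s2) /\
  (exists k s3, alg2 h c (w1, nu1) k s3) /\
  forall (w2 : 'I_n -> @rform R n) (nu2 : 'I_n -> R[i])
         (k : nat) (w3 : 'I_n -> @rform R n) (nu3 : 'I_n -> R[i]),
    alg1 (w1, nu1) (w2, nu2) ->
    alg2 h c (w1, nu1) k (w3, nu3) ->
    (* (i) *)
    [/\ basis_Vplus_solution h f c 0 w2,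
        forall t0 : R[i], t0 <> 0 -> basis_Vplus_solution h f c t0 w3,
        (forall i1 il : 'I_n, i1 = 0%N :> nat -> il.+1 = n ->
           lexle (nu2 i1 - nu2 il) 1) ->
          forall i, Grel h f (w3 i - w2 i),
        forall (t0 : R[i]) (i : 'I_n),
          scale_set tau^-1 (Glat h (Zfib h f c t0)) (w2 i - omega0 h f i)
      & (* each of the k base changes (B) multiplies the leading terms by t *)
        forall (t0 : R[i]) (i : 'I_n),
          scale_set tau^-1 (Glat h (Zfib h f c t0))
            (w3 i - constF (t0 ^+ k) *: omega0 h f i)]
    /\
    (* (ii) *)
    (reductive_divisor h ->
     (forall j,
        loc h c (Grel h f)
          (nabla_tau f (w3 j) -
           frame_mul w3 (Omega_0 h c + tau^-1 *: A_infty nu3) j) /\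
        loc h c (Grel h f)
          (nabla_t h f c (w3 j) -
           frame_mul w3 ((n%:R * tfun h c)^-1 *:
             (Dtilde k + tau *: Omega_0 h c + A_infty nu3)) j)) /\
     family_Vplus_solution h f c w3).
Proof.
have h_nonconst : forall a : R[i], h <> a%:MP by case: hD.
split; first exact: alg1_exists.
split; first exact: alg2_exists.
move=> w2 nu2 k w3 nu3 A1 A2.
have inv2 := alg1_frame_inv h_nonconst hh hf hc hw1 setT A1.
have inv3 := alg2_frame_inv h_nonconst hh hf hc hw1 A2.
have st2 := alg1_final A1.
have [st3 st3'] := alg2_final A2.
split; last first.
  move=> _; split=> [j|].
    split; first exact: (frame_nabla_tau inv3).
    exact: (frame_nabla_t h_nonconst hf hc inv3).
  by apply: (final_family_Vplus_solution h_nonconst hh hf hc inv3).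
split.
(* The inequality between the last and the first entry is required only for a nonzero value of [t];
   here the value is 0, so the stopping of Algorithm 1 suffices. *)
- by apply: (final_basis_Vplus_solution h_nonconst hc inv2 st2) => // /(_ erefl).
- by move=> t0 t00; apply: (final_basis_Vplus_solution h_nonconst hc inv3 st3).
- move=> nu2_le; apply: (algorithms_agree h_nonconst hh hf hc hw1 A1 A2).
  by move=> a b [a0 bn]; rewrite /lexlt (nu2_le a b a0 bn).
- move=> t0 i; have := inv_close inv2 t0 i.
  by rewrite expr0 rmorph1 scale1r.
exact: (inv_close inv3).
Qed.
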